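(* Let $n\ge1$ and let $u=(u_I)_{I\subseteq[n]}$ be a data vector. The critical points $\hat\Theta$ of the parametric log-likelihood function $$L_u(\Theta)=\Bigl(\sum_{I\subseteq[n]}u_I\log\det(\Theta_I)\Bigr)-\Bigl(\sum_{I\subseteq[n]}u_I\Bigr)\log\det(\Theta+\mathrm{Id}_n)$$ are found by solving various likelihood equations on submodels $\mathcal{M}_r$ for $r\le n$, where $\mathcal{M}_r$ is the determinantal point process model on subsets of an $r$-element set. If $u$ is generic, in the sense of algebraic geometry, then the total number of complex critical points of $L_u$ equals $$\sum_{\pi\in\mathcal{P}_n}\ \prod_{i=1}^{|\pi|}\Bigl(2^{|\pi_i|-1}\,\mu_{|\pi_i|}\Bigr),$$ where $\mathcal{P}_n$ is the set of all set partitions $\pi=\{\pi_1,\dots,\pi_{|\pi|}\}$ of $[n]$, $|\pi|$ is the number of parts of $\pi$, and $\mu_r$ is the maximum likelihood degree of the projective variety $\mathcal{V}_r$, the Zariski closure of $\mathcal{M}_r$.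
   Context: Notation. $[n]=\{1,\dots,n\}$. For a symmetric $n\times n$ matrix $\Theta=(\theta_{ij})$ and $I\subseteq[n]$, $\Theta_I$ is the principal submatrix with rows and columns indexed by $I$, and $\det(\Theta_\emptyset)=1$. $\mathrm{Id}_n$ is the identity matrix. A set partition of $[n]$ is a set of nonempty pairwise disjoint subsets (its parts) whose union is $[n]$. Critical points. The data vector $u$ may be any complex vector of length $2^n$. A critical point of $L_u$ is a complex symmetric matrix $\Theta$ with all principal minors $\det(\Theta_I)$ nonzero and $\det(\Theta+\mathrm{Id}_n)\neq0$, at which all $\binom{n+1}{2}$ partial derivatives of $L_u$ with respect to the entries $\theta_{ij}$, $i\le j$ (with $\theta_{ji}=\theta_{ij}$), vanish. These partial derivatives are rational functions of $\Theta$; setting them to zero gives the likelihood equations. The model and its variety. The determinantal point process model $\mathcal{M}_r$ is the set of probability distributions $(p_I)_{I\subseteq[r]}$ with $p_I=\det(\Theta_I)/\det(\Theta+\mathrm{Id}_r)$, where $\Theta$ ranges over positive-definite real symmetric $r\times r$ matrices. $\mathcal{V}_r$ is the Zariski closure of $\mathcal{M}_r$ in the complex projective space $\mathbb{P}^{2^r-1}$ with homogeneous coordinates $p_I$, $I\subseteq[r]$. Maximum likelihood degree. $\mu_r$ is the number of complex critical points, for generic data $w=(w_I)_{I\subseteq[r]}$, of the multivalued function $\sum_{I\subseteq[r]} w_I\log p_I-\bigl(\sum_{I\subseteq[r]} w_I\bigr)\log\bigl(\sum_{I\subseteq[r]} p_I\bigr)$ restricted to $\mathcal{V}_r$; here one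 counts critical points at nonsingular points of $\mathcal{V}_r$ where all $p_I$ and the sum $\sum_I p_I$ are nonzero. Generic. ''Generic in the sense of algebraic geometry'' means that there exists a proper subvariety of the data space $\mathbb{R}^{2^n}$ such that the statement holds for all vectors $u$ outside that subvariety. *)

(* Defs.v *)
From HB Require Import structures.
From mathcomp Require Import all_boot all_order all_algebra.
From mathcomp Require Import complex.
From mathcomp Require Import classical_sets functions cardinality reals.
From mathcomp Require Import mpoly.

Set Implicit Arguments.
Unset Strict Implicit.
Unset Printing Implicit Defensive.

Import Order.TTheory GRing.Theory Num.Theory.

Local Open Scope ring_scope.
Local Open Scope complex_scope.
Local Open Scope classical_set_scope.

(* Vectors (x_I) indexed by the subsets I of an r-element set, the entries
   being listed in the order of [enum {set 'I_r}]. *)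
Notation subset_vec K r := 'rV[K]_(#|{set 'I_r}|).

Definition coord (K : Type) (r : nat) (x : subset_vec K r) (I : {set 'I_r}) : K :=
  x 0 (enum_rank I).

Definition psubmx (K : Type) (n : nat) (A : 'M[K]_n) (I : {set 'I_n}) :
    'M[K]_#|I| :=
  mxsub (@enum_val _ (mem I)) (@enum_val _ (mem I)) A.

Definition block_diagonal (K : nmodType) (n : nat) (P : {set {set 'I_n}})
    (A : 'M[K]_n) : Prop :=
  forall (B : {set 'I_n}) (i j : 'I_n),
    B \in P -> i \in B -> j \notin B -> A i j = 0.

Definition dpp_point (K : fieldType) (r : nat) (T : 'M[K]_r) : subset_vec K r :=
  \row_k (\det (psubmx T (enum_val k)) / \det (T + 1%:M)).

Definition posdef (R : realType) (r : nat) (T : 'M[R]_r) : Prop :=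
  T^T = T /\ forall v : 'rV[R]_r, v != 0 -> 0 < (v *m T *m v^T) 0 0.

(* A subvariety V of P^(N-1) is represented by the set of all its nonzero
   homogeneous coordinate vectors, which is stable under nonzero scaling. *)
Section Projective.
Variables (C : fieldType) (N : nat).
Implicit Types (S V : set 'rV[C]_N) (p v : 'rV[C]_N) (F : {mpoly C[N]}).

Definition proj_zariski_closure S : set 'rV[C]_N :=
  [set p | p != 0 /\
    forall F (d : nat), F \is d.-homog ->
      (forall q, S q -> F.@[q 0] = 0) -> F.@[p 0] = 0].

Definition vanishing_ideal V : set {mpoly C[N]} :=
  [set F | forall p, V p -> F.@[p 0] = 0].

(* Zariski tangent space, at p, of the affine cone over V. *)
Definition cone_tangent V p : set 'rV[C]_N :=
  [set v | forall F, vanishing_ideal V F ->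
    \sum_(k < N) (mderiv k F).@[p 0] * v 0 k = 0].

Definition alg_independent V (d : nat) (f : d.-tuple {mpoly C[N]}) : Prop :=
  forall G : {mpoly C[d]}, vanishing_ideal V (G \mPo f) -> G = 0.

(* The homogeneous coordinate ring of V has transcendence degree
   dim V + 1. *)
Definition proj_dim V (d : nat) : Prop :=
  (exists f : d.+1.-tuple {mpoly C[N]}, alg_independent V f) /\
  (forall k (f : k.-tuple {mpoly C[N]}), alg_independent V f -> (k <= d.+1)%N).

(* Jacobian criterion: the Jacobian of the vanishing ideal has corank
   dim V + 1 at p. *)
Definition nonsingular_point V p : Prop :=
  exists (d : nat) (T : {vspace 'rV[C]_N}),
    [/\ proj_dim V d, \dim T = d.+1
      & forall v, v \in T <-> cone_tangent V p v].

(* The points of P^(N-1) with coordinate vector in S, as lines. *)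
Definition proj_points S : set {vspace 'rV[C]_N} :=
  [set L | exists2 p, S p & L = <[p]>%VS].

End Projective.

Section Generic.
Variables (R : realType) (N : nat).

Definition affine_subvariety (Z : set 'rV[R]_N) : Prop :=
  exists S : set {mpoly R[N]},
    Z = [set u | forall F, S F -> F.@[u 0] = 0].

Definition generically (P : 'rV[R]_N -> Prop) : Prop :=
  exists Z : set 'rV[R]_N,
    [/\ affine_subvariety Z, Z <> setT & forall u, ~ Z u -> P u].

End Generic.

Definition complexify (R : realType) (N : nat) (u : 'rV[R]_N) : 'rV[R[i]]_N :=
  map_mx (real_complex R) u.

Section DPP.
Variable R : realType.

Definition dpp_model (r : nat) : set (subset_vec R r) :=
  [set p | exists2 T : 'M[R]_r, posdef T & p = dpp_point T].

Definition dpp_variety (r : nat) : set (subset_vec R[i] r) :=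
  proj_zariski_closure (@complexify R _ @` @dpp_model r).

(* Partial derivative with respect to p_I of
   sum_J w_J log p_J - (sum_J w_J) log (sum_J p_J). *)
Definition implicit_partial (r : nat) (w p : subset_vec R[i] r)
    (I : {set 'I_r}) : R[i] :=
  coord w I / coord p I - (\sum_J coord w J) / (\sum_J coord p J).

(* The log-likelihood is homogeneous of degree 0, so its restriction to V is
   critical at a nonsingular point exactly when its differential vanishes on
   the tangent space of the affine cone. *)
Definition implicit_critical (r : nat) (w p : subset_vec R[i] r) : Prop :=
  [/\ @dpp_variety r p /\ nonsingular_point (@dpp_variety r) p,
      forall I, coord p I != 0,
      \sum_I coord p I != 0
    & forall v, cone_tangent (@dpp_variety r) p v ->
        \sum_I implicit_partial w p I * coord v I = 0].

Definition is_ml_degree (r m : nat) : Prop :=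
  generically (fun w : subset_vec R r =>
    (proj_points (implicit_critical (complexify w)) #= `I_m)%card).

(* T with its entries (i, j) and (j, i) both replaced by the variable 'X. *)
Definition free_entry (n : nat) (T : 'M[R[i]]_n) (i j : 'I_n) :
    'M[{poly R[i]}]_n :=
  \matrix_(k, l)
    if ((k == i) && (l == j)) || ((k == j) && (l == i)) then 'X
    else (T k l)%:P.

Definition dlog (f : {poly R[i]}) (x : R[i]) : R[i] := (f^`()).[x] / f.[x].

(* Partial derivative of L_u with respect to theta_ij = theta_ji, at T. *)
Definition loglik_partial (n : nat) (u : subset_vec R[i] n) (T : 'M[R[i]]_n)
    (i j : 'I_n) : R[i] :=
  \sum_I coord u I * dlog (\det (psubmx (free_entry T i j) I)) (T i j)
  - (\sum_I coord u I) * dlog (\det (free_entry T i j + 1%:M)) (T i j).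

Definition critical_point (n : nat) (u : subset_vec R[i] n)
    (T : 'M[R[i]]_n) : Prop :=
  [/\ T^T = T,
      forall I, \det (psubmx T I) != 0,
      \det (T + 1%:M) != 0
    & forall i j : 'I_n, (i <= j)%N -> loglik_partial u T i j = 0].

(* Data on the subsets of B, where B is identified with 'I_#|B| by
   [enum_val]: the entry at J is the sum of u_I over the I with
   I :&: B = J. *)
Definition marginal (n : nat) (u : subset_vec R[i] n) (B : {set 'I_n}) :
    subset_vec R[i] #|B| :=
  \row_(k < #|{set 'I_#|B|}|)
    \sum_(I : {set 'I_n} | [set j : 'I_#|B| | enum_val j \in I]%SET == enum_val k)
      coord u I.

End DPP.

(* Main.v *)
(** The equations of L_u only involve, on a block of the support of Theta, the
    marginal data on that block: for a block-diagonal Theta both det(Theta_I)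
    and det(Theta + Id) factor, and derivatives in off-block directions vanish.
    So a critical point decomposes along the connected components of its
    support graph, and it remains to compare connected solutions with critical
    points at nonsingular points of V_r.

    Let Theta be symmetric with nonzero determinant.  If its support is
    connected, the cone over V_r is smooth there, its tangent space is the image
    of the differential of (c, Theta) |-> (c det Theta_I)_I, and Theta is
    determined by its principal minors up to conjugation by signs; hence
    2^(r-1) matrices over each point.  The birational moves
    Theta |-> Theta W^-1, W = 1 + s e_k e_k^T Theta, act linearly on the vector
    of minors, preserve connectedness and fill in the support, which reduces all
    this to matrices without zero entries, where the minors of size at most 3
    determine Theta.  If the support is disconnected and r > 2, second and third
    derivatives of curves through Theta give too many tangent vectors, so the
    point is singular.  For r = 2 the variety is the whole space, and
    generic data have no disconnected critical point.  Every point of V_r with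
    p_emptyset <> 0 comes from a complex symmetric matrix, by a norm argument
    over the sign choices of the square roots of the squared entries. *)

(* Generators of the ideal of V_r are not at hand, so tangent spaces cannot be read off a Jacobian.
   Points of the cone are therefore taken with values in arbitrary rings: over the dual numbers they
   are tangent vectors. A few explicit equations, enough to rebuild a matrix from its minors, then
   show that every tangent vector at a matrix without zero entries comes from a dual matrix. The
   moves extend to this setting because, up to a scalar, they act on minors by a linear map that
   does not depend on Theta and so preserves the ideal. The nonzero determinant survives the moves
   and ensures that the transitive support reached at the end has no empty row. At a disconnected
   matrix all minors are even along a direction joining two blocks. First derivatives vanish there,
   which turns the next Taylor coefficients into tangent vectors. The factor 2^(r-1) counts sign
   vectors modulo a global sign; connectedness makes their action free. *)
Require Import Defs.
From HB Require Import structures.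
From mathcomp Require Import all_boot all_order all_algebra.
From mathcomp Require Import complex.
From mathcomp Require Import boolp classical_sets functions cardinality reals.
From mathcomp Require Import mpoly.
From mathcomp Require Import finset perm ring.

Set Implicit Arguments.
Unset Strict Implicit.
Unset Printing Implicit Defensive.

Import Order.TTheory GRing.Theory Num.Theory.

Local Open Scope ring_scope.
Local Notation coord := Defs.coord.

(** * Principal minors *)

Section Minors.
Variable R : comNzRingType.

(** Sylvester's identity: one block matrix is factored into triangular blocks in two ways. *)
Lemma det_addmul_swap (m k : nat) (U : 'M[R]_(m, k)) (V : 'M[R]_(k, m)) :
  \det (1%:M + U *m V) = \det (1%:M + V *m U).
Proof.
have E1 : block_mx 1%:M (- U) V 1%:M
    = block_mx 1%:M 0 V 1%:M *m block_mx 1%:M (- U) 0 (1%:M + V *m U).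
  rewrite mulmx_block !mul1mx !mulmx0 !mulmx1 ?mul0mx ?addr0 ?add0r mulmxN.
  congr block_mx; last by rewrite addrCA addNr addr0.
have E2 : block_mx 1%:M (- U) V 1%:M
    = block_mx (1%:M + U *m V) (- U) 0 1%:M *m block_mx 1%:M 0 V 1%:M.
  rewrite mulmx_block !mul1mx !mulmx0 !mulmx1 ?mul0mx ?addr0 ?add0r mulNmx.
  by congr block_mx; rewrite -addrA subrr addr0.
have := congr1 determinant E1; rewrite {1}E2 !det_mulmx.
by rewrite !(det_lblock, det_ublock) !det1 !mul1r !mulr1.
Qed.

Lemma det2 (M : 'M[R]_2) :
  \det M = M ord0 ord0 * M ord_max ord_max - M ord0 ord_max * M ord_max ord0.
Proof.
rewrite (expand_det_row _ ord0) !big_ord_recl big_ord0 addr0 /cofactor.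
rewrite !det_mx11 !mxE /= /bump /= expr0 expr1 mul1r mulN1r mulrN.
by congr (_ * M _ _ - M _ _ * M _ _); apply: val_inj.
Qed.

Variable n : nat.
Implicit Types (A : 'M[R]_n) (I J B : {set 'I_n}).

(** Rows outside I become rows of the identity. All minors are then determinants of one size, and no
    matrices over the varying types ['I_#|I|] have to be compared. *)
Definition pmx A I : 'M[R]_n :=
  \matrix_(i, j) if i \in I then A i j else (i == j)%:R.

Definition pm A I : R := \det (pmx A I).

Definition dproj I : 'M[R]_n := diag_mx (\row_i (i \in I)%:R).

Lemma pmxE A I : pmx A I = dproj I *m A + (1%:M - dproj I).
Proof.
apply/matrixP=> i j; rewrite mxE [RHS]mxE mul_diag_mx !mxE.
case: (i \in I); last by rewrite mul0r add0r mul0rn subr0.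
by rewrite mul1r subrr addr0.
Qed.

(** The selection matrix S of f satisfies S S^T = 1 and S^T S = [dproj I], so the padded matrix is 1
    + S^T (S A - S). Swapping the two factors leaves the determinant of S A S^T. *)
Lemma det_mxsub_pm k (f : 'I_k -> 'I_n) A : injective f ->
  \det (mxsub f f A) = pm A [set f i | i in 'I_k].
Proof.
move=> f_inj; set I := [set f i | i in 'I_k].
pose S : 'M[R]_(k, n) := \matrix_(a, j) (f a == j)%:R.
have SX p (X : 'M_(n, p)) : S *m X = rowsub f X.
  apply/matrixP=> a j; rewrite !mxE (bigD1 (f a)) //= mxE eqxx mul1r.
  rewrite big1 ?addr0 // => l; rewrite eq_sym => /negbTE nl.
  by rewrite mxE nl mul0r.
have SS : S *m S^T = 1%:M.
  rewrite SX; apply/matrixP=> a b; rewrite !mxE eq_sym.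
  by rewrite (inj_eq f_inj).
have SP : S^T *m S = dproj I.
  apply/matrixP=> i j; rewrite mxE [RHS]mxE !mxE.
  case: (boolP (i \in I)) => [/imsetP[a _ ->]|/imsetP iI].
    rewrite (bigD1 a) //= !mxE eqxx mul1r big1 ?addr0 // => b nba.
    by rewrite !mxE (inj_eq f_inj) (negbTE nba) mul0r.
  rewrite mul0rn big1 // => b _; rewrite !mxE.
  case: eqP => [fi|_]; last by rewrite mul0r.
  by case: iI; exists b.
rewrite /pm pmxE -SP -mulmxA addrCA -mulmxBr.
rewrite det_addmul_swap mulmxBl -mulmxA SS addrC subrK; congr (\det _).
rewrite SX -[A *m _]trmxK trmx_mul trmxK SX.
by apply/matrixP=> a b; rewrite !mxE.
Qed.

Lemma det_psubmx A I : \det (psubmx A I) = pm A I.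
Proof.
rewrite det_mxsub_pm; last exact: enum_val_inj.
congr pm; apply/setP=> i; apply/imsetP/idP => [[a _ ->]|iI].
  exact: enum_valP.
by exists (enum_rank_in iI i) => //; rewrite enum_rankK_in.
Qed.

Lemma pm_ext A A' I : {in I &, A =2 A'} -> pm A I = pm A' I.
Proof.
move=> AA'; rewrite -!det_psubmx; congr (\det _).
by apply/matrixP=> i j; rewrite !mxE AA' ?enum_valP.
Qed.

Lemma pm0 A : pm A set0 = 1.
Proof.
rewrite /pm (_ : pmx A set0 = 1%:M) ?det1 //.
by apply/matrixP=> i j; rewrite !mxE inE.
Qed.

Lemma pmT A : pm A setT = \det A.
Proof. by congr (\det _); apply/matrixP=> i j; rewrite !mxE inE. Qed.

Lemma pm1 A i : pm A [set i] = A i i.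
Proof.
have -> : [set i] = [set (fun _ : 'I_1 => i) x | x in 'I_1]%SET.
  apply/setP=> j; rewrite inE; apply/eqP/imsetP => [->|[x _ ->] //].
  by exists ord0.
rewrite -det_mxsub_pm; last by move=> x y _; rewrite (ord1 x) (ord1 y).
by rewrite det_mx11 mxE.
Qed.

Lemma pm2 A i j : i != j ->
  pm A [set i; j] = A i i * A j j - A i j * A j i.
Proof.
move=> nij; pose f (x : 'I_2) := if x == ord0 then i else j.
have -> : [set i; j] = [set f x | x in 'I_2]%SET.
  apply/setP=> k; rewrite !inE; apply/orP/imsetP => [[/eqP->|/eqP->]|[x _ ->]].
  - by exists ord0.
  - by exists (lift ord0 ord0).
  by rewrite /f; case: ifP => _; [left|right].
rewrite -det_mxsub_pm; last first.
  have nji : j == i = false by rewrite eq_sym (negbTE nij).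
  move=> x y; rewrite /f.
  case: x => [[|[|//]] Px]; case: y => [[|[|//]] Py] //= h;
    try (by apply: val_inj);
    by move/eqP: h; rewrite ?(negbTE nij) ?nji.
by rewrite det2 !mxE.
Qed.

Lemma pm3 A i j k : i != j -> i != k -> j != k ->
  pm A [set i; j; k] =
    A i i * (A j j * A k k - A j k * A k j)
    - A i j * (A j i * A k k - A j k * A k i)
    + A i k * (A j i * A k j - A j j * A k i).
Proof.
move=> nij nik njk.
pose f (x : 'I_3) := if val x is 0 then i else if val x is 1 then j else k.
have -> : [set i; j; k] = [set f x | x in 'I_3]%SET.
  apply/setP=> l; rewrite !inE.
  apply/idP/imsetP => [/orP[/orP[/eqP->|/eqP->]|/eqP->]|[x _ ->]].
  - by exists ord0.
  - by exists (lift ord0 ord0).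
  - by exists (lift ord0 (lift ord0 ord0)).
  by rewrite /f; case: (val x) => [|[|_]]; rewrite eqxx ?orbT.
rewrite -det_mxsub_pm; last first.
  move=> [[|[|[|//]]] Px] [[|[|[|//]]] Py] /=; rewrite /f /= => h;
    try (by apply: val_inj); move: nij nik njk; rewrite h ?eqxx // -h eqxx //.
rewrite (expand_det_row _ ord0) !big_ord_recl big_ord0 addr0 /cofactor.
rewrite !det2 !mxE /f /= /bump /=.
by rewrite !exprS !expr0; ring.
Qed.

(** The padded matrix itself is the product of the two padded matrices. *)
Lemma pm_block A B I :
  (forall i j, i \in B -> j \notin B -> A i j = 0) ->
  (forall i j, i \in B -> j \notin B -> A j i = 0) ->
  pm A I = pm A (I :&: B) * pm A (I :\: B).
Proof.
move=> AB BA; rewrite /pm -det_mulmx; congr (\det _).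
apply/matrixP=> i j; rewrite mxE [RHS]mxE; under eq_bigr do rewrite !mxE.
case: (boolP (i \in I :&: B)) => [|iIB].
  rewrite inE => /andP[iI iB]; rewrite iI (bigD1 j) //=.
  case: (boolP (j \in B)) => jB; last first.
    rewrite AB // mul0r add0r big1 // => k nkj.
    case: (boolP (k \in B)) => kB; last by rewrite AB ?mul0r.
    by rewrite inE kB /= (negbTE nkj) mulr0.
  rewrite inE jB eqxx mulr1 big1 ?addr0 // => k nkj.
  case: (boolP (k \in B)) => kB; last by rewrite AB ?mul0r.
  by rewrite inE kB /= (negbTE nkj) mulr0.
rewrite (bigD1 i) //= eqxx mul1r big1 ?addr0; last first.
  by move=> k; rewrite eq_sym => /negbTE->; rewrite mul0r.
move: iIB; rewrite !inE negb_and => /orP[/negbTE->|/negbTE iB].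
  by rewrite andbF.
by rewrite iB.
Qed.

Lemma pm_scale A (a b : 'I_n -> R) I :
  pm (\matrix_(i, j) (a i * A i j * b j)) I = (\prod_(i in I) (a i * b i)) * pm A I.
Proof.
pose a' i := if i \in I then a i else 1.
pose b' i := if i \in I then b i else 1.
rewrite (@pm_ext _ (\matrix_(i, j) (a' i * A i j * b' j))); last first.
  by move=> i j iI jI; rewrite !mxE /a' /b' iI jI.
have -> : pm (\matrix_(i, j) (a' i * A i j * b' j)) I
    = \det (diag_mx (\row_i a' i) *m pmx A I *m diag_mx (\row_i b' i)).
  congr (\det _); rewrite mul_diag_mx mul_mx_diag; apply/matrixP=> i j.
  rewrite !mxE.
  case: (boolP (i \in I)) => [//|iI]; case: eqP => [<-|_].
    by rewrite /a' /b' (negbTE iI) !mulr1.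
  by rewrite mulr0 mul0r.
rewrite !det_mulmx !det_diag mulrAC -big_split /=; congr (_ * _).
rewrite [RHS]big_mkcond; apply: eq_bigr => i _; rewrite !mxE /a' /b'.
by case: ifP => // _; rewrite mulr1.
Qed.

Lemma pm_scalar (c : R) A I : pm (c *: A) I = c ^+ #|I| * pm A I.
Proof.
rewrite -prodr_const (_ : c *: A = \matrix_(i, j) (c * A i j * 1)).
  rewrite (pm_scale A (fun=> c) (fun=> 1)); congr (_ * _).
  by apply: eq_bigr => i _; rewrite mulr1.
by apply/matrixP=> i j; rewrite !mxE mulr1.
Qed.

(** In the expansion of the right-hand side, I records the rows in which the entry of A, not that of
    the identity, is chosen. *)
Lemma sum_pm A : \sum_I pm A I = \det (A + 1%:M).
Proof.
rewrite /pm /determinant exchange_big /=; apply: eq_bigr => s _.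
rewrite -big_distrr /=; congr (_ * _).
under [RHS]eq_bigr do rewrite mxE [X in _ + X]mxE.
rewrite bigA_distr; apply: eq_bigr => I _; apply: eq_bigr => i _.
by rewrite mxE; case: ifP => // _; rewrite mxE.
Qed.

End Minors.

Lemma map_pm (R S : comNzRingType) (f : {rmorphism R -> S}) n (A : 'M[R]_n) I :
  f (pm A I) = pm (map_mx f A) I.
Proof.
rewrite /pm -det_map_mx; congr (\det _); apply/matrixP=> i j; rewrite !mxE.
by case: ifP => _ //; rewrite rmorph_nat.
Qed.

Lemma pm_psubmx (R : comNzRingType) n (A : 'M[R]_n) (B : {set 'I_n})
    (J : {set 'I_#|B|}) :
  pm (psubmx A B) J = pm A [set enum_val j | j in J].
Proof.
rewrite -det_psubmx.
have -> : psubmx (psubmx A B) J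
    = mxsub (enum_val \o enum_val) (enum_val \o enum_val) A.
  by apply/matrixP=> i j; rewrite !mxE.
rewrite det_mxsub_pm; last by apply: inj_comp; exact: enum_val_inj.
congr pm; apply/setP=> i; apply/imsetP/imsetP => [[a _ ->]|[j jJ ->]].
  by exists (enum_val a) => //; exact: enum_valP.
by exists (enum_rank_in jJ j) => //=; rewrite enum_rankK_in.
Qed.

(** * A birational move acting linearly on principal minors *)

Section Step.
Variables (R : comUnitRingType) (n : nat).
Implicit Types (A : 'M[R]_n) (I : {set 'I_n}) (k : 'I_n) (s : R).

Definition step k s A : 'M[R]_n :=
  \matrix_(i, j) (A i j - s / (1 + s * A k k) * A i k * A k j).

(* With W = 1 + s e_k e_k^T A one has step k s A = A W^-1 and det W = 1 + s A_kk,
   so multiplying the identity-padded submatrix on the right by W only changes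
   its row k. *)
Lemma pm_step k s A I : 1 + s * A k k \is a GRing.unit ->
  (1 + s * A k k) * pm (step k s A) I =
    pm A I + (if k \in I then 0 else s * pm A (k |: I)).
Proof.
move=> u.
pose W := 1%:M + (s *: delta_mx k ord0) *m (row k A).
have WE i j : W i j = (i == j)%:R + (if i == k then s * A k j else 0).
  rewrite !mxE big_ord1 !mxE eqxx andbT.
  by case: (i == k); rewrite /= ?mulr1 ?mulr0 ?mul0r.
have detW : \det W = 1 + s * A k k.
  rewrite det_addmul_swap det_mx11 !mxE eqxx mulr1n (bigD1 k) //=.
  rewrite [X in _ + (_ + X)]big1.
    by rewrite !mxE !eqxx /= mulr1 addr0 mulrC.
  move=> i /negbTE nik; rewrite !mxE nik /= ?mulr0. 
  by [].
have stepW : step k s A *m W = A.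
  apply/matrixP=> i j; rewrite mxE; under eq_bigr do rewrite WE mulrDr.
  rewrite big_split /= (bigD1 j) //= eqxx mulr1 [X in _ + X + _]big1 ?addr0.
    rewrite (bigD1 k) //= eqxx [X in _ + (_ + X)]big1 ?addr0.
      rewrite !mxE; set v := (_ / _); have E' : v * s * A k k = s - v.
        have E : v * (1 + s * A k k) = s by rewrite /v mulrVK.
        by rewrite -[in RHS]E; ring.
      transitivity (A i j + A i k * A k j * (s - v - v * s * A k k)).
        by ring.
      by rewrite E' subrr mulr0 addr0.
    by move=> l /negbTE->; rewrite mulr0.
  by move=> l /negbTE->; rewrite mulr0.
rewrite -detW mulrC {1}/pm -det_mulmx.
have -> : pmx (step k s A) I *m W =
    \matrix_(i, j) (pmx A I i j +
      (if (i == k) && (k \notin I) then s * A k j else 0)).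
  apply/matrixP=> i j; rewrite [RHS]mxE [pmx A I i j]mxE mxE.
  case: (boolP (i \in I)) => iI.
    under eq_bigr do rewrite mxE iI.
    have /matrixP/(_ i j) := stepW; rewrite mxE => ->.
    by case: (i =P k) => [<-|_]; rewrite ?iI addr0.
  rewrite (bigD1 i) //= mxE (negbTE iI) eqxx mul1r WE big1 ?addr0.
    by case: (i =P k) => // <-; rewrite iI.
  by move=> l nl; rewrite mxE (negbTE iI) eq_sym (negbTE nl) mul0r.
case: ifP => kI.
  rewrite addr0; congr (\det _); apply/matrixP=> i j; rewrite !mxE.
  by rewrite andbF addr0.
(* Only row k has changed: it is now e_k plus s times row k of A. Linearity in that row separates
   the minor on I from the one on [k |: I]. *)
rewrite -[pm A I]mul1r /pm; apply: (determinant_multilinear (i0 := k)).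
- apply/rowP=> j; rewrite !mxE eqxx kI /= !inE eqxx /=; case: eqP => _; ring.
- apply/matrixP=> i j; rewrite !mxE.
  by rewrite [lift k i == k]eq_sym (negbTE (neq_lift _ _)) addr0.
- apply/matrixP=> i j; rewrite !mxE !inE.
  by rewrite [lift k i == k]eq_sym (negbTE (neq_lift _ _)) addr0.
Qed.

(** This is the denominator of the move by [- s] applied after the move by s; being a unit, it makes
    the inverse move available. *)
Lemma step_diag k s A : 1 + s * A k k \is a GRing.unit ->
  1 - s * step k s A k k = (1 + s * A k k)^-1.
Proof.
move=> u; apply: (mulIr u); rewrite mulVr // mxE.
set v := _ / _; have E : v * (1 + s * A k k) = s by rewrite /v mulrVK.
transitivity ((1 - s * A k k) * (1 + s * A k k)
    + s * A k k * A k k * (v * (1 + s * A k k))); first by ring.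
by rewrite E; ring.
Qed.

Lemma step_unit k s A : 1 + s * A k k \is a GRing.unit ->
  1 + - s * step k s A k k \is a GRing.unit.
Proof. by move=> u; rewrite mulNr step_diag // unitrV. Qed.

Lemma stepK k s A : 1 + s * A k k \is a GRing.unit ->
  step k (- s) (step k s A) = A.
Proof.
move=> u; apply/matrixP=> i j; rewrite [LHS]mxE [- s * step _ _ _ _ _]mulNr step_diag // invrK.
have sik l : step k s A l k * (1 + s * A k k) = A l k.
  rewrite mxE; set v := _ / _.
  have E : v * (1 + s * A k k) = s by rewrite /v mulrVK.
  transitivity (A l k * (1 + s * A k k) - A l k * A k k * (v * (1 + s * A k k))).
    by ring.
  by rewrite E; ring.
have skj : step k s A k j * (1 + s * A k k) = A k j.
  rewrite mxE; set v := _ / _.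
  have E : v * (1 + s * A k k) = s by rewrite /v mulrVK.
  transitivity (A k j * (1 + s * A k k) - A k k * A k j * (v * (1 + s * A k k))).
    by ring.
  by rewrite E; ring.
transitivity (step k s A i j + s * (step k s A i k * (1 + s * A k k))
    * (step k s A k j * (1 + s * A k k)) / (1 + s * A k k)).
  set u' := 1 + _ in u *; set S := step k s A.
  transitivity (S i j + s * S i k * u' * S k j * (u' / u')); last by ring.
  by rewrite divrr //; ring.
by rewrite sik skj mxE; ring.
Qed.

Lemma step_sym k s A : A^T = A -> (step k s A)^T = step k s A.
Proof.
move=> /matrixP symA; apply/matrixP=> i j.
have sA x y : A x y = A y x by rewrite -[in RHS]symA mxE.
by rewrite !mxE (sA j i) (sA j k) (sA k i); ring.
Qed.

End Step.

Lemma map_step (R S : comUnitRingType) (f : {rmorphism R -> S}) n k s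
    (A : 'M[R]_n) : 1 + s * A k k \is a GRing.unit ->
  map_mx f (step k s A) = step k (f s) (map_mx f A).
Proof.
move=> u; apply/matrixP=> i j.
by rewrite !mxE rmorphB !rmorphM rmorphV // rmorphD rmorphM rmorph1.
Qed.

(** * Dual numbers *)

(** Pairs a + eps b with eps^2 = 0. The alias keeps the additive structure of the product and leaves
    room for a multiplication that is not componentwise. *)
Definition dual (K : Type) : Type := (K * K)%type.

Section Dual.
Variable K : fieldType.

HB.instance Definition _ := GRing.Zmodule.on (dual K).

Implicit Types x y : dual K.

Definition dual_mul x y : dual K := (x.1 * y.1, x.1 * y.2 + x.2 * y.1).
Definition dual_one : dual K := (1, 0).

Fact dual_mulA : associative dual_mul.
Proof. by move=> x y z; congr pair; rewrite /=; ring. Qed.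

Fact dual_mulC : commutative dual_mul.
Proof. by move=> x y; congr pair; rewrite /=; ring. Qed.

Fact dual_mul1 : left_id dual_one dual_mul.
Proof. by move=> [a b]; congr pair; rewrite /=; ring. Qed.

Fact dual_mulD : left_distributive dual_mul +%R.
Proof. by move=> x y z; congr pair; rewrite /=; ring. Qed.

Fact dual_oner_neq0 : dual_one != 0.
Proof. by apply/eqP=> -[/eqP]; rewrite oner_eq0. Qed.

HB.instance Definition _ := GRing.Zmodule_isComNzRing.Build (dual K)
  dual_mulA dual_mulC dual_mul1 dual_mulD dual_oner_neq0.

Definition dual_unit : pred (dual K) := fun x => x.1 != 0.
Definition dual_inv x : dual K :=
  if x.1 != 0 then (x.1^-1, - x.2 / x.1 ^+ 2) else x.

Fact dual_mulVx : {in dual_unit, left_inverse 1 dual_inv *%R}.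
Proof.
move=> x; rewrite unfold_in /dual_inv => x0; rewrite x0.
by congr pair; rewrite /= ?mulVf //; field.
Qed.

Fact dual_unitP x y : y * x = 1 -> dual_unit x.
Proof.
case=> E _; apply/eqP=> x0; move: E; rewrite x0 mulr0 => /esym/eqP.
by rewrite oner_eq0.
Qed.

Fact dual_inv_out : {in [predC dual_unit], dual_inv =1 id}.
Proof. by move=> x; rewrite /dual_inv inE unfold_in => /negbTE->. Qed.

HB.instance Definition _ := GRing.ComNzRing_hasMulInverse.Build (dual K)
  dual_mulVx dual_unitP dual_inv_out.

Definition dconst (a : K) : dual K := (a, 0).

Fact dconst_zmod : zmod_morphism dconst.
Proof. by move=> a b; congr pair; rewrite /= subrr. Qed.

Fact dconst_monoid : monoid_morphism dconst.
Proof. by split=> // a b; congr pair; rewrite /= mulr0 mul0r addr0. Qed.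

HB.instance Definition _ := GRing.isZmodMorphism.Build _ _ dconst dconst_zmod.
HB.instance Definition _ :=
  GRing.isMonoidMorphism.Build _ _ dconst dconst_monoid.

Definition dfst x : K := x.1.

Fact dfst_zmod : zmod_morphism dfst. Proof. by []. Qed.
Fact dfst_monoid : monoid_morphism dfst. Proof. by []. Qed.

HB.instance Definition _ := GRing.isZmodMorphism.Build _ _ dfst dfst_zmod.
HB.instance Definition _ := GRing.isMonoidMorphism.Build _ _ dfst dfst_monoid.

Definition dsnd x : K := x.2.

Fact dsnd_zmod : zmod_morphism dsnd. Proof. by []. Qed.

HB.instance Definition _ := GRing.isZmodMorphism.Build _ _ dsnd dsnd_zmod.

Lemma dual_unitE x : (x \is a GRing.unit) = (dfst x != 0).
Proof. by []. Qed.

Lemma dfstM x y : dfst (x * y) = dfst x * dfst y. Proof. by []. Qed.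

Lemma dfstX x k : dfst (x ^+ k) = dfst x ^+ k. Proof. exact: rmorphXn. Qed.

Lemma dfst_nat k : dfst k%:R = k%:R. Proof. exact: rmorph_nat. Qed.

Lemma dfstV x : dfst x^-1 = (dfst x)^-1.
Proof.
rewrite /dfst [in LHS]/GRing.inv /= /dual_inv; case: eqP => //= ->.
by rewrite invr0.
Qed.

Lemma dual_mulE x y : x * y = (x.1 * y.1, x.1 * y.2 + x.2 * y.1) :> dual K.
Proof. by []. Qed.

Lemma dual_addE x y : x + y = (x.1 + y.1, x.2 + y.2) :> dual K.
Proof. by []. Qed.

(** Reduction of p modulo the square of X - a. *)
Definition jet (a : K) (p : {poly K}) : dual K := (p.[a], p^`().[a]).

Fact jet_zmod a : zmod_morphism (jet a).
Proof. by move=> p q; congr pair; rewrite /= ?derivB !hornerE. Qed.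

Fact jet_monoid a : monoid_morphism (jet a).
Proof.
split=> [|p q]; first by congr pair; rewrite -polyC1 ?derivC !hornerE.
by rewrite dual_mulE; congr pair; rewrite /= ?derivM !hornerE //= addrC.
Qed.

HB.instance Definition _ a := GRing.isZmodMorphism.Build _ _ (jet a) (jet_zmod a).
HB.instance Definition _ a :=
  GRing.isMonoidMorphism.Build _ _ (jet a) (jet_monoid a).

Lemma mpoly_ring_ind (N : nat) (P : {mpoly K[N]} -> Prop) :
  (forall c, P c%:MP) -> (forall i, P 'X_i) ->
  (forall p q, P p -> P q -> P (p + q)) ->
  (forall p q, P p -> P q -> P (p * q)) -> forall p, P p.
Proof.
move=> PC PX PD PM p; rewrite [p]mpolyE; apply: (big_ind P) => //.
  by rewrite -mpolyC0; exact: (PC _).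
move=> m _; rewrite -mul_mpolyC; apply: (PM _ _ (PC _)).
rewrite mpolyXE_id; apply: (big_ind P _ PM).
  by rewrite -mpolyC1; exact: (PC _).
move=> i _; elim: (m i) => [|k IH]; first by rewrite expr0 -mpolyC1; exact: (PC _).
by rewrite exprS; apply: PM.
Qed.

(** First-order Taylor formula: the eps-part of F at p + eps v is the differential of F at p applied
    to v. *)
Lemma mmap_dconst (N : nat) (h : 'I_N -> dual K) (F : {mpoly K[N]}) :
  mmap dconst h F = (F.@[fun k => (h k).1],
    \sum_(k < N) (mderiv k F).@[fun k => (h k).1] * (h k).2).
Proof.
elim/mpoly_ring_ind: F => [c|i|p q Ep Eq|p q Ep Eq].
- rewrite mmapC mevalC big1 // => k _.
  by rewrite mderivC meval0 mul0r.
- rewrite mmapX mmap1U mevalXU [LHS]surjective_pairing; congr pair.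
  rewrite (bigD1 i) //= mderivX mnm1E eqxx.
  have -> : (U_(i) - U_(i))%MM = 0%MM by apply/mnmP=> j; rewrite mnmBE mnm0E subnn.
  rewrite mpolyX0 scale1r meval1 mul1r big1 ?addr0 // => k nk.
  by rewrite mderivX mnm1E eq_sym (negbTE nk) scale0r meval0 mul0r.
- rewrite rmorphD /= Ep Eq rmorphD dual_addE /= -big_split /=; congr pair.
  by apply: eq_bigr => k _; rewrite mderivD rmorphD mulrDl.
- rewrite rmorphM /= Ep Eq rmorphM dual_mulE; congr pair => /=.
  rewrite [X in X + _]mulr_sumr [X in _ + X]mulr_suml -big_split /=.
  by apply: eq_bigr => k _; rewrite mderivM rmorphD !rmorphM /=; ring.
Qed.

End Dual.

(** * The cone over the image of the principal minor map *)

Section Poly.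
Variable K : numFieldType.

Lemma poly_inj0 (f : nat -> K) (p : {poly K}) :
  injective f -> (forall k, p.[f k] = 0) -> p = 0.
Proof.
move=> f_inj p0; apply/eqP; apply: contraT => pn0.
have allp : all (root p) [seq f k | k <- iota 0 (size p)].
  by apply/allP=> _ /mapP[k _ ->]; apply/rootP.
have := max_poly_roots pn0 allp; rewrite map_inj_uniq // iota_uniq => /(_ isT).
by rewrite size_map size_iota ltnn.
Qed.

Lemma poly_all0 (p : {poly K}) : (forall y, p.[y] = 0) -> p = 0.
Proof.
move=> p0; apply: (@poly_inj0 (fun k => k%:R)) => // a b /eqP.
by rewrite eqr_nat => /eqP.
Qed.

Lemma exists_nonroot (p : {poly K}) : p != 0 -> exists y, p.[y] != 0.
Proof.
move=> pn0; suff /existsNP[y /eqP] : ~ forall y, p.[y] = 0 by exists y.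
by move/poly_all0; apply/eqP.
Qed.

Lemma poly_cofinite0 (p : {poly K}) (q : {poly K}) : q != 0 ->
  (forall y, q.[y] != 0 -> p.[y] = 0) -> p = 0.
Proof.
move=> q0 p0; have /poly_all0/eqP : forall y, (p * q).[y] = 0.
  by move=> y; rewrite hornerM; have [->|/p0->] := eqVneq q.[y] 0; rewrite ?mulr0 ?mul0r.
by rewrite mulf_eq0 (negbTE q0) orbF => /eqP.
Qed.

End Poly.

Lemma mmap_ext (R S : nzRingType) N (f1 f2 : R -> S) (h1 h2 : 'I_N -> S) F :
  f1 =1 f2 -> h1 =1 h2 -> mmap f1 h1 F = mmap f2 h2 F.
Proof.
move=> ef eh; apply: eq_bigr => m _; rewrite ef; congr (_ * _).
by apply: eq_bigr => i _; rewrite eh.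
Qed.

Lemma mmap_rmorph (R S U : nzRingType) N (f : R -> S) (g : {rmorphism S -> U})
    (h : 'I_N -> S) F : g (mmap f h F) = mmap (g \o f) (g \o h) F.
Proof.
rewrite rmorph_sum; apply: eq_bigr => m _; rewrite rmorphM; congr (_ * _).
by rewrite rmorph_prod; apply: eq_bigr => i _; rewrite rmorphXn.
Qed.

Section Cone.
Variables (K : numFieldType) (r : nat).
Local Notation N := #|{set 'I_r}|.
Implicit Types (F : {mpoly K[N]}) (T : 'M[K]_r) (I : {set 'I_r}) (k : 'I_r).

Definition ev (A : nzRingType) (f : K -> A) (x : {set 'I_r} -> A) F : A :=
  mmap f (fun i => x (enum_val i)) F.

(** The ideal of the cone parametrized by all symmetric matrices; [vanishing_idealP] identifies it
    with the ideal of V_r. *)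
Definition minor_ideal F : Prop :=
  forall c T, T^T = T -> ev idfun (fun I => c * pm T I) F = 0.

(** Points of the cone with values in A. For A = K they are ordinary points, for A = [dual K] points
    together with a tangent vector. *)
Definition onV (A : nzRingType) (f : K -> A) (x : {set 'I_r} -> A) : Prop :=
  forall F, minor_ideal F -> ev f x F = 0.

(** The action of [step] on vectors of minors once the factor 1 + s T_kk is cleared. It is linear
    and makes no reference to T. *)
Definition pstep (A : nzRingType) k (s : A) (x : {set 'I_r} -> A) I : A :=
  x I + (if k \in I then 0 else s * x (k |: I)).

Lemma ev_ext (A : nzRingType) (f : K -> A) x y F : x =1 y -> ev f x F = ev f y F.
Proof. by move=> xy; apply: mmap_ext => // k; rewrite xy. Qed.

Lemma onV_ext (A : nzRingType) (f : K -> A) x y : x =1 y -> onV f x -> onV f y.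
Proof. by move=> xy h F /h; rewrite (ev_ext _ _ xy). Qed.

Lemma pm_pstep (A : comUnitRingType) k (s : A) (T : 'M[A]_r) I :
  1 + s * T k k \is a GRing.unit ->
  (1 + s * T k k) * pm (step k s T) I = pstep k s (pm T) I.
Proof. exact: pm_step. Qed.

Lemma pstepK (A : comNzRingType) k (s : A) x : pstep k (- s) (pstep k s x) =1 x.
Proof.
move=> I; rewrite /pstep; case: ifP => kI; first by rewrite !addr0.
rewrite setU11 addr0 -addrA; suff -> : s * x (k |: I) + - s * x (k |: I) = 0.
  by rewrite addr0.
by rewrite mulNr subrr.
Qed.

Lemma pstep_ext (A : nzRingType) k (s : A) x y I :
  x =1 y -> pstep k s x I = pstep k s y I.
Proof. by move=> xy; rewrite /pstep !xy. Qed.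

Lemma pstepZ (A : comNzRingType) k (s c : A) x I :
  pstep k s (fun I => c * x I) I = c * pstep k s x I.
Proof. by rewrite /pstep; case: ifP => _; ring. Qed.

(** At every parameter value the curve lies on the cone, so F yields a polynomial with only zero
    values, hence the zero polynomial. Its image under any ring morphism, such as a truncation, is
    zero as well. *)
Lemma curve_ideal (A : nzRingType) (f : {rmorphism {poly K} -> A}) (c : {poly K})
    (T : 'M[{poly K}]_r) F : T^T = T -> minor_ideal F ->
  ev (f \o polyC) (fun I => f (c * pm T I)) F = 0.
Proof.
move=> symT IF.
have -> : ev (f \o polyC) (fun I => f (c * pm T I)) F
        = f (ev polyC (fun I => c * pm T I) F).
  by rewrite /ev mmap_rmorph.
rewrite [ev _ _ _](_ : _ = 0) ?rmorph0 //; apply: poly_all0 => y.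
rewrite -horner_evalE mmap_rmorph /=.
rewrite -[RHS](IF c.[y] (map_mx (horner_eval y) T)).
  apply: mmap_ext => [a|k] /=; first by rewrite horner_evalE hornerC.
  by rewrite horner_evalE hornerM -map_pm.
by rewrite map_trmx symT.
Qed.

Definition subst_step k s F : {mpoly K[N]} :=
  F \mPo [tuple 'X_i + (if k \in enum_val i then 0
                         else s *: 'X_(enum_rank (k |: enum_val i))) | i < N].

Lemma ev_subst_step (A : comNzRingType) (f : {rmorphism K -> A}) k s x F :
  ev f x (subst_step k s F) = ev f (pstep k (f s) x) F.
Proof.
rewrite /ev /subst_step /comp_mpoly mmap_rmorph; apply: mmap_ext => [a|i] /=.
  by rewrite mmapC.
rewrite tnth_mktuple rmorphD /= mmapX mmap1U /pstep; congr (_ + _).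
case: ifP => _; first by rewrite rmorph0.
by rewrite mmapZ mmapX mmap1U enum_rankK.
Qed.

(** If 1 + s T_kk is nonzero, the transformed vector is a multiple of the minors of [step k s T].
    The excluded matrices are reached by adding y to T_kk: the result is a polynomial in y vanishing
    off the roots of a nonzero polynomial, so it vanishes at y = 0 too. *)
Lemma subst_step_ideal k s F : minor_ideal F -> minor_ideal (subst_step k s F).
Proof.
move=> IF c T symT; rewrite ev_subst_step /=.
pose TX : 'M[{poly K}]_r := map_mx polyC T + ('X *: delta_mx k k).
pose P : {poly K} := ev polyC (pstep k s%:P (fun I => c%:P * pm TX I)) F.
have PE y : P.[y] = ev idfun (pstep k s
    (fun I => c * pm (T + y *: delta_mx k k) I)) F.
  rewrite /P -horner_evalE mmap_rmorph; apply: mmap_ext => [a|i] /=.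
    by rewrite horner_evalE hornerC.
  have E I : (c%:P * pm TX I).[y] = c * pm (T + y *: delta_mx k k) I.
    rewrite hornerM hornerC -horner_evalE map_pm; congr (_ * pm _ _).
    apply/matrixP=> a b; rewrite !mxE /= horner_evalE !hornerE.
    by case: (_ && _); rewrite !hornerE.
  rewrite horner_evalE /pstep hornerD E; case: ifP => _; first by rewrite horner0.
  by rewrite hornerM hornerC E.
suff P0 : P = 0.
  have := PE 0; rewrite P0 horner0 scale0r addr0 => <- //.
have q0 : (1 + s * T k k)%:P + s *: 'X != 0 :> {poly K}.
  have [->|s0] := eqVneq s 0.
    by rewrite scale0r mul0r !addr0 polyC_eq0 oner_eq0.
  apply/eqP=> /(congr1 (coefp 1)); rewrite /= coefD coefC coefZ coefX /=.
  by rewrite add0r mulr1 coef0 => /eqP; rewrite (negbTE s0).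
apply: (poly_cofinite0 q0) => y; rewrite !hornerE => u; rewrite PE.
set Ty := T + _.
have uy : 1 + s * Ty k k \is a GRing.unit.
  by rewrite unitfE !mxE !eqxx /= mulr1 mulrDr addrA.
rewrite -[RHS](IF (c * (1 + s * Ty k k)) (step k s Ty)); last first.
  by apply: step_sym; rewrite /Ty linearD linearZ /= trmx_delta symT.
by apply: ev_ext => I; rewrite pstepZ -mulrA pm_pstep.
Qed.

Lemma onV_pstep (A : comNzRingType) (f : {rmorphism K -> A}) k s x :
  onV f x -> onV f (pstep k (f s) x).
Proof. by move=> Vx F IF; rewrite -ev_subst_step Vx //; apply: subst_step_ideal. Qed.

Lemma onV_scale (A : comNzRingType) (f : {rmorphism K -> A}) s x :
  onV f x -> onV f (fun I => f s * x I).
Proof.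
move=> Vx F IF.
pose G := F \mPo [tuple s *: 'X_i | i < N].
have evG (B : comNzRingType) (g : {rmorphism K -> B}) y :
    ev g y G = ev g (fun I => g s * y I) F.
  rewrite /ev /G /comp_mpoly mmap_rmorph; apply: mmap_ext => [a|i] /=.
    by rewrite mmapC.
  by rewrite tnth_mktuple mmapZ mmapX mmap1U.
rewrite -evG; apply: Vx => c T symT; rewrite evG -[RHS](IF (s * c) T symT).
by apply: ev_ext => I; rewrite /= mulrA.
Qed.

Lemma onV_psi c T : T^T = T -> onV idfun (fun I => c * pm T I).
Proof. by move=> symT F IF; apply: IF. Qed.

End Cone.

Section DualCone.
Variables (K : numFieldType) (r : nat).
Implicit Types (T : 'M[K]_r) (I : {set 'I_r}).

(** Dual data are the jets at 0 of affine lines of scalars and matrices, to which [curve_ideal]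
    applies. *)
Lemma onV_dual (c : dual K) (T : 'M[dual K]_r) : T^T = T ->
  onV (@dconst K) (fun I => c * pm T I).
Proof.
move=> /matrixP symT F IF.
pose lin (a : dual K) : {poly K} := a.1%:P + a.2 *: 'X.
have jet_lin a : jet 0 (lin a) = a.
  rewrite [RHS]surjective_pairing /jet /lin; congr pair; first by rewrite !hornerE.
  by rewrite derivD derivC derivZ derivX add0r !hornerE.
have := @curve_ideal K r _ (jet 0) (lin c) (map_mx lin T) F.
move=> /(_ _ IF) <-.
  apply: mmap_ext => [a|k] /=.
    by rewrite /jet /dconst hornerC derivC horner0.
  rewrite rmorphM /= jet_lin map_pm; congr (_ * pm _ _).
  by apply/matrixP=> i j; rewrite !mxE /= jet_lin.
by apply/matrixP=> i j; rewrite !mxE -[in RHS]symT mxE.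
Qed.

End DualCone.

(** * Connectedness of the support *)

Section Support.
Variables (K : numFieldType) (r : nat).
Implicit Types (T : 'M[K]_r) (B : {set 'I_r}).

Definition separated B T : Prop := forall i j, i \in B -> j \notin B -> T i j = 0.

(** Connectedness of the support graph of a symmetric matrix, stated by cuts instead of paths since
    [step] visibly preserves cuts. *)
Definition connected_mx T : Prop :=
  forall B, separated B T -> B = set0 \/ B = setT.

Definition transitive_support T : Prop :=
  forall i k j, T i k != 0 -> T k j != 0 -> T i j != 0.

Lemma sym_entry (A : Type) (T : 'M[A]_r) i j : T^T = T -> T i j = T j i.
Proof. by move=> symT; rewrite -[in RHS]symT mxE. Qed.

Lemma separated_step B T k s : T^T = T -> separated B T ->
  separated B (step k s T).
Proof.
move=> symT sB i j iB jB; rewrite mxE sB // sub0r.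
have [kB|kB] := boolP (k \in B); first by rewrite (sB k j) // mulr0 oppr0.
by rewrite (sB i k) // mulr0 mul0r oppr0.
Qed.

Lemma connected_step T k s : 1 + s * T k k != 0 -> T^T = T ->
  connected_mx T -> connected_mx (step k s T).
Proof.
move=> u symT cT B sB; apply: cT; rewrite -(@stepK _ _ k s T) ?unitfE //.
by apply: separated_step => //; apply: step_sym.
Qed.

Lemma disconnected_step T k s : 1 + s * T k k != 0 -> T^T = T ->
  ~ connected_mx T -> ~ connected_mx (step k s T).
Proof.
move=> u symT ncT cT; apply: ncT; rewrite -(@stepK _ _ k s T) ?unitfE //.
apply: connected_step => //; last exact: step_sym.
by rewrite -unitfE step_unit // unitfE.
Qed.

Lemma det_step T k s : 1 + s * T k k != 0 -> \det T != 0 ->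
  \det (step k s T) != 0.
Proof.
move=> u; rewrite -!pmT; apply: contraNneq => s0.
have := @pm_step _ _ k s T setT; rewrite unitfE => /(_ u).
by rewrite s0 mulr0 in_setT addr0 => <-.
Qed.

Lemma exists_step T i k j : T i k != 0 -> T k j != 0 -> T i j = 0 ->
  exists s, [/\ 1 + s * T k k != 0, step k s T i j != 0
    & forall a b, T a b != 0 -> step k s T a b != 0].
Proof.
move=> ik kj ij.
pose lin (a b : K) : {poly K} := a%:P + b *: 'X.
have lin_neq0 a b : a != 0 -> lin a b != 0.
  move=> a0; apply/eqP=> /(congr1 (horner^~ 0)).
  by rewrite /lin !hornerE => /eqP; rewrite (negbTE a0).
(* A nonroot s of p is nonzero, keeps 1 + s T_kk nonzero, and keeps every nonzero entry nonzero: the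
   factor for (a, b) is 1 + s T_kk times the entry after the move. *)
pose p := 'X * lin 1 (T k k) *
  \prod_(ab : 'I_r * 'I_r | T ab.1 ab.2 != 0)
    lin (T ab.1 ab.2) (T k k * T ab.1 ab.2 - T ab.1 k * T k ab.2).
have : p != 0.
  rewrite !mulf_neq0 ?polyX_eq0 ?lin_neq0 ?oner_eq0 //.
  by apply/prodf_neq0 => -[a b] /= ab; apply: lin_neq0.
case/exists_nonroot=> s; rewrite /p /lin !hornerE horner_prod mulf_eq0 negb_or.
rewrite mulf_eq0 negb_or => /andP[/andP[s0]]; rewrite mulrC => u /prodf_neq0 ps.
exists s; split=> // [|a b ab].
  by rewrite mxE ij sub0r oppr_eq0 !mulf_neq0 // invr_neq0.
have := ps (a, b) ab; rewrite /= !hornerE; apply: contraNneq.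
rewrite mxE => E; apply/eqP; transitivity
  ((1 + s * T k k) * (T a b - s / (1 + s * T k k) * T a k * T k b)).
  by field.
by rewrite E mulr0.
Qed.

(* Each step can enlarge the support until it becomes transitive. *)
Lemma step_ind (P : 'M[K]_r -> Prop) :
  (forall T, T^T = T -> \det T != 0 -> transitive_support T -> P T) ->
  (forall T k s, T^T = T -> \det T != 0 -> 1 + s * T k k != 0 ->
     P (step k s T) -> P T) ->
  forall T, T^T = T -> \det T != 0 -> P T.
Proof.
move=> Pend Pstep T.
pose supp T := [set ab : 'I_r * 'I_r | T ab.1 ab.2 != 0].
have [m] := ubnP (#|~: supp T|); elim: m T => // m IH T le_m symT detT.
have [|] := boolP [exists ikj : 'I_r * 'I_r * 'I_r,
    [&& T ikj.1.1 ikj.1.2 != 0, T ikj.1.2 ikj.2 != 0 & T ikj.1.1 ikj.2 == 0]].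
  case/existsP=> -[[i k] j] /= /and3P[ik kj /eqP ij].
  have [s [u sij sab]] := exists_step ik kj ij.
  apply: (Pstep _ k s) => //; apply: IH; last exact: det_step.
    rewrite -ltnS; apply: leq_trans le_m; rewrite ltnS; apply: proper_card.
    apply/properP; split.
      by apply/fintype.subsetP=> -[a b]; rewrite !inE; apply: contra => /= /sab.
    by exists (i, j); rewrite !inE /= ?ij ?eqxx ?negbK.
  exact: step_sym.
rewrite negb_exists => /forallP tr; apply: Pend => // i k j ik kj.
by have := tr (i, k, j); rewrite /= ik kj.
Qed.

Lemma row_neq0 T i : \det T != 0 -> exists j, T i j != 0.
Proof.
move=> detT; apply/existsP; apply: contraNT detT.
rewrite negb_exists => /forallP ri0; rewrite (expand_det_row _ i) big1 // => j _.
by have := ri0 j; rewrite negbK => /eqP->; rewrite mul0r.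
Qed.

(** By transitivity no edge leaves the set of neighbours of i, and this set is nonempty because a
    zero row would kill the determinant. *)
Lemma transitive_connected_full T : T^T = T -> \det T != 0 ->
  transitive_support T -> connected_mx T -> forall i j, T i j != 0.
Proof.
move=> symT detT trT cT i j; pose B := [set j | T i j != 0].
have [/setP B0|/setP/(_ j)] : B = set0 \/ B = setT.
- apply: cT => a b; rewrite !inE negbK => Ta /eqP Tb.
  apply/eqP; apply: contraT => ab; have := trT _ _ _ Ta ab.
  by rewrite Tb eqxx.
- have [k ik] := row_neq0 i detT.
  by have := B0 k; rewrite !inE ik.
by rewrite !inE.
Qed.

Lemma transitive_diag T : T^T = T -> \det T != 0 ->
  transitive_support T -> forall i, T i i != 0.
Proof.
move=> symT detT trT i; have [k ik] := row_neq0 i detT.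
by apply: (trT _ k); rewrite // sym_entry.
Qed.

End Support.

(** * Reconstructing a matrix with nonzero entries from its principal minors *)

Section Relation.
Variables (r : nat) (o : 'I_r).
Implicit Types (I : {set 'I_r}).

Section Ring.
Variable A : comNzRingType.
Implicit Types (x : {set 'I_r} -> A) (T : 'M[A]_r).

(* At x = c pm T with T symmetric, these are c^2 T_ij^2 and
   2 c^3 T_oi T_ij T_oj. *)
Definition sqform x i j : A :=
  x [set i] * x [set j] - (if i == j then 0 else x set0 * x [set i; j]).

Definition triform x i j : A :=
  (if [&& o != i, o != j & i != j] then x set0 ^+ 2 * x [set o; i; j] else 0)
  - x [set o] * x [set i] * x [set j] + x [set o] * sqform x i j
  + x [set i] * sqform x o j + x [set j] * sqform x o i.

(** At x = c pm T the matrix of [triform] is 2 c^3 D T D with D = diag(T_oi), so its minor on I is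
    that of T times factors expressible through [sqform]. The exponent is [#|I|.-1] because x I
    already carries one factor c. *)
Definition minor_relation x I : A :=
  pm (\matrix_(i, j) triform x i j) I
  - 2%:R ^+ #|I| * (\prod_(i in I) sqform x o i) * x I * x set0 ^+ #|I|.-1.

Lemma sqformE c T i j : T^T = T ->
  sqform (fun I => c * pm T I) i j = c ^+ 2 * T i j ^+ 2.
Proof.
move=> symT; rewrite /sqform !pm1 pm0; case: eqP => [<-|/eqP nij].
  by rewrite subr0; ring.
by rewrite pm2 // (sym_entry j i symT); ring.
Qed.

Lemma triformE c T i j : T^T = T ->
  triform (fun I => c * pm T I) i j = 2%:R * c ^+ 3 * (T o i * T i j * T o j).
Proof.
move=> symT; rewrite /triform !sqformE // !pm1 pm0.
have [<-|noi] := eqVneq o i; first by rewrite /=; ring.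
have [<-|noj] := eqVneq o j.
  by rewrite /= (sym_entry i o symT); ring.
have [<-|nij] := eqVneq i j; first by rewrite /=; ring.
rewrite /= pm3 // (sym_entry i o symT) (sym_entry j o symT) (sym_entry j i symT).
by ring.
Qed.

Lemma minor_relation_pm c T I : T^T = T -> I != set0 ->
  minor_relation (fun I => c * pm T I) I = 0.
Proof.
move=> symT; rewrite -card_gt0 => I0; rewrite /minor_relation pm0 mulr1.
rewrite (_ : \matrix_(i, j) _ = \matrix_(i, j)
    ((2%:R * c ^+ 3 * T o i) * T i j * T o j)); last first.
  by apply/matrixP=> i j; rewrite !mxE triformE //; ring.
rewrite pm_scale (eq_bigr (fun i => 2%:R * c * (c ^+ 2 * T o i ^+ 2))); last first.
  by move=> i _; ring.
rewrite big_split /= prodr_const exprMn.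
rewrite [X in _ - _ * X * _ * _](eq_bigr (fun i => c ^+ 2 * T o i ^+ 2)); last first.
  by move=> i _; rewrite sqformE.
have -> : c ^+ #|I| = c * c ^+ #|I|.-1 by rewrite -exprS prednK.
by ring.
Qed.

End Ring.

Lemma sqform_rmorph (A B : comNzRingType) (g : {rmorphism A -> B}) x i j :
  g (sqform x i j) = sqform (g \o x) i j.
Proof. by rewrite /sqform rmorphB rmorphM; case: eqP => _; rewrite ?rmorph0 ?rmorphM. Qed.

Lemma triform_rmorph (A B : comNzRingType) (g : {rmorphism A -> B}) x i j :
  g (triform x i j) = triform (g \o x) i j.
Proof.
rewrite /triform !rmorphD rmorphN !rmorphM !sqform_rmorph; congr (_ - _ + _ + _ + _).
by case: ifP => _; rewrite ?rmorph0 ?rmorphM ?rmorphXn.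
Qed.

Lemma minor_relation_rmorph (A B : comNzRingType) (g : {rmorphism A -> B}) x I :
  g (minor_relation x I) = minor_relation (g \o x) I.
Proof.
rewrite /minor_relation rmorphB map_pm !rmorphM !rmorphXn rmorph_nat.
congr (pm _ _ - _ * _ * _ * _).
  by apply/matrixP=> i j; rewrite !mxE /= triform_rmorph.
by rewrite rmorph_prod; apply: eq_bigr => i _; rewrite sqform_rmorph.
Qed.

(** Read in the variables of the polynomial ring, the relation is an element of [minor_ideal]; it
    therefore holds at points over any ring, in particular over the dual numbers. *)
Lemma onV_minor_relation (K : numFieldType) (A : comNzRingType)
    (f : {rmorphism K -> A}) x I :
  I != set0 -> onV f x -> minor_relation x I = 0.
Proof.
move=> I0 Vx.
pose G : {mpoly K[#|{set 'I_r}|]} :=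
  minor_relation (fun J => 'X_(enum_rank J)) I.
have evG (B : comNzRingType) (g : {rmorphism K -> B}) y :
    ev g y G = minor_relation y I.
  rewrite /ev /G minor_relation_rmorph /minor_relation /=.
  have xE J : mmap g (fun i => y (enum_val i)) 'X_(enum_rank J) = y J.
    by rewrite mmapX mmap1U enum_rankK.
  rewrite /triform /sqform /= !xE; congr (pm _ _ - _ * _ * _ * _).
    by apply/matrixP=> i j; rewrite !mxE !xE.
  by apply: eq_bigr => i _; rewrite !xE.
rewrite -(evG _ f); apply: Vx => c T symT.
by rewrite (evG _ idfun) minor_relation_pm.
Qed.

Lemma triform_sym (A : comNzRingType) (x : {set 'I_r} -> A) i j :
  triform x j i = triform x i j.
Proof.
rewrite /triform /sqform [j == i]eq_sym [[set j; i]]setUC [in LHS]setUAC.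
by rewrite [(o != j) && _]andbCA; case: ifP => _; case: ifP => _; ring.
Qed.

(** The formula for [triform] solved for T_ij, with [m i] standing for a chosen square root of
    T_oi^2. *)
Definition rebuilt (A : comUnitRingType) (x : {set 'I_r} -> A) (m : 'I_r -> A) :
    'M[A]_r :=
  \matrix_(i, j) (triform x i j / (2%:R * x set0 ^+ 3 * (m i * m j))).

Lemma rebuilt_sym (A : comUnitRingType) (x : {set 'I_r} -> A) m :
  (rebuilt x m)^T = rebuilt x m.
Proof.
by apply/matrixP=> i j; rewrite !mxE triform_sym [m j * _]mulrC.
Qed.

(** Under these hypotheses every factor multiplying x I in [minor_relation] is a unit, so the
    relation determines x I. *)
Lemma pm_rebuilt (A : comUnitRingType) (x : {set 'I_r} -> A) m I :
  (2%:R : A) \is a GRing.unit -> x set0 \is a GRing.unit ->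
  (forall i, m i \is a GRing.unit) ->
  (forall i, x set0 ^+ 2 * (m i * m i) = sqform x o i) ->
  minor_relation x I = 0 -> I != set0 -> x I = x set0 * pm (rebuilt x m) I.
Proof.
move=> U2 U0 Um m2 /eqP; rewrite /minor_relation subr_eq0 => /eqP E.
rewrite -card_gt0 => I0.
have denU i j : 2%:R * x set0 ^+ 3 * (m i * m j) \is a GRing.unit.
  by rewrite unitrM unitrM U2 unitrX // unitrM !Um.
move: E; rewrite (_ : \matrix_(i, j) _ =
    \matrix_(i, j) ((2%:R * x set0 ^+ 3 * m i) * rebuilt x m i j * m j)); last first.
  apply/matrixP=> i j; rewrite !mxE -[LHS](divrK (denU i j)).
  by ring.
rewrite pm_scale (eq_bigr (fun i => 2%:R * x set0 * sqform x o i)); last first.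
  by move=> i _; rewrite -m2; ring.
rewrite big_split /= prodr_const exprMn => E.
have pU : 2%:R ^+ #|I| * (\prod_(i in I) sqform x o i) * x set0 ^+ #|I|.-1
    \is a GRing.unit.
  rewrite unitrM unitrM !unitrX // andbT /=; apply: rpred_prod => i _.
  by rewrite -m2 unitrM unitrX // unitrM !Um.
have xE : x set0 ^+ #|I| = x set0 * x set0 ^+ #|I|.-1 by rewrite -exprS prednK.
by apply: (mulrI pU); rewrite mulrAC -E xE; ring.
Qed.

End Relation.

(** * Lifting and rigidity over a connected matrix *)

Section Lift.
Variables (K : numFieldType) (r : nat).
Implicit Types (T : 'M[K]_r) (I : {set 'I_r}).

(** The differential of (c, T) |-> c pm T reaches the whole tangent space; [rigid_duals] is its
    injectivity in the matrix directions. In dual-number form both can be carried along [step]. *)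
Definition lifts_duals T : Prop :=
  forall (c : K) (x : {set 'I_r} -> dual K), c != 0 ->
    onV (@dconst K) x -> (forall I, dfst (x I) = c * pm T I) ->
  exists (c' : dual K) (T' : 'M[dual K]_r),
    [/\ T'^T = T', map_mx (@dfst K) T' = T, dfst c' = c
      & forall I, x I = c' * pm T' I].

Definition rigid_duals T : Prop :=
  forall T' : 'M[dual K]_r, T'^T = T' -> map_mx (@dfst K) T' = T ->
    (forall I, pm T' I = dconst (pm T I)) -> T' = map_mx (@dconst K) T.

Definition rigid_signs T : Prop :=
  forall T', T'^T = T' -> (forall I, pm T' I = pm T I) ->
    exists d : 'I_r -> K, (forall i, d i = 1 \/ d i = -1) /\
      forall i j, T' i j = d i * T i j * d j.

Lemma lifts_duals_step k s T : 1 + s * T k k != 0 ->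
  lifts_duals (step k s T) -> lifts_duals T.
Proof.
move=> u Lstep c x c0 Vx x1; have uU : 1 + s * T k k \is a GRing.unit by rewrite unitfE.
have [c' [T' [symT' T'1 c'1 xE]]] : exists (c' : dual K) (T' : 'M[dual K]_r),
    [/\ T'^T = T', map_mx (@dfst K) T' = step k s T,
      dfst c' = c * (1 + s * T k k)
      & forall I, pstep k (dconst s) x I = c' * pm T' I].
  apply: Lstep; first by rewrite mulf_neq0.
    exact: onV_pstep.
  move=> I; rewrite -mulrA pm_pstep // -pstepZ /pstep rmorphD /= x1.
  by case: ifP => _; rewrite ?rmorph0 // rmorphM /= x1.
have T'kk : dfst (T' k k) = step k s T k k by rewrite -T'1 mxE.
(* The denominator of the inverse move, to be absorbed into the scalar. *)
pose e : dual K := 1 + - dconst s * T' k k.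
have e1 : dfst e = (1 + s * T k k)^-1.
  by rewrite rmorphD rmorph1 rmorphM rmorphN /= T'kk mulNr step_diag.
have eU : e \is a GRing.unit by have := invr_neq0 u; rewrite -e1.
exists (c' * e), (step k (- dconst s) T'); split.
- exact: step_sym.
- by rewrite map_step // T'1 rmorphN /= stepK.
- by transitivity (dfst c' * dfst e); rewrite // e1 c'1 mulfK.
move=> I; rewrite -mulrA [e * _]pm_pstep // -[LHS](pstepK k (dconst s) x) -pstepZ.
exact: pstep_ext.
Qed.

Lemma rigid_duals_step k s T : 1 + s * T k k != 0 ->
  rigid_duals (step k s T) -> rigid_duals T.
Proof.
move=> u Rstep T' symT' T'1 pmT'.
have uU : 1 + s * T k k \is a GRing.unit by rewrite unitfE.
have T'kk : T' k k = dconst (T k k) by rewrite -pm1 pmT' pm1.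
have u'E : 1 + dconst s * T' k k = dconst (1 + s * T k k).
  by rewrite T'kk rmorphD rmorphM rmorph1.
have u' : 1 + dconst s * T' k k \is a GRing.unit by rewrite u'E dual_unitE.
have : step k (dconst s) T' = map_mx (@dconst K) (step k s T).
  apply: Rstep; first exact: step_sym.
    by rewrite map_step // T'1.
  move=> I; apply: (mulrI u'); rewrite pm_pstep // u'E -rmorphM pm_pstep //.
  rewrite /pstep rmorphD !pmT'; case: ifP => _; first by rewrite rmorph0.
  by rewrite rmorphM.
move/(congr1 (step k (- dconst s))); rewrite stepK // => ->.
rewrite -rmorphN -map_step ?stepK //.
by rewrite step_unit.
Qed.

Lemma rigid_signs_step k s T : 1 + s * T k k != 0 ->
  rigid_signs (step k s T) -> rigid_signs T.
Proof.
move=> u Rstep T' symT' pmT'.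
have uU : 1 + s * T k k \is a GRing.unit by rewrite unitfE.
have T'kk : T' k k = T k k by rewrite -pm1 pmT' pm1.
have u' : 1 + s * T' k k \is a GRing.unit by rewrite T'kk.
have [|I|d [d1 dE]] := Rstep (step k s T'); first exact: step_sym.
  apply: (mulrI u'); rewrite pm_pstep // T'kk pm_pstep //.
  by rewrite /pstep !pmT'.
exists d; split=> // i j; rewrite -[in LHS](stepK u') -[in RHS](stepK uU).
rewrite [LHS]mxE [step k (- s) _ i j]mxE !dE.
have dk : d k * d k = 1 by case: (d1 k) => ->; rewrite ?mulrNN mulr1.
have -> : d k * step k s T k k * d k = step k s T k k.
  by rewrite mulrAC dk mul1r.
rewrite mulrBr mulrBl; congr (_ - _).
transitivity (d i * (- s / (1 + - s * step k s T k k) * step k s T i k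
   * step k s T k j) * d j * (d k * d k)); first by ring.
by rewrite dk mulr1.
Qed.

(** Minors of size one fix the diagonal; a constant minor on {i, j} forces 2 T_ij times the eps-part
    of T'_ij to vanish. *)
Lemma rigid_duals_full T : T^T = T -> (forall i j, T i j != 0) -> rigid_duals T.
Proof.
move=> symT T0 T' symT' T'1 pmT'; apply/matrixP=> i j; rewrite mxE.
have T'ij a b : (T' a b).1 = T a b by rewrite -T'1 mxE.
have T'ii a : T' a a = dconst (T a a) by rewrite -pm1 pmT' pm1.
have [<-//|nij] := eqVneq i j.
rewrite [LHS]surjective_pairing T'ij; congr pair.
have := pmT' [set i; j]; rewrite !pm2 // rmorphB !rmorphM /= !T'ii.
move/addrI/oppr_inj; rewrite (sym_entry j i symT') (sym_entry j i symT).
rewrite -rmorphM dual_mulE => -[_]; rewrite T'ij mulrC -mulr2n => /eqP.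
by rewrite mulrn_eq0 mulf_eq0 (negbTE (T0 _ _)) orbF => /eqP.
Qed.

(** Minors of size at most three fix T_ij^2 and the products T_oi T_ij T_oj. The first make the
    ratios T'_oi / T_oi signs, the second make these signs conjugate T into T'. *)
Lemma rigid_signs_full (o : 'I_r) T : T^T = T -> (forall i j, T i j != 0) ->
  rigid_signs T.
Proof.
move=> symT T0 T' symT' pmT'.
have sq i j : T' i j ^+ 2 = T i j ^+ 2.
  have := @sqformE _ _ 1 T' i j symT'; rewrite expr1n mul1r => <-.
  have := @sqformE _ _ 1 T i j symT; rewrite expr1n mul1r => <-.
  by rewrite /sqform !mul1r !pmT'.
have tri i j : T' o i * T' i j * T' o j = T o i * T i j * T o j.
  have two : 2%:R * 1 ^+ 3 != 0 :> K by rewrite expr1n mulr1 pnatr_eq0.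
  apply: (mulfI two); rewrite -!triformE //.
  by rewrite /triform /sqform !mul1r !pmT'.
have d2 i : (T' o i / T o i) * (T' o i / T o i) = 1.
  by rewrite -expr2 expr_div_n sq divff // expf_neq0.
exists (fun i => T' o i / T o i); split=> [i|i j].
  have /eqP := d2 i; rewrite -expr2 sqrf_eq1 => /orP[]/eqP; first by left.
  by right.
have T'0 a : T' o a != 0.
  apply/eqP=> z; have /esym/eqP := sq o a.
  by rewrite z expr0n /= expf_eq0 (negbTE (T0 _ _)).
transitivity (T' i j * ((T' o i / T o i) * (T' o i / T o i))
    * ((T' o j / T o j) * (T' o j / T o j))); first by rewrite !d2 !mulr1.
transitivity (T' o i * T' i j * T' o j * (T' o i / T o i) * (T' o j / T o j)
    / (T o i * T o j)); first by field; rewrite !T0.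
by rewrite tri; field; rewrite !T0.
Qed.

Lemma lifts_duals_full (o : 'I_r) T : T^T = T -> (forall i j, T i j != 0) ->
  lifts_duals T.
Proof.
move=> symT T0 c x c0 Vx x1.
have x1E J : (@dfst K \o x) J = c * pm T J by exact: x1.
have sq1 i : dfst (sqform x o i) = c ^+ 2 * T o i ^+ 2.
  by rewrite sqform_rmorph -(sqformE c o i symT) /sqform /= !x1.
have tri1 i j : dfst (triform o x i j) = 2%:R * c ^+ 3 * (T o i * T i j * T o j).
  by rewrite triform_rmorph -(triformE o c i j symT) /triform /sqform /= !x1.
have two0 : 2%:R != 0 :> K by rewrite pnatr_eq0.
have x0U : x set0 \is a GRing.unit by rewrite dual_unitE x1 pm0 mulr1.
pose b i : dual K := sqform x o i / x set0 ^+ 2.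
have b1 i : dfst (b i) = T o i ^+ 2.
  rewrite /b dfstM dfstV dfstX sq1 x1 pm0 mulr1.
  by field.
(* The square root of [b i] lying over T_oi: its eps-part solves a linear equation with coefficient
   2 T_oi, which is nonzero. *)
pose m i : dual K := (T o i, (b i).2 / (2%:R * T o i)).
have m2 i : m i * m i = b i.
  rewrite dual_mulE [RHS]surjective_pairing; congr pair.
    by rewrite -expr2 -b1.
  by rewrite /=; field; rewrite T0.
have mU i : m i \is a GRing.unit by rewrite dual_unitE /= T0.
have twoU : (2%:R : dual K) \is a GRing.unit.
  by rewrite -(rmorph_nat (@dconst K)) dual_unitE.
have m2' i : x set0 ^+ 2 * (m i * m i) = sqform x o i.
  by rewrite m2 mulrC divrK ?unitrX.
exists (x set0), (rebuilt o x m); split.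
- exact: rebuilt_sym.
- apply/matrixP=> i j; rewrite !mxE dfstM dfstV (dfstM _ (_ * _)) tri1 (dfstM _ (_ ^+ _)).
  rewrite dfstX x1 pm0 mulr1 dfst_nat (dfstM (m i)) /dfst /=.
  by field; rewrite !T0 c0.
- by rewrite x1 pm0 mulr1.
move=> I; have [->|I0] := eqVneq I set0; first by rewrite pm0 mulr1.
by apply: (pm_rebuilt twoU x0U mU m2' _ I0); apply: (onV_minor_relation o I0 Vx).
Qed.

Lemma connected_rigid (o : 'I_r) T : T^T = T -> \det T != 0 -> connected_mx T ->
  [/\ lifts_duals T, rigid_duals T & rigid_signs T].
Proof.
move=> symT detT; apply: (step_ind (P := fun T => connected_mx T ->
  [/\ lifts_duals T, rigid_duals T & rigid_signs T])) symT detT => {T}.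
- move=> T symT detT trT cT.
  have T0 := transitive_connected_full symT detT trT cT.
  by split; [exact: (lifts_duals_full o) | exact: rigid_duals_full
            | exact: (rigid_signs_full o)].
- move=> T k s symT detT u IH cT.
  have [] := IH (connected_step u symT cT).
  by split; [apply: lifts_duals_step u _ | apply: rigid_duals_step u _
            | apply: rigid_signs_step u _].
Qed.

End Lift.

(** * The ideal of the variety *)

Section Variety.
Variables (R : realType) (r : nat).
Local Notation C := R[i].
Local Notation N := #|{set 'I_r}|.
Local Notation rc := (real_complex R).
Implicit Types (F : {mpoly C[N]}) (p v : subset_vec C r) (I : {set 'I_r}).

Definition cone_pt (c : C) (T : 'M[C]_r) : subset_vec C r :=
  \row_k (c * pm T (enum_val k)).

Lemma coord_cone_pt c T I : coord (cone_pt c T) I = c * pm T I.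
Proof. by rewrite /coord mxE enum_rankK. Qed.

Lemma coordK p q : (forall I, coord p I = coord q I) -> p = q.
Proof. by move=> pq; apply/rowP=> k; have := pq (enum_val k); rewrite /coord enum_valK. Qed.

Lemma coord_complexify (q : subset_vec R r) I :
  coord (complexify q) I = rc (coord q I).
Proof. by rewrite /coord mxE. Qed.

Lemma ev_coord p F : F.@[p 0] = ev idfun (coord p) F.
Proof. by apply: mmap_ext => // k; rewrite /coord enum_valK. Qed.

Lemma dpp_pointE (K : fieldType) (T : 'M[K]_r) I :
  coord (dpp_point T) I = pm T I / \det (T + 1%:M).
Proof. by rewrite /coord mxE enum_rankK det_psubmx. Qed.

Lemma dpp_point_cone (T : 'M[C]_r) : dpp_point T = cone_pt (\det (T + 1%:M))^-1 T.
Proof. by apply: coordK => I; rewrite dpp_pointE coord_cone_pt mulrC. Qed.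

Lemma ev_homog (K A : comNzRingType) n (f : {rmorphism K -> A}) (h : 'I_n -> A)
    (G : {mpoly K[n]}) d (a : A) :
  G \is d.-homog -> mmap f (fun i => a * h i) G = a ^+ d * mmap f h G.
Proof.
move=> /dhomogP hG; rewrite /mmap mulr_sumr; apply: eq_big_seq => m mG.
rewrite mulrCA; congr (_ * _); rewrite /mmap1 -(hG m mG) /= mdegE -prodrXr -big_split.
by apply: eq_bigr => i _; rewrite exprMn.
Qed.

Lemma posdef_add1 n (T : 'M[R]_n) : posdef T -> \det (T + 1%:M) != 0.
Proof.
move=> [_ posT]; apply/det0P=> -[v v0 E].
have vv : 0 <= (v *m v^T) 0 0.
  by rewrite mxE sumr_ge0 // => i _; rewrite mxE -expr2 sqr_ge0.
have : (v *m (T + 1%:M) *m v^T) 0 0 = 0 by rewrite E mul0mx mxE.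
rewrite mulmxDr mulmx1 mulmxDl mxE => /eqP.
by rewrite gt_eqF // ltr_wpDr // posT.
Qed.

(** Since |v_i v_j| is at most |v|^2, the form of S is bounded below by -M |v|^2, where M is the sum
    of the absolute values of its entries. *)
Lemma posdef_shift n (S : 'M[R]_n) : S^T = S ->
  exists M, forall x, M <= x -> posdef (x%:M + S).
Proof.
move=> symS; pose M := \sum_i \sum_j `|S i j|.
exists (M + 1) => x Mx; split; first by rewrite linearD /= tr_scalar_mx symS.
move=> v v0; pose q := \sum_i v 0 i ^+ 2.
have q0 : 0 < q.
  rewrite lt_def sumr_ge0 ?andbT; last by move=> i _; rewrite sqr_ge0.
  apply: contraNneq v0 => /eqP; rewrite psumr_eq0; last by move=> i _; rewrite sqr_ge0.
  move=> /allP h; apply/eqP/rowP=> i; rewrite mxE; apply/eqP.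
  by have := h i (mem_index_enum i); rewrite /= sqrf_eq0.
have vq i : v 0 i ^+ 2 <= q.
  by rewrite /q (bigD1 i) //= lerDl sumr_ge0 // => j _; rewrite sqr_ge0.
rewrite mulmxDr mulmxDl mxE mul_mx_scalar -scalemxAl mxE.
have -> : (v *m v^T) 0 0 = q.
  by rewrite mxE; apply: eq_bigr => i _; rewrite mxE expr2.
have -> : (v *m S *m v^T) 0 0 = \sum_j \sum_i v 0 i * S i j * v 0 j.
  by rewrite mxE; apply: eq_bigr => j _; rewrite !mxE mulr_suml.
suff h : - (M * q) <= \sum_j \sum_i v 0 i * S i j * v 0 j.
  apply: lt_le_trans (lerD (lexx _) h); rewrite -mulrBl mulr_gt0 //.
  by rewrite subr_gt0 (lt_le_trans _ Mx) // ltrDl.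
rewrite /M exchange_big mulr_suml -sumrN; apply: ler_sum => j _.
rewrite mulr_suml -sumrN; apply: ler_sum => i _.
apply: lerNnormlW; rewrite !normrM mulrAC mulrC ler_wpM2l //.
have ge0 := normr_ge0 (v 0 i).
have [ij|/ltW ij] := lerP `|v 0 i| `|v 0 j|.
  apply: le_trans (vq j); rewrite -real_normK ?num_real // expr2.
  by rewrite ler_wpM2r.
apply: le_trans (vq i); rewrite -real_normK ?num_real // expr2.
by rewrite ler_wpM2l.
Qed.

(** Two restrictions to lines: on S + y Id vanishing at infinitely many large y gives vanishing at
    the real matrix S; on A + y B vanishing at natural y gives vanishing at y = i, that is, at a
    complex matrix with real part A and imaginary part B. *)
Lemma model_dense F d : F \is d.-homog ->
  (forall q, ((@complexify R N) @` @dpp_model R r)%classic q -> F.@[q 0] = 0) ->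
  forall T : 'M[C]_r, T^T = T -> ev idfun (pm T) F = 0.
Proof.
move=> homF F0.
have F0real (S : 'M[R]_r) : posdef S -> ev idfun (pm (map_mx rc S)) F = 0.
  move=> pS; have := F0 (complexify (dpp_point S)).
  have q1 : ((@complexify R N) @` @dpp_model R r)%classic (complexify (dpp_point S)).
    by apply: imageP; exists S.
  move=> /(_ q1).
  have -> : complexify (dpp_point S) = cone_pt (rc (\det (S + 1%:M))^-1) (map_mx rc S).
    apply: coordK => I; rewrite coord_cone_pt coord_complexify dpp_pointE.
    by rewrite rmorphM /= map_pm mulrC.
  rewrite ev_coord (_ : ev _ _ _ = mmap idfun
      (fun i => rc (\det (S + 1%:M))^-1 * pm (map_mx rc S) (enum_val i)) F).
    rewrite (ev_homog _ _ _ homF) => /eqP; rewrite mulf_eq0 expf_eq0.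
    by rewrite fmorph_eq0 invr_eq0 (negbTE (posdef_add1 pS)) andbF => /eqP.
  by apply: mmap_ext => // i; rewrite coord_cone_pt.
have rcI : injective (fun k : nat => rc k%:R).
  by move=> a b /(fmorph_inj (real_complex R))/eqP; rewrite eqr_nat => /eqP.
have poly_ev (P : 'M[C]_r) (Q : 'M[C]_r) y :
    (ev polyC (pm (map_mx polyC P + 'X *: map_mx polyC Q)) F).[y]
    = ev idfun (pm (P + y *: Q)) F.
  rewrite -horner_evalE mmap_rmorph; apply: mmap_ext => [a|i] /=.
    by rewrite horner_evalE hornerC.
  rewrite horner_evalE -horner_evalE map_pm; congr pm; apply/matrixP=> a b.
  by rewrite !mxE /= horner_evalE !hornerE.
have F0realsym (S : 'M[R]_r) : S^T = S -> ev idfun (pm (map_mx rc S)) F = 0.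
  move=> symS; have [M posM] := posdef_shift symS.
  pose P := ev polyC (pm (map_mx polyC (map_mx rc S + rc M *: 1%:M)
                          + 'X *: map_mx polyC 1%:M)) F.
  have P0 : P = 0.
    apply: (poly_inj0 rcI) => k; rewrite poly_ev -addrA -scalerDl addrC.
    rewrite -rmorphD scalemx1 -map_scalar_mx -map_mxD; apply: F0real.
    by apply: posM; rewrite lerDl ler0n.
  have := poly_ev (map_mx rc S + rc M *: 1%:M) 1%:M (- rc M).
  by rewrite -/P P0 horner0 -addrA -scalerDl subrr scale0r addr0 => <-.
move=> T symT.
pose A := map_mx (@complex.Re R) T; pose B := map_mx (@complex.Im R) T.
have symA : A^T = A by rewrite /A map_trmx symT.
have symB : B^T = B by rewrite /B map_trmx symT.
pose P := ev polyC (pm (map_mx polyC (map_mx rc A) + 'X *: map_mx polyC (map_mx rc B))) F.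
have P0 : P = 0.
  apply: (poly_inj0 rcI) => k; rewrite poly_ev.
  rewrite -map_mxZ -map_mxD; apply: F0realsym.
  by rewrite linearD linearZ /= symA symB.
have := poly_ev (map_mx rc A) (map_mx rc B) 'i%C; rewrite -/P P0 horner0.
rewrite (_ : _ + _ = T) => [<- //|]; apply/matrixP=> i j; rewrite !mxE.
by rewrite [RHS]complexE.
Qed.

(** Towards [minor_ideal], the case c = 0 is the apex, which is no projective point and is reached
    by a polynomial in c. Conversely, V_r is cut out by homogeneous equations only: evaluating F at
    y times a point, as a polynomial in y, shows that each homogeneous component of F vanishes on
    the model. *)
Lemma vanishing_idealP F :
  vanishing_ideal (@dpp_variety R r) F <-> minor_ideal F.
Proof.
split=> [VF c T symT|IF p [p0 Vp]].
  pose P : {poly C} := ev polyC (fun I => 'X * (pm T I)%:P) F.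
  have PE y : P.[y] = ev idfun (fun I => y * pm T I) F.
    rewrite -horner_evalE mmap_rmorph; apply: mmap_ext => [a|i] /=.
      by rewrite horner_evalE hornerC.
    by rewrite horner_evalE !hornerE.
  rewrite -PE (@poly_cofinite0 _ P 'X) ?horner0 ?polyX_eq0 // => y.
  rewrite hornerX PE => y0; have -> : ev idfun (fun I => y * pm T I) F = F.@[cone_pt y T 0].
    by rewrite ev_coord; apply: ev_ext => I; rewrite coord_cone_pt.
  apply: (VF (cone_pt y T)); split.
    apply: contraNneq y0 => E; have := coord_cone_pt y T set0.
    by rewrite /coord E pm0 mulr1 => <-.
  move=> G d homG modelG; rewrite ev_coord.
  rewrite (_ : ev _ _ _ = mmap idfun (fun i => y * pm T (enum_val i)) G).
    by rewrite (ev_homog _ _ _ homG) -/(ev _ _ _) (model_dense homG modelG) // mulr0.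
  by apply: mmap_ext => // i; rewrite coord_cone_pt.
have [m Fm] : exists m, (msize F <= m)%N by exists (msize F).
have Fsum := pihomog_partitionE Fm.
rewrite Fsum rmorph_sum big1 // => d _; apply: (Vp _ d) => [|q]; first exact: pihomogP.
case=> q' [S pS ->] <-.
set T := map_mx rc S.
have symT : T^T = T by rewrite /T map_trmx; case: pS => ->.
pose P : {poly C} := \sum_(e < m) (ev idfun (pm T) (pihomog mdeg e F)) *: 'X^e.
have P0 : P = 0.
  apply: poly_all0 => y; rewrite horner_sum -[RHS](IF y T symT) [in RHS]Fsum /ev rmorph_sum.
  apply: eq_bigr => e _; rewrite hornerZ hornerXn mulrC /=.
  by rewrite -(ev_homog _ _ _ (@pihomogP _ _ mdeg e F)).
have := congr1 (coefp d) P0; rewrite /= coef0 coef_sum (bigD1 d) //= coefZ coefXn eqxx.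
rewrite mulr1 big1 ?addr0 => [E|e]; last first.
  rewrite -val_eqE /= coefZ coefXn eq_sym => /negbTE->; exact: mulr0.
rewrite ev_coord (_ : ev _ _ _ = mmap idfun
   (fun i => rc (\det (S + 1%:M))^-1 * pm (map_mx rc S) (enum_val i)) (pihomog mdeg d F)).
  by rewrite (ev_homog _ _ _ (@pihomogP _ _ mdeg d F)) -/(ev _ _ _) E mulr0.
apply: mmap_ext => // i; rewrite coord_complexify dpp_pointE.
by rewrite rmorphM /= map_pm mulrC.
Qed.

(* In [proj_zariski_closure], [p != 0] compares p with 0 as functions of two
   indices. *)
Lemma fun_of_mx0 : fun_of_matrix (0 : subset_vec C r) == 0.
Proof. by apply/eqP/funext => i; apply/funext => k; rewrite mxE. Qed.

Lemma dpp_varietyP p : dpp_variety p <-> p != 0 /\ onV idfun (coord p).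
Proof.
split=> [Vp|[p0 Vp]].
  split; first by case: Vp => p0 _; apply: contraNneq p0 => ->; rewrite fun_of_mx0.
  by move=> F /vanishing_idealP/(_ p Vp); rewrite ev_coord.
split=> [|F d homF modelF].
  apply: contraNneq p0 => E; apply/eqP/rowP=> k.
  by rewrite [LHS](congr1 (fun f => f 0 k) E) mxE.
rewrite ev_coord; apply: Vp => c T symT.
rewrite (_ : ev _ _ _ = mmap idfun (fun i => c * pm T (enum_val i)) F) //.
by rewrite (ev_homog _ _ _ homF) -/(ev _ _ _) (model_dense homF modelF) // mulr0.
Qed.

(** By [mmap_dconst], F at p + eps v consists of its value at p and its differential on v. *)
Lemma cone_tangentP p v : dpp_variety p ->
  cone_tangent (@dpp_variety R r) p v <->
    onV (@dconst C) (fun I => (coord p I, coord v I)).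
Proof.
move=> Vp.
have E F : ev (@dconst C) (fun I => (coord p I, coord v I)) F
    = (F.@[p 0], \sum_(k < N) (mderiv k F).@[p 0] * v 0 k).
  rewrite /ev mmap_dconst /=; congr pair.
    by apply: mmap_ext => // k; rewrite /coord enum_valK.
  apply: eq_bigr => k _; rewrite [coord v _]/coord enum_valK; congr (_ * _).
  by apply: mmap_ext => // l; rewrite /coord enum_valK.
split=> tv F IF.
  rewrite E tv; last exact/vanishing_idealP.
  by rewrite (_ : F.@[p 0] = 0) //; move/vanishing_idealP: IF; apply.
by have := tv F ((vanishing_idealP F).1 IF); rewrite E => -[].
Qed.

End Variety.

(** * Closedness of the image of the principal minor map *)

Section EvenNorm.
Variables (B : idomainType) (n : nat).
Hypothesis two_neq0 : 2%:R != 0 :> B.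
Implicit Types (p f : {mpoly B[n]}) (e : {ffun 'I_n -> bool}).

Definition sign_change e p : {mpoly B[n]} :=
  mmap (@mpolyC n B) (fun i => (-1) ^+ e i * 'X_i) p.

Lemma mcoeff_sign_change e p m :
  (sign_change e p)@_m = (\prod_i (-1) ^+ (e i * m i)) * p@_m.
Proof.
rewrite {1}[p]mpolyE /sign_change rmorph_sum raddf_sum /=.
have E k : (mmap (@mpolyC n B) (fun i => (-1) ^+ e i * 'X_i) (p@_k *: 'X_[k]))@_m
    = p@_k * (\prod_i (-1) ^+ (e i * k i)) * (k == m)%:R.
  rewrite mmapZ mmapX /mmap1 mul_mpolyC mcoeffZ -mulrA; congr (_ * _).
  rewrite (eq_bigr (fun i => ((-1) ^+ (e i * k i))%:MP * 'X_i ^+ k i)); last first.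
    by move=> i _; rewrite exprMn -exprM rmorphXn rmorphN1.
  by rewrite big_split -mpolyXE_id -rmorph_prod mcoeffCM mcoeffX.
rewrite (eq_bigr _ (fun k _ => E k)).
have [mp|mp] := boolP (m \in msupp p).
  rewrite (bigD1_seq m) ?msupp_uniq //= eqxx mulr1 [X in _ + X]big1 => [|k].
    by rewrite addr0 mulrC.
  by move/negbTE->; rewrite mulr0.
rewrite (memN_msupp_eq0 mp) mulr0 big1_seq // => k /= kp.
by case: eqP => [km|_]; rewrite ?mulr0 //; move: mp; rewrite -km kp.
Qed.

Lemma sign_change_comp e e' p :
  sign_change e (sign_change e' p) = sign_change [ffun i => e i (+) e' i] p.
Proof.
rewrite /sign_change mmap_rmorph; apply: mmap_ext => [a|i] /=.
  by rewrite mmapC.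
rewrite rmorphM /= rmorphXn rmorphN1 mmapX mmap1U ffunE mulrA; congr (_ * _).
by rewrite -signr_addb addbC.
Qed.

(* The product over all sign changes is even in every variable, hence a
   polynomial in their squares. *)
Lemma even_norm f (b : 'I_n -> B) : exists g : B,
  forall (A : comNzRingType) (phi : {rmorphism B -> A}) (z : 'I_n -> A),
    (forall i, z i ^+ 2 = phi (b i)) ->
    phi g = \prod_(e : {ffun 'I_n -> bool}) mmap phi (fun i => (-1) ^+ e i * z i) f.
Proof.
pose P := \prod_e sign_change e f.
have Psign e : sign_change e P = P.
  rewrite /P [LHS]rmorph_prod.
  rewrite (reindex_inj (h := fun e' : {ffun 'I_n -> bool} => [ffun i => e i (+) e' i])) /=.
    apply: eq_bigr => e' _.
    rewrite -[LHS]/(sign_change e (sign_change [ffun i => e i (+) e' i] f)).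
    rewrite sign_change_comp; congr (sign_change _ f).
    by apply/ffunP=> i; rewrite !ffunE addKb.
  move=> e1 e2 /ffunP E; apply/ffunP=> i; have := E i; rewrite !ffunE.
  exact: addbI.
have Peven (m : 'X_{1..n}) i : odd (m i) -> P@_m = 0.
  move=> mi; have := congr1 (mcoeff m) (Psign [ffun j => j == i]).
  rewrite mcoeff_sign_change (bigD1 i) //= ffunE eqxx mul1n -signr_odd mi expr1.
  rewrite big1 => [|j nj]; last by rewrite ffunE (negbTE nj) mul0n expr0.
  move/eqP; rewrite mulr1 mulN1r eq_sym -addr_eq0 -mulr2n -mulr_natl mulf_eq0.
  by rewrite (negbTE two_neq0) => /eqP.
(* The witness lies in B and serves every specialization [phi]. It can thus be shown to vanish where
   the square roots are true matrix entries, and then be evaluated elsewhere. *)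
exists (\sum_(m <- msupp P) P@_m * \prod_i b i ^+ (m i)./2) => A phi z zb.
transitivity (mmap phi z P).
  rewrite rmorph_sum; apply: eq_big_seq => m mP; rewrite rmorphM rmorph_prod.
  congr (_ * _); apply: eq_bigr => i _; rewrite rmorphXn /= -zb -exprM mul2n.
  congr (_ ^+ _); apply: even_halfK; apply: contraTN mP => /Peven P0.
  by rewrite -mcoeff_eq0 P0.
rewrite rmorph_prod; apply: eq_bigr => e _; rewrite /sign_change mmap_rmorph.
apply: mmap_ext => [a|i] /=; first by rewrite mmapC.
by rewrite rmorphM /= rmorphXn rmorphN1 mmapX mmap1U.
Qed.

End EvenNorm.

Section Closed.
Variables (K : numClosedFieldType) (r : nat).
Local Notation N := #|{set 'I_r}|.
Implicit Types (I : {set 'I_r}).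

Definition sqvar (A : Type) (d : 'I_r -> A) (z : 'I_N -> A) : 'M[A]_r :=
  \matrix_(i, j) if i == j then d i else z (enum_rank [set i; j]).

(** For x = c pm T and z holding the entries c T_ij, [sqvar] is c T and its minor on I is c^#|I| pm
    T I. The powers of [x set0] bring both terms to the common factor c^(r+1). *)
Definition defect (A : comNzRingType) (x : {set 'I_r} -> A) (z : 'I_N -> A) I : A :=
  x set0 ^+ r * x I
  - x set0 ^+ (r.+1 - #|I|) * pm (sqvar (fun i => x [set i]) z) I.

Lemma defect_rmorph (A A' : comNzRingType) (g : {rmorphism A -> A'}) x z I :
  g (defect x z I) = defect (g \o x) (g \o z) I.
Proof.
rewrite /defect rmorphB !rmorphM !rmorphXn map_pm; congr (_ - _ * pm _ _).
by apply/matrixP=> i j; rewrite !mxE; case: eqP.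
Qed.

Lemma defect_ext (A : comNzRingType) (x x' : {set 'I_r} -> A) z z' I :
  x =1 x' -> z =1 z' -> defect x z I = defect x' z' I.
Proof.
move=> ex ez; rewrite /defect !ex; congr (_ - _ * pm _ _).
by apply/matrixP=> i j; rewrite !mxE ex ez.
Qed.

(** The coordinates give the squares of the off-diagonal entries, and one choice of roots must fit
    all minors at once. So all defects are packed into one polynomial in t. Its product over all
    sign choices is a polynomial in x that vanishes on matrices for each t, hence at the given
    point. As K[t] is a domain, the polynomial of one sign choice is zero, and with it all its
    defects. *)
Lemma onV_cone (x : {set 'I_r} -> K) : onV idfun x -> x set0 != 0 ->
  exists2 T : 'M[K]_r, T^T = T & forall I, x I = x set0 * pm T I.
Proof.
move=> Vx x0; pose B : idomainType := {mpoly K[N]}.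
have two_neq0 : 2%:R != 0 :> B.
  by rewrite -mpolyC_nat mpolyC_eq0 pnatr_eq0.
pose X I : B := 'X_(enum_rank I).
pose XC I : {mpoly B[N]} := (X I)%:MP.
pose b (k : 'I_N) : B := \prod_(i in enum_val k) X [set i] - X set0 * X (enum_val k).
pose f (t : K) : {mpoly B[N]} :=
  \sum_I (t ^+ enum_rank I)%:MP%:MP * defect XC (fun k => 'X_k) I.
have evX (y : {set 'I_r} -> K) I : mmap idfun (fun k => y (enum_val k)) (X I) = y I.
  by rewrite mmapX mmap1U enum_rankK.
have evf (y : {set 'I_r} -> K) (z : 'I_N -> K) t :
    mmap (mmap idfun (fun k => y (enum_val k))) z (f t)
    = \sum_I t ^+ enum_rank I * defect y z I.
  rewrite rmorph_sum; apply: eq_bigr => I _; rewrite rmorphM.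
  congr (_ * _); first by rewrite [LHS]mmapC [LHS]mmapC.
  rewrite [LHS](defect_rmorph (mmap (mmap idfun (fun k => y (enum_val k))) z)).
  apply: defect_ext => [J|k] /=; first by rewrite [LHS]mmapC; exact: evX.
  by rewrite mmapX mmap1U.
have evb (y : {set 'I_r} -> K) i j : i != j ->
    mmap idfun (fun k => y (enum_val k)) (b (enum_rank [set i; j]))
    = y [set i] * y [set j] - y set0 * y [set i; j].
  move=> nij; rewrite /b enum_rankK rmorphB rmorphM rmorph_prod.
  rewrite big_setU1 ?inE //= big_set1.
  by congr (_ * _ - _ * _); exact: evX.
have g_ t := even_norm two_neq0 (f t) b.
have [z z2] : exists z : 'I_N -> K,
    forall k, z k ^+ 2 = mmap idfun (fun k => x (enum_val k)) (b k).
  by exists (fun k => sqrtC (mmap idfun (fun k => x (enum_val k)) (b k))) => k;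
    rewrite sqrtCK.
pose Q (e : {ffun 'I_N -> bool}) : {poly K} :=
  \sum_(k < N) defect x (fun k => (-1) ^+ e k * z k) (enum_val k) *: 'X^k.
have /eqP : \prod_e Q e = 0.
  apply: poly_all0 => t; have [g gE] := g_ t.
  have <- : mmap idfun (fun k => x (enum_val k)) g = 0.
    apply: Vx => c T symT.
    pose y I := c * pm T I.
    (* [even_norm] requires w_k^2 = b_k at every index; the default root provides this at sets that
       are not pairs. *)
    pose w (k : 'I_N) : K :=
      if [pick ij : 'I_r * 'I_r | (ij.1 != ij.2) && (enum_val k == [set ij.1; ij.2])]
      is Some ij then c * T ij.1 ij.2
      else sqrtC (mmap idfun (fun k => y (enum_val k)) (b k)).
    have wE i j : i != j -> w (enum_rank [set i; j]) = c * T i j.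
      move=> nij; rewrite /w; case: pickP => [[a d] /= /andP[nad]|/(_ (i, j))].
        rewrite enum_rankK => /eqP E.
        have /set2P : a \in [set i; j] by rewrite E set21.
        have /set2P : d \in [set i; j] by rewrite E set22.
        case=> dE [] aE; move: nad; rewrite aE dE ?eqxx // => _.
        by rewrite (sym_entry j i symT).
      by rewrite /= nij enum_rankK eqxx.
    rewrite [LHS](gE _ _ w) => [|k].
      apply/eqP/prodf_eq0; exists [ffun=> false] => //.
      rewrite (_ : mmap _ _ _ = mmap (mmap idfun (fun k => y (enum_val k))) w (f t)).
        rewrite evf big1 // => I _; rewrite (_ : defect y w I = 0) ?mulr0 //.
        rewrite /defect (_ : sqvar _ _ = c *: T); last first.
          apply/matrixP=> i j; rewrite !mxE; have [<-|nij] := eqVneq i j.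
            by rewrite /y pm1.
          exact: wE.
        rewrite pm_scalar /y pm0 mulr1 [_ * (_ * pm T I)]mulrA mulrA -exprD.
        rewrite subnK ?[c ^+ _.+1]exprSr ?subrr //.
        by rewrite ltnW // ltnS -[X in (_ <= X)%N]card_ord max_card.
      by apply: mmap_ext => // k; rewrite ffunE expr0 mul1r.
    rewrite /w; case: pickP => [[i j] /= /andP[nij /eqP E]|_]; last by rewrite sqrtCK.
    rewrite -[k]enum_valK E; apply/esym; rewrite [LHS](evb y) // /y !pm1 pm0 pm2 // (sym_entry j i symT).
    by ring.
  rewrite (gE _ _ z z2) horner_prod; apply: eq_bigr => e _; rewrite evf horner_sum.
  rewrite [RHS](reindex_onto enum_val enum_rank) /=; last by move=> I _; rewrite enum_rankK.
  apply: eq_big => [k|k _]; first by rewrite enum_valK eqxx.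
  by rewrite hornerZ hornerXn enum_valK mulrC.
rewrite prodf_seq_eq0 => /hasP[e _ /= /eqP Qe].
pose S := sqvar (fun i => x [set i]) (fun k => (-1) ^+ e k * z k).
exists ((x set0)^-1 *: S).
  apply/matrixP=> i j; rewrite !mxE eq_sym; case: eqP => [->//|_].
  by rewrite setUC.
move=> I; have := congr1 (coefp (enum_rank I)) Qe; rewrite /= coef0 coef_sum.
rewrite (bigD1 (enum_rank I)) //= coefZ coefXn eqxx mulr1 big1 ?addr0; last first.
  move=> k; rewrite -val_eqE coefZ coefXn eq_sym => /negbTE->; exact: mulr0.
rewrite enum_rankK /defect -/S => /eqP; rewrite subr_eq0 => /eqP E.
have cI : (#|I| <= r)%N by rewrite -[X in (_ <= X)%N]card_ord max_card.
apply: (mulfI (expf_neq0 r x0)); rewrite E pm_scalar subSn // exprS.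
rewrite [X in _ = _ * X]mulrA mulrA exprVn; congr (_ * _).
rewrite [_ ^+ r * _]mulrCA; congr (_ * _).
by rewrite expfB_cond ?(negbTE x0).
Qed.

End Closed.

(** * Algebraic dependence *)

Section AlgDep.
Variable K : numFieldType.

Lemma mcoeff0_meval n (p : {mpoly K[n]}) : p@_0%MM = p.@[fun=> 0].
Proof.
elim/mpoly_ring_ind: p => [c|i|p q Ep Eq|p q Ep Eq].
- by rewrite mpolyCK mevalC.
- by rewrite mcoeffX mnm1_eq0 mevalXU.
- by rewrite mcoeffD Ep Eq rmorphD.
- by rewrite [LHS](rmorphM (mcoeff 0%MM)) /= Ep Eq rmorphM.
Qed.

(** Restriction to coordinate lines shows that all partial derivatives vanish everywhere as well. In
    characteristic zero they determine the nonconstant coefficients, by induction on the degree. *)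
Lemma mpoly_all0 n (p : {mpoly K[n]}) : (forall v, p.@[v] = 0) -> p = 0.
Proof.
move=> p0; apply/mpolyP=> m; rewrite mcoeff0.
have [k] := ubnP (mdeg m); elim: k m p p0 => // k IH m p p0 mk.
have [->|/eqP m0] := eqVneq m 0%MM; first by rewrite mcoeff0_meval.
have [i mi] : exists i, m i != 0%N.
  apply/existsP; apply: contraT; rewrite negb_exists => /forallP h.
  by case: m0; apply/mnmP=> i; apply/eqP; rewrite mnm0E -[_ == _]negbK.
have Em : (m = (m - U_(i)) + U_(i))%MM by rewrite submK // lep1mP.
have dp0 v : (mderiv i p).@[v] = 0.
  pose h (k : 'I_n) : {poly K} := (v k)%:P + (k == i)%:R *: 'X.
  have /(congr1 (jet 0)) : mmap polyC h p = 0.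
    apply: poly_all0 => y; rewrite -horner_evalE mmap_rmorph.
    rewrite -[RHS](p0 (fun k => (h k).[y])).
    by apply: mmap_ext => [a|j] /=; rewrite horner_evalE ?hornerC.
  rewrite rmorph0 mmap_rmorph => E.
  have : mmap (@dconst K) (fun k => (v k, (k == i)%:R)) p = 0.
    rewrite -[RHS]E; apply: mmap_ext => [a|j] /=.
      by rewrite /jet derivC !hornerE.
    by rewrite /jet /h derivD derivC derivZ derivX !hornerE.
  rewrite mmap_dconst => -[_] /=; rewrite (bigD1 i) //= eqxx mulr1 big1 ?addr0 //.
  by move=> j /negbTE->; rewrite mulr0.
have : (mderiv i p)@_(m - U_(i))%MM = 0.
  by apply: IH => //; move: mk; rewrite {1}Em mdegD mdeg1 addn1 ltnS.
by rewrite mcoeff_deriv -Em => /eqP; rewrite mulrn_eq0 /= => /eqP.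
Qed.

Lemma msizeM_bound n (p q : {mpoly K[n]}) a b :
  (msize p <= a.+1)%N -> (msize q <= b.+1)%N -> (msize (p * q) <= (a + b).+1)%N.
Proof.
have [->|p0] := eqVneq p 0; first by rewrite mul0r msize0.
have [->|q0] := eqVneq q 0; first by rewrite mulr0 msize0.
rewrite msizeM // (mpolySpred _ p0) (mpolySpred _ q0) !ltnS addSn addnS /= ltnS.
exact: leq_add.
Qed.

Lemma wide_kernel (m n : nat) (A : 'M[K]_(m, n)) : (n < m)%N ->
  exists2 v : 'rV_m, v != 0 & v *m A = 0.
Proof.
move=> nm; have /rowV0Pn[v vA v0] : kermx A != 0.
  rewrite -mxrank_eq0 mxrank_ker subn_eq0 -ltnNge.
  exact: leq_ltn_trans (rank_leq_col A) nm.
by exists v => //; apply/sub_kermxP.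
Qed.

(* There are m^k products of the f_i with exponents below m, in a space of
   polynomials whose dimension grows like m^s. *)
Lemma alg_dependent k s (f : 'I_k -> {mpoly K[s]}) : (s < k)%N ->
  exists2 G : {mpoly K[k]}, G != 0 & mmap (@mpolyC s K) f G = 0.
Proof.
move=> sk; pose D := \max_i msize (f i).
have fD i : (msize (f i) <= D.+1)%N.
  by rewrite leqW // (leq_bigmax_cond (F := fun i => msize (f i))).
(* The products have size at most b, so at most b^s monomials occur, and b^s <= ((kD + 1) m)^s <
   m^(s+1) <= m^k by the choice of m. *)
pose m := ((k * D).+1 ^ s).+1; pose b := (k * (m * D)).+1.
pose E := {ffun 'I_k -> 'I_m}.
pose mon (e : E) : 'X_{1..k} := [multinom val (e i) | i < k].
pose q (e : E) : {mpoly K[s]} := \prod_i f i ^+ e i.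
have qb e : (msize (q e) <= b)%N.
  have fX i (j : nat) : (msize (f i ^+ j) <= (j * D).+1)%N.
    elim: j => [|j IH]; first by rewrite expr0 msize1.
    by rewrite exprS mulSn; apply: msizeM_bound.
  have : (msize (q e) <= (\sum_(i < k) e i * D).+1)%N.
    rewrite /q; elim/big_ind2: _ => [|x1 a1 x2 a2|i _]; first by rewrite msize1.
      exact: msizeM_bound.
    exact: fX.
  move/leq_trans; apply; rewrite ltnS -[X in (_ <= X * _)%N]card_ord -sum_nat_const.
  by apply: leq_sum => i _; rewrite leq_mul2r ltnW ?orbT.
pose M := 'X_{1..s < b}.
have cardM : (#|{: M}| <= b ^ s)%N.
  have b0 : (0 < b)%N by [].
  pose g (x : M) : {ffun 'I_s -> 'I_b} := [ffun i => inord (x i)].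
  have g_inj : injective g.
    move=> x y /ffunP xy; apply/val_inj/mnmP=> i; have /(congr1 val) := xy i.
    rewrite !ffunE /= !inordK // ltnS -/b.
      rewrite -ltnS; apply: leq_trans (bmdeg y); rewrite ltnS mdegE (bigD1 i) //=.
      exact: leq_addr.
    rewrite -ltnS; apply: leq_trans (bmdeg x); rewrite ltnS mdegE (bigD1 i) //=.
    exact: leq_addr.
  by have := leq_card g g_inj; rewrite card_ffun !card_ord.
have cardME : (#|{: M}| < #|{: E}|)%N.
  rewrite card_ffun !card_ord; apply: (leq_ltn_trans cardM).
  have m0 : (0 < m)%N by [].
  have bm : (b <= (k * D).+1 * m)%N.
    by rewrite mulSn /b [(m * D)%N]mulnC mulnA -add1n leq_add.
  apply: (@leq_ltn_trans (((k * D).+1 * m) ^ s)); first by case: (s) => // t; rewrite leq_exp2r.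
  rewrite expnMn; apply: (@leq_trans (m ^ s.+1)).
    by rewrite expnS ltn_pmul2r ?expn_gt0 // ltnSn.
  by rewrite leq_pexp2l.
pose A : 'M[K]_(#|{: E}|, #|{: M}|) :=
  \matrix_(i, j) (q (enum_val i))@_(bmnm (enum_val j)).
have [v v0 vA] := wide_kernel A cardME.
have monI : injective mon.
  move=> e e' /mnmP ee; apply/ffunP=> i; apply: val_inj.
  by have := ee i; rewrite !mnmE.
exists (\sum_e v 0 (enum_rank e) *: 'X_[mon e]).
  apply: contraNneq v0 => G0; apply/eqP/rowP=> i; rewrite mxE.
  have := congr1 (mcoeff (mon (enum_val i))) G0.
  rewrite mcoeff0 raddf_sum /= (bigD1 (enum_val i)) //= mcoeffZ mcoeffX eqxx.
  rewrite mulr1 enum_valK big1 ?addr0 // => e ne.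
  by rewrite mcoeffZ mcoeffX (inj_eq monI) (negbTE ne) mulr0.
have -> : mmap (@mpolyC s K) f (\sum_e v 0 (enum_rank e) *: 'X_[mon e])
    = \sum_e v 0 (enum_rank e) *: q e.
  rewrite rmorph_sum; apply: eq_bigr => e _; rewrite [LHS]mmapZ mul_mpolyC mmapX.
  by congr (_ *: _); apply: eq_bigr => i _; rewrite mnmE.
apply/mpolyP=> x; rewrite mcoeff0 raddf_sum /=.
have [xb|xb] := ltnP (mdeg x) b; last first.
  rewrite big1 // => e _; rewrite mcoeffZ memN_msupp_eq0 ?mulr0 //.
  by apply: msize_mdeg_ge; apply: leq_trans (qb e) xb.
have := congr1 (fun w : 'rV_#|{: M}| => w 0 (enum_rank (BMultinom xb))) vA.
rewrite [RHS]mxE => E0; rewrite -[RHS]E0 mxE.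
rewrite (reindex_onto enum_val enum_rank) /=; last first.
  by move=> e _; rewrite enum_rankK.
apply: eq_big => [i|i _]; first by rewrite enum_valK eqxx.
by rewrite mcoeffZ enum_valK mxE enum_rankK.
Qed.

End AlgDep.

(** * Derivatives of principal minors *)

Section DualMatrix.
Variable K : fieldType.

Lemma dual_prod (J : finType) (P : pred J) (h : J -> dual K) :
  \prod_(i | P i) h i =
    (\prod_(i | P i) (h i).1,
     \sum_(i | P i) (h i).2 * \prod_(j | P j && (j != i)) (h j).1).
Proof.
rewrite [LHS]surjective_pairing -[X in (X, _)]/(dfst _) rmorph_prod; congr pair.
rewrite -big_filter -[in RHS]big_filter; under [in RHS]eq_bigr do rewrite -big_filter_cond.
have : uniq [seq i <- index_enum J | P i] by rewrite filter_uniq ?index_enum_uniq.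
elim: [seq i <- _ | _] => [|i s IH] /=; first by rewrite !big_nil.
case/andP=> is_ /IH E; rewrite !big_cons eqxx dual_mulE /= E [LHS]addrC.
rewrite [X in (h i).2 * X + _ = _](rmorph_prod (@dfst K)); congr (_ * _ + _).
  rewrite [RHS]big_seq_cond [LHS]big_seq; apply: eq_bigl => j.
  by case: eqP => [->|_]; rewrite ?andbT // (negbTE is_).
rewrite mulr_sumr big_seq [RHS]big_seq; apply: eq_bigr => j js.
rewrite big_cons (_ : i != j); first by ring.
by apply: contraNneq is_ => ->.
Qed.

Variable n : nat.
Implicit Types (T H : 'M[K]_n) (I : {set 'I_n}).

Definition dualmx T H : 'M[dual K]_n := \matrix_(i, j) (T i j, H i j).

Definition ddet T H : K := (\det (dualmx T H)).2.

Definition dpm T H I : K := (pm (dualmx T H) I).2.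

Lemma ddet_linear T a H H' : ddet T (a *: H + H') = a * ddet T H + ddet T H'.
Proof.
pose g (B : 'M[K]_n) := \sum_(s : 'S_n) (-1) ^+ s *
  \sum_i B i (s i) * \prod_(j | j != i) T j (s j).
have E B : ddet T B = g B.
  rewrite /ddet /determinant -[LHS]/(dsnd _) raddf_sum.
  apply: eq_bigr => s _ /=; rewrite dual_prod /= -(rmorphN1 (@dconst K)) -rmorphXn.
  rewrite /dconst /= mul0r addr0; congr (_ * _); apply: eq_bigr => i _.
  by rewrite mxE; congr (_ * _); apply: eq_bigr => j _; rewrite mxE.
rewrite !E /g mulr_sumr -big_split; apply: eq_bigr => s _ /=.
rewrite mulrCA -mulrDr; congr (_ * _); rewrite mulr_sumr -big_split /=.
by apply: eq_bigr => i _; rewrite !mxE; ring.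
Qed.

Lemma dualmx_sym T H : T^T = T -> H^T = H -> (dualmx T H)^T = dualmx T H.
Proof.
by move=> sT sH; apply/matrixP=> i j; rewrite !mxE (sym_entry i j sT) (sym_entry i j sH).
Qed.

Lemma dualmx_fst T H : map_mx (@dfst K) (dualmx T H) = T.
Proof. by apply/matrixP=> i j; rewrite !mxE. Qed.

Lemma dualmxE (T' : 'M[dual K]_n) T :
  map_mx (@dfst K) T' = T -> T' = dualmx T (map_mx snd T').
Proof. by move=> <-; apply/matrixP=> i j; rewrite !mxE [LHS]surjective_pairing. Qed.

Lemma pm_dualmx T H I : pm (dualmx T H) I = (pm T I, dpm T H I).
Proof.
rewrite [LHS]surjective_pairing; congr pair.
by rewrite -[LHS]/(dfst _) map_pm dualmx_fst.
Qed.

Lemma dpm_linear T a H H' I :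
  dpm T (a *: H + H') I = a * dpm T H I + dpm T H' I.
Proof.
have E B : dpm T B I = ddet (pmx T I) (\matrix_(i, j) if i \in I then B i j else 0).
  rewrite /dpm /ddet /pm (_ : pmx _ _ = dualmx (pmx T I)
    (\matrix_(i, j) if i \in I then B i j else 0)) //.
  apply/matrixP=> i j; rewrite !mxE; case: ifP => // _.
  by case: eqP.
rewrite !E -ddet_linear; congr ddet; apply/matrixP=> i j; rewrite !mxE.
by case: ifP => // _; rewrite mulr0 addr0.
Qed.

Lemma dpm0 T I : dpm T 0 I = 0.
Proof.
have := dpm_linear T 0 0 0 I; rewrite scale0r addr0 mul0r add0r => E.
by have := dpm_linear T 1 0 0 I; rewrite scale1r addr0 mul1r => /eqP;
  rewrite -subr_eq0 opprD addNKr oppr_eq0 => /eqP.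
Qed.

End DualMatrix.

(** * Dimension and smoothness at connected matrices *)

Section Small.
Variable r : nat.
Implicit Types (S : {set 'I_r}).

(* The sets of size at most two index coordinates on the cone; the empty set
   stands for the scaling factor. *)
Definition small_sets : {set {set 'I_r}} := [set S : {set 'I_r} | (#|S| <= 2)%N].

(** The projective dimension r(r+1)/2; the predecessor discounts the scaling factor. *)
Definition cone_dim : nat := #|small_sets|.-1.

Definition small_set (k : 'I_cone_dim.+1) : {set 'I_r} := nth set0 (enum small_sets) k.

Definition small_index S : 'I_cone_dim.+1 := inord (index S (enum small_sets)).

Lemma card_small_sets : #|small_sets| = cone_dim.+1.
Proof.
rewrite prednK // card_gt0; apply/set0Pn; exists set0.
by rewrite inE cards0.
Qed.

Lemma small_indexK S : (#|S| <= 2)%N -> small_set (small_index S) = S.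
Proof.
move=> S2; have Ss : S \in enum small_sets by rewrite mem_enum inE.
rewrite /small_set /small_index inordK ?nth_index //.
by rewrite -card_small_sets cardE index_mem.
Qed.

Lemma small_setP k : (#|small_set k| <= 2)%N.
Proof.
have : small_set k \in enum small_sets.
  by rewrite mem_nth // -cardE card_small_sets.
by rewrite mem_enum inE.
Qed.

Lemma small_setK k : small_index (small_set k) = k.
Proof.
apply: val_inj; rewrite /= /small_index /small_set index_uniq ?inordK ?enum_uniq //.
by rewrite -cardE card_small_sets.
Qed.

Lemma card_pair (i j : 'I_r) : (#|[set i; j]| <= 2)%N.
Proof. by rewrite cards2; case: eqP. Qed.

Lemma small_cases S : (#|S| <= 2)%N -> S = set0 \/ exists i j, S = [set i; j].
Proof.
case E: #|S| => [|[|[|//]]] _; first by left; apply: cards0_eq.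
  by right; have /cards1P[i ->] : #|S| == 1%N by [rewrite E]; exists i, i; rewrite setUid.
by right; have /cards2P[i [j [_ ->]]] : #|S| == 2%N by [rewrite E]; exists i, j.
Qed.

Lemma set_pair_eq (i j a b : 'I_r) : [set i; j] = [set a; b] ->
  (i = a /\ j = b) \/ (i = b /\ j = a).
Proof.
move=> E; have /set2P ia : i \in [set a; b] by rewrite -E set21.
have /set2P jb : j \in [set a; b] by rewrite -E set22.
have /set2P ai : a \in [set i; j] by rewrite E set21.
have /set2P bi : b \in [set i; j] by rewrite E set22.
case: ia => ?; case: jb => ?; subst; try (by [left|right]).
  by case: bi => ->; left.
by case: ai => ->; left.
Qed.

(** Packs a scalar and a symmetric matrix into one function on small sets; diagonal entries sit at
    [[set i; i]], the singletons. *)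
Lemma pair_function (A : Type) (a0 : A) (T : 'M[A]_r) : T^T = T ->
  exists val : {set 'I_r} -> A, val set0 = a0 /\ forall i j, val [set i; j] = T i j.
Proof.
move=> symT.
exists (fun S => if [pick ij : 'I_r * 'I_r | S == [set ij.1; ij.2]] is Some ij
                 then T ij.1 ij.2 else a0); split=> [|i j].
  case: pickP => // -[i j] /= /eqP/setP/(_ i).
  by rewrite set21 inE.
case: pickP => [[a b] /= /eqP /set_pair_eq[[-> ->]|[-> ->]] //|/(_ (i, j))].
  exact: sym_entry.
by rewrite eqxx.
Qed.

End Small.

Section Smooth.
Variables (R : realType) (r : nat).
Local Notation C := R[i].
Local Notation N := #|{set 'I_r}|.
Local Notation d := (cone_dim r).
Implicit Types (T : 'M[C]_r) (I : {set 'I_r}).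

(** Any values with nonzero scaling coordinate are minors of size at most two of a symmetric matrix,
    whose off-diagonal entries are complex square roots. Multiplying G by the scaling variable takes
    care of the remaining values. *)
Lemma dpp_coordinates_independent :
  alg_independent (@dpp_variety R r)
    [tuple 'X_(enum_rank (small_set k)) | k < d.+1].
Proof.
move=> G /vanishing_idealP IG.
suff /eqP : G * 'X_(small_index set0) = 0.
  rewrite mulf_eq0 => /orP[/eqP //|/eqP/(congr1 (mcoeff U_(small_index set0)))].
  by rewrite mcoeffX eqxx mcoeff0 => /eqP; rewrite oner_eq0.
apply: mpoly_all0 => v; rewrite rmorphM /= mevalXU.
set c := v _; have [->|c0] := eqVneq c 0; first by rewrite mulr0.
pose w S := v (small_index S).
pose T : 'M[C]_r := \matrix_(i, j) if i == j then w [set i] / c else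
  sqrtC (w [set i] / c * (w [set j] / c) - w [set i; j] / c).
have symT : T^T = T.
  apply/matrixP=> i j; rewrite !mxE eq_sym; case: eqP => [->//|_].
  by rewrite setUC [w [set i] / _ * _]mulrC.
have := IG c T symT.
rewrite /ev /comp_mpoly mmap_rmorph.
rewrite (_ : mmap _ _ _ = G.@[v]) => [->|]; first by rewrite mul0r.
apply: mmap_ext => [a|k] /=; first by rewrite mmapC.
rewrite tnth_mktuple mmapX mmap1U enum_rankK -[in RHS](small_setK k).
rewrite -/(w _); case: (small_cases (small_setP k)) => [->|[i [j ->]]].
  by rewrite pm0 mulr1.
have [<-|nij] := eqVneq i j.
  by rewrite setUid pm1 mxE eqxx mulrCA divff ?mulr1.
rewrite pm2 // (sym_entry j i symT) -expr2 !mxE !eqxx (negbTE nij) sqrtCK.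
by field.
Qed.

(** On the cone every coordinate is a polynomial in the d + 1 parameters c and T_ij, so
    [alg_dependent] applies to the pulled-back functions. *)
Lemma dpp_dependent k (f : k.-tuple {mpoly C[N]}) :
  alg_independent (@dpp_variety R r) f -> (k <= d.+1)%N.
Proof.
move=> indf; rewrite leqNgt; apply/negP => dk.
pose p S : {mpoly C[d.+1]} := 'X_(small_index S).
pose X I : {mpoly C[d.+1]} := p set0 * pm (\matrix_(i, j) p [set i; j]) I.
pose h (F : {mpoly C[N]}) : {mpoly C[d.+1]} := mmap (@mpolyC _ _) (fun k => X (enum_val k)) F.
have [G G0 fG] := alg_dependent (fun i => h (tnth f i)) dk.
move/eqP: G0; apply; apply: indf; apply/vanishing_idealP => c T symT.
have hG : h (G \mPo f) = 0.
  rewrite -[RHS]fG /h /comp_mpoly mmap_rmorph; apply: mmap_ext => [a|i] //=.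
  by rewrite mmapC.
have [val [val0 valT]] := pair_function c symT.
have := congr1 (meval (fun k => val (small_set k))) hG; rewrite meval0 => E.
rewrite -[RHS]E /h mmap_rmorph; apply: mmap_ext => [a|i] /=.
  by rewrite mevalC.
rewrite /X rmorphM /= mevalXU small_indexK ?cards0 // val0 map_pm.
congr (_ * pm _ _); apply/matrixP=> a b.
by rewrite !mxE /= mevalXU small_indexK ?valT // card_pair.
Qed.

Lemma dpp_proj_dim : proj_dim (@dpp_variety R r) d.
Proof.
split; last exact: dpp_dependent.
by exists [tuple 'X_(enum_rank (small_set k)) | k < d.+1];
  exact: dpp_coordinates_independent.
Qed.

Lemma dpp_proj_dim_uniq e : proj_dim (@dpp_variety R r) e -> e = d.
Proof.
move=> [[f /dpp_dependent]]; rewrite ltnS => ed /(_ _ _ dpp_coordinates_independent).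
by rewrite ltnS => de; apply/eqP; rewrite eqn_leq ed.
Qed.

(** The image of (c', H) under the differential of (c, T) |-> c pm T. *)
Definition tangent_vec (c : C) T (c' : C) (H : 'M[C]_r) : subset_vec C r :=
  \row_k (c * dpm T H (enum_val k) + c' * pm T (enum_val k)).

Lemma coord_tangent_vec c T c' H I :
  coord (tangent_vec c T c' H) I = c * dpm T H I + c' * pm T I.
Proof. by rewrite /coord mxE enum_rankK. Qed.

Lemma coord_linear a (p q : subset_vec C r) I :
  coord (a *: p + q) I = a * coord p I + coord q I.
Proof. by rewrite /coord !mxE. Qed.

Lemma tangent_vec_dual c T c' H I :
  (c * pm T I, coord (tangent_vec c T c' H) I)
  = ((c, c') : dual C) * pm (dualmx T H) I.
Proof. by rewrite coord_tangent_vec pm_dualmx. Qed.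

Lemma cone_pt_variety c T : T^T = T -> c != 0 -> dpp_variety (cone_pt c T).
Proof.
move=> symT c0; apply/dpp_varietyP; split.
  apply: contraNneq c0 => E; have := coord_cone_pt c T set0.
  by rewrite E pm0 mulr1 /coord mxE => <-.
by apply: (onV_ext (x := fun I => c * pm T I)) => [I|]; rewrite ?coord_cone_pt //;
  apply: onV_psi.
Qed.

Lemma tangent_vec_cone c T c' H : T^T = T -> H^T = H -> c != 0 ->
  cone_tangent (@dpp_variety R r) (cone_pt c T) (tangent_vec c T c' H).
Proof.
move=> symT symH c0; apply/cone_tangentP; first exact: cone_pt_variety.
apply: (onV_ext (x := fun I => ((c, c') : dual C) * pm (dualmx T H) I)).
  by move=> I; rewrite -tangent_vec_dual coord_cone_pt.
exact: onV_dual (dualmx_sym symT symH).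
Qed.

Lemma connected_tangent c T v : T^T = T -> \det T != 0 -> connected_mx T ->
  (0 < r)%N -> c != 0 ->
  cone_tangent (@dpp_variety R r) (cone_pt c T) v ->
  exists c' H, H^T = H /\ v = tangent_vec c T c' H.
Proof.
move=> symT detT cT r0 c0 /(cone_tangentP _ (cone_pt_variety symT c0)) Vv.
have [lift _ _] := connected_rigid (Ordinal r0) symT detT cT.
have [|c' [T' [symT' T'1 c'1 E]]] := lift c _ c0 Vv.
  by move=> I; rewrite /= coord_cone_pt.
exists c'.2, (map_mx snd T'); split; first by rewrite map_trmx symT'.
have c'E : c' = (c, c'.2) by rewrite [LHS]surjective_pairing -c'1.
apply: coordK => I; have := tangent_vec_dual c T c'.2 (map_mx snd T') I.
by rewrite -c'E -(dualmxE T'1) -E => -[].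
Qed.

(** Small sets identify the pairs (c', H) with row vectors of length d + 1. On these the
    differential is injective by [rigid_duals], and its image is the tangent space by
    [lifts_duals]. *)
Lemma connected_nonsingular c T : T^T = T -> \det T != 0 -> connected_mx T ->
  (0 < r)%N -> c != 0 ->
  nonsingular_point (@dpp_variety R r) (cone_pt c T).
Proof.
move=> symT detT cT r0 c0.
pose mat (t : 'rV[C]_d.+1) : 'M[C]_r := \matrix_(i, j) t 0 (small_index [set i; j]).
have matS t : (mat t)^T = mat t by apply/matrixP=> i j; rewrite !mxE setUC.
pose L (t : 'rV[C]_d.+1) := tangent_vec c T (t 0 (small_index set0)) (mat t).
have mat_lin a t u : mat (a *: t + u) = a *: mat t + mat u.
  by apply/matrixP=> i j; rewrite !mxE.
have L_lin : linear L.
  move=> a t u; apply: coordK => I.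
  rewrite coord_tangent_vec mat_lin dpm_linear coord_linear !coord_tangent_vec !mxE.
  rewrite !mulrDr !mulrDl !mulrA [c * a]mulrC -!addrA; congr (_ + _).
  by rewrite addrCA.
pose LL := GRing.isLinear.Build _ _ _ _ L L_lin.
pose Lf : {linear 'rV[C]_d.+1 -> subset_vec C r} := HB.pack L LL.
pose f : 'Hom('rV[C]_d.+1, subset_vec C r) := linfun Lf.
have fE t : f t = L t by rewrite lfunE.
exists d, (limg f); split; first exact: dpp_proj_dim.
  rewrite limg_dim_eq ?dimvf ?dim_matrix; first exact: mul1n.
  apply/eqP; rewrite -subv0; apply/subvP=> t; rewrite memv_cap memv_ker memv0 fE.
  case/andP=> _ /eqP Lt.
  have [_ rig _] := connected_rigid (Ordinal r0) symT detT cT.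
  have Lt0 I : c * dpm T (mat t) I + t 0 (small_index set0) * pm T I = 0.
    by rewrite -coord_tangent_vec -/(L t) Lt /coord mxE.
  have t0 : t 0 (small_index set0) = 0.
    have := Lt0 set0; rewrite /dpm !pm0 mulr1 => <-.
    by rewrite [X in c * X](_ : _ = 0) // mulr0 add0r.
  have Ht I : pm (dualmx T (mat t)) I = dconst (pm T I).
    rewrite pm_dualmx; congr pair; have /eqP := Lt0 I.
    by rewrite t0 mul0r addr0 mulf_eq0 (negbTE c0) => /eqP.
  have E := rig _ (dualmx_sym symT (matS t)) (dualmx_fst _ _) Ht.
  apply/eqP/rowP=> k; rewrite mxE -(small_setK k).
  case: (small_cases (small_setP k)) => [->//|[i [j ->]]].
  by have /matrixP/(_ i j) := E; rewrite !mxE => -[].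
move=> v; split=> [/memv_imgP[t _ ->]|].
  by rewrite fE; apply: tangent_vec_cone.
case/connected_tangent=> // c' [H [symH ->]].
have [val [val0 valH]] := pair_function c' symH.
apply/memv_imgP; exists (\row_k val (small_set k)); first exact: memvf.
rewrite fE /L mxE small_indexK ?cards0 // val0; congr tangent_vec.
by apply/matrixP=> i j; rewrite !mxE small_indexK ?valH // card_pair.
Qed.

End Smooth.

(** * Singularity at disconnected matrices *)

Section Curves.
Variables (K : numFieldType) (r : nat).
Implicit Types (T H : 'M[K]_r) (I : {set 'I_r}) (v : {set 'I_r} -> K).

Lemma poly_horner_eq (p q : {poly K}) : (forall y, p.[y] = q.[y]) -> p = q.
Proof.
move=> pq; apply/eqP; rewrite -subr_eq0; apply/eqP; apply: poly_all0 => y.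
by rewrite hornerD hornerN pq subrr.
Qed.

Definition curve T H I : {poly K} := pm (map_mx polyC T + 'X *: map_mx polyC H) I.

Lemma curve_horner T H I y : (curve T H I).[y] = pm (T + y *: H) I.
Proof.
rewrite /curve -horner_evalE map_pm; congr pm; apply/matrixP=> a b.
by rewrite !mxE /= horner_evalE !hornerE.
Qed.

Lemma curve_coef0 T H I : (curve T H I)`_0 = pm T I.
Proof. by rewrite -horner_coef0 curve_horner scale0r addr0. Qed.

Lemma curve_coef1 T H I : (curve T H I)`_1 = dpm T H I.
Proof.
rewrite /dpm; have -> : dualmx T H
    = map_mx (jet 0) (map_mx polyC T + 'X *: map_mx polyC H).
  apply/matrixP=> a b; rewrite !mxE /= /jet !derivE; congr pair.
    by rewrite !hornerE.
  by rewrite !hornerE.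
rewrite -map_pm /= -/(curve T H I) horner_coef0 coef_deriv mulr1n //.
Qed.

Lemma curve_coef1D T H H' I :
  (curve T (H + H') I)`_1 = (curve T H I)`_1 + (curve T H' I)`_1.
Proof. by rewrite !curve_coef1 -[H]scale1r dpm_linear scale1r mul1r. Qed.

Lemma curve_single T H i : curve T H [set i] = Poly [:: T i i; H i i].
Proof.
apply: poly_horner_eq => y; rewrite curve_horner pm1 horner_Poly /= !mxE.
by ring.
Qed.

Lemma curve_pair T H i j : T^T = T -> H^T = H -> i != j ->
  curve T H [set i; j] = Poly [:: T i i * T j j - T i j ^+ 2;
    T i i * H j j + H i i * T j j - 2%:R * T i j * H i j;
    H i i * H j j - H i j ^+ 2].
Proof.
move=> sT sH nij; apply: poly_horner_eq => y.
rewrite curve_horner pm2 // horner_Poly /= !mxE (sym_entry j i sT) (sym_entry j i sH).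
by ring.
Qed.

(** Only the coefficients of degree two and three will be read, so the lower ones stay
    existential. *)
Lemma curve_triple T H i j k : T^T = T -> H^T = H ->
  H i i = 0 -> H j j = 0 -> H k k = 0 -> i != j -> i != k -> j != k ->
  exists a b, curve T H [set i; j; k] = Poly [:: a; b;
    2%:R * (T i j * H i k * H j k + T i k * H i j * H j k + T j k * H i j * H i k)
      - T i i * H j k ^+ 2 - T j j * H i k ^+ 2 - T k k * H i j ^+ 2;
    2%:R * H i j * H i k * H j k].
Proof.
move=> sT sH Hi Hj Hk nij nik njk.
exists (T i i * T j j * T k k + 2%:R * T i j * T i k * T j k - T i i * T j k ^+ 2
  - T j j * T i k ^+ 2 - T k k * T i j ^+ 2),
  (2%:R * (T i j * T i k * H j k + T i j * T j k * H i k + T i k * T j k * H i j)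
   - 2%:R * (T i i * T j k * H j k + T j j * T i k * H i k + T k k * T i j * H i j)).
apply: poly_horner_eq => y.
rewrite curve_horner pm3 // horner_Poly /= !mxE Hi Hj Hk.
rewrite (sym_entry j i sT) (sym_entry j i sH) (sym_entry k i sT) (sym_entry k i sH).
by rewrite (sym_entry k j sT) (sym_entry k j sH); ring.
Qed.

Lemma curve_set0 T H : curve T H set0 = 1.
Proof. by rewrite /curve pm0. Qed.

Definition tangentV T v : Prop := onV (@dconst K) (fun I => (pm T I, v I) : dual K).

Lemma tangentV_linear T a b v w : tangentV T v -> tangentV T w ->
  tangentV T (fun I => a * v I + b * w I).
Proof.
move=> tv tw F IF.
have := tv F IF; have := tw F IF; rewrite /ev !mmap_dconst /= => -[F0 Ew] [_ Ev].
congr pair; first exact: F0.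
rewrite (eq_bigr _ (fun k _ => mulrDr _ _ _)) big_split /=.
under eq_bigr do rewrite mulrCA; rewrite -mulr_sumr Ev mulr0 add0r.
by under eq_bigr do rewrite mulrCA; rewrite -mulr_sumr Ew mulr0.
Qed.

Lemma tangentV_pm T : T^T = T -> tangentV T (pm T).
Proof.
move=> symT; apply: (onV_ext (x := fun I => ((1, 1) : dual K) * pm (dualmx T 0) I)).
  move=> I; rewrite pm_dualmx dual_mulE /=; congr pair; first by rewrite mul1r.
  by rewrite dpm0 mulr0 add0r mul1r.
by apply: onV_dual; apply: dualmx_sym; rewrite ?trmx0.
Qed.

Lemma tangentV_dpm T H : T^T = T -> H^T = H -> tangentV T (dpm T H).
Proof.
move=> symT symH; apply: (onV_ext (x := fun I => 1 * pm (dualmx T H) I)).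
  by move=> I; rewrite pm_dualmx mul1r.
by apply: onV_dual; apply: dualmx_sym.
Qed.

(* If the velocity of a curve vanishes, its second and third order
   coefficients are tangent. *)
Lemma tangentV_coef T H m : T^T = T -> H^T = H -> (1 < m < 4)%N ->
  (forall I, (curve T H I)`_1 = 0) -> tangentV T (fun I => (curve T H I)`_m).
Proof.
move=> symT symH m4 c1 F IF.
(* Among polynomials without linear term, keeping the coefficients 0 and m is multiplicative for m =
   2 and 3; for m = 4 the product of the quadratic terms would interfere. *)
have coefM1 (p q : {poly K}) : p`_1 = 0 -> q`_1 = 0 ->
    (p * q)`_1 = 0 /\ (p * q)`_m = p`_0 * q`_m + p`_m * q`_0.
  move=> p1 q1; rewrite !coefM; case: m m4 => [|[|[|[|//]]]] // _;
    rewrite !big_ord_recl !big_ord0 /= ?p1 ?q1 ?mulr0 ?mul0r ?addr0 ?add0r //.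
have [_ ] : (mmap polyC (fun k => curve T H (enum_val k)) F)`_1 = 0 /\
    mmap (@dconst K) (fun k => (pm T (enum_val k), (curve T H (enum_val k))`_m)) F
    = ((mmap polyC (fun k => curve T H (enum_val k)) F)`_0,
       (mmap polyC (fun k => curve T H (enum_val k)) F)`_m).
  elim/mpoly_ring_ind: F {IF} => [a|i|p q [p1 pm] [q1 qm]|p q [p1 pm] [q1 qm]].
  - rewrite !mmapC !coefC /=; split=> //.
    by case: (m) m4 => [|[|m']].
  - by rewrite !mmapX !mmap1U c1 curve_coef0.
  - by rewrite !rmorphD /= !coefD p1 q1 addr0 pm qm.
  - rewrite !rmorphM /=; have [-> ->] := coefM1 _ _ p1 q1.
    by rewrite pm qm coef0M.
rewrite /ev => ->.
have -> : mmap polyC (fun k => curve T H (enum_val k)) F = 0.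
  have := @curve_ideal K r _ idfun 1 (map_mx polyC T + 'X *: map_mx polyC H) F.
  move=> /(_ _ IF) <-; last by rewrite linearD linearZ /= !map_trmx symT symH.
  by apply: mmap_ext => // k /=; rewrite mul1r.
by rewrite !coef0.
Qed.

(** The direction of the coordinate theta_ij = theta_ji; for i = j its only entry is 1, not 2. *)
Definition symE (i j : 'I_r) : 'M[K]_r :=
  \matrix_(a, b) (((a == i) && (b == j)) || ((a == j) && (b == i)))%:R.

Lemma symE_sym i j : (symE i j)^T = symE i j.
Proof. by apply/matrixP=> a b; rewrite !mxE andbC orbC andbC. Qed.

Lemma symEC i j : symE i j = symE j i.
Proof. by apply/matrixP=> a b; rewrite !mxE orbC. Qed.

Lemma symE_in i j : symE i j i j = 1.
Proof. by rewrite mxE !eqxx. Qed.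

Lemma symE_pair i j a b : [set a; b] != [set i; j] -> symE i j a b = 0.
Proof.
move=> h; rewrite mxE; case: orP => // -[] /andP[/eqP E1 /eqP E2]; move: h.
  by rewrite E1 E2 eqxx.
by rewrite E1 E2 setUC eqxx.
Qed.

(* Conjugation by the signs of B fixes T and negates H. *)
Lemma curve_odd T H (B : {set 'I_r}) I :
  (forall a b, (a \in B) != (b \in B) -> T a b = 0) ->
  (forall a b, (a \in B) == (b \in B) -> H a b = 0) ->
  (curve T H I)`_1 = 0.
Proof.
move=> TB HB; have /(congr1 (coefp 1)) /= : curve T H I = curve T H I \Po (- 'X).
  apply: poly_horner_eq => y; rewrite horner_comp !curve_horner.
  pose s (a : 'I_r) : K := (-1) ^+ (a \in B).
  have -> : T + (- 'X).[y] *: H = \matrix_(a, b) (s a * (T + y *: H) a b * s b).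
    apply/matrixP=> a b; rewrite !mxE !hornerE /s.
    have [ab|ab] := boolP ((a \in B) == (b \in B)).
      rewrite HB // !mulr0 !addr0 -mulrA mulrCA mulrC (eqP ab) -expr2.
      by rewrite sqrr_sign mul1r.
    rewrite TB // !add0r; case: (a \in B) ab => /=; case: (b \in B) => //= _;
      by rewrite expr0 expr1; ring.
  rewrite pm_scale big1 ?mul1r // => a _; by rewrite -expr2 sqrr_sign.
have -> : (curve T H I \Po - 'X)`_1 = - (curve T H I)`_1.
  have coef1E (p : {poly K}) : p`_1 = p^`().[0].
    by rewrite horner_coef0 coef_deriv mulr1n.
  rewrite !coef1E deriv_comp derivN derivX hornerM horner_comp !hornerE.
  by rewrite oppr0 mulrN1.
by move/eqP; rewrite -addr_eq0 -mulr2n mulrn_eq0 => /eqP.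
Qed.

End Curves.

Lemma pstep_lincomb (A : comNzRingType) r (J : finType) (a : J -> A)
    (w : J -> {set 'I_r} -> A) b x k s I :
  pstep k s (fun I => \sum_j a j * w j I + b * x I) I
  = \sum_j a j * pstep k s (w j) I + b * pstep k s x I.
Proof.
rewrite /pstep; case: ifP => _.
  by rewrite !addr0; congr (_ + _); apply: eq_bigr => j _; rewrite addr0.
rewrite [in RHS](eq_bigr (fun j => a j * w j I + s * (a j * w j (k |: I)))) => [|j _].
  by rewrite big_split /= -mulr_sumr; ring.
by ring.
Qed.

Lemma pair_diag_neq r (a i j : 'I_r) : i != j -> [set a; a] != [set i; j].
Proof. by apply: contraNneq => /set_pair_eq[[-> ->]|[-> ->]]. Qed.

Section Singular.
Variables (K : numFieldType) (r : nat).
Local Notation d := (cone_dim r).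
Implicit Types (T H : 'M[K]_r) (I : {set 'I_r}).

(* One tangent vector more than the dimension of the cone. *)
Definition many_tangents T : Prop :=
  exists (w : 'I_d.+1 -> {set 'I_r} -> K) (x : {set 'I_r} -> K),
    [/\ forall k, tangentV T (w k), tangentV T x
      & forall a b, (forall I, \sum_k a k * w k I + b * x I = 0) ->
          (forall k, a k = 0) /\ b = 0].

(** The map g, a nonzero multiple of the inverse linear move, sends tangent vectors at the moved
    matrix to tangent vectors at T and is injective. *)
Lemma many_tangents_step k s T : 1 + s * T k k != 0 ->
  many_tangents (step k s T) -> many_tangents T.
Proof.
move=> u [w [x [tw tx ind]]].
have uU : 1 + s * T k k \is a GRing.unit by rewrite unitfE.
pose g (y : {set 'I_r} -> K) I := (1 + s * T k k) * pstep k (- s) y I.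
have tg y : tangentV (step k s T) y -> tangentV T (g y).
  move=> /(@onV_pstep _ _ _ _ k (- s))/(onV_scale (1 + s * T k k)) ty.
  apply: onV_ext ty => I.
  have E : pstep k (dconst (- s)) (fun I => (pm (step k s T) I, y I) : dual K) I
      = (pstep k (- s) (pm (step k s T)) I, pstep k (- s) y I).
    rewrite /pstep; case: ifP => _; first by rewrite !addr0.
    by rewrite dual_mulE dual_addE /= mul0r addr0.
  rewrite [X in _ * X]E dual_mulE /= mul0r addr0; congr pair.
  rewrite -pstepZ -[RHS](pstepK k s (pm T)).
  by apply: pstep_ext => J; exact: pm_pstep.
exists (fun i => g (w i)), (g x); split=> [i||a b E]; [exact: tg (tw i) | exact: tg tx |].
apply: ind => I; pose S J := \sum_i a i * w i J + b * x J.
have S0 : pstep k (- s) S =1 fun=> 0.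
  move=> J.
  apply: (mulfI u); rewrite mulr0 -[RHS](E J) /g /S pstep_lincomb.
  rewrite mulrDr mulr_sumr [X in _ + X]mulrCA; congr (_ + _).
  by apply: eq_bigr => i _; rewrite mulrCA.
have := pstepK k (- s) S I; rewrite opprK -/(S I) => <-.
by rewrite (pstep_ext _ _ _ S0) /pstep mulr0 if_same addr0.
Qed.

(** One vector per small set: pm T for the empty set, and for {i, j} the first derivative along
    E_ij, or the second coefficient when T_ij = 0. These are triangular with respect to the
    coordinates at small sets. The additional vector vanishes at all small sets but not at some
    triple. *)
Lemma many_tangents_transitive T : T^T = T -> \det T != 0 ->
  transitive_support T -> ~ connected_mx T -> (2 < r)%N -> many_tangents T.
Proof.
move=> symT detT trT ncT r3.
have Td := transitive_diag symT detT trT.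
have Tsym a b : (T a b != 0) = (T b a != 0) by rewrite (sym_entry a b symT).
(* The neighbours of i form a block containing i and, as T_ij = 0, not j. Changing signs on it fixes
   T and negates a direction H supported across its boundary. *)
have cross i j (H : 'M[K]_r) : T i j = 0 ->
    (forall a b, (T i a != 0) == (T i b != 0) -> H a b = 0) ->
    forall I, (curve T H I)`_1 = 0.
  move=> ij H0 I; apply: (@curve_odd _ _ T H [set a | T i a != 0]) => a b.
    rewrite !inE => ab; apply/eqP; apply: contraT => Tab.
    case/negP: ab; apply/eqP; apply/idP/idP => h; first exact: trT h Tab.
    by apply: trT h _; rewrite Tsym.
  by rewrite !inE; apply: H0.
have crossE i j : T i j = 0 -> forall I, (curve T (symE K i j) I)`_1 = 0.
  move=> ij; apply: (cross i j) => // a b ab; apply: symE_pair.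
  apply: contraTneq ab => /set_pair_eq[[-> ->]|[-> ->]];
    by rewrite ij Td eqxx.
pose vec i j I : K := if T i j == 0 then (curve T (symE K i j) I)`_2
                      else dpm T (symE K i j) I.
have tvec i j : tangentV T (vec i j).
  rewrite /vec; case: eqP => ij; last exact: tangentV_dpm (symE_sym _ _ _).
  by apply: tangentV_coef => //; [exact: symE_sym | exact: crossE].
have vec0 i j : vec i j set0 = 0.
  rewrite /vec -curve_coef1 curve_set0 !coef1; by case: ifP.
have vec1 i j a : vec i j [set a] = ((i == a) && (j == a))%:R.
  rewrite /vec -curve_coef1 curve_single !coef_Poly /= mxE [(a == j) && _]andbC orbb.
  have [ij|ij] := eqVneq (T i j) 0; last by rewrite !(eq_sym a).
  case: andP => [[/eqP ia /eqP ja]|//]; have := Td a.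
  by rewrite -{1}ia -ja ij eqxx.
have vec2 i j a b : a != b -> i != j ->
    vec i j [set a; b] != 0 -> [set a; b] = [set i; j].
  move=> ab ij; apply: contraNeq => h.
  rewrite /vec -curve_coef1 curve_pair // ?symE_sym // !coef_Poly /=.
  rewrite (symE_pair K h) !symE_pair ?pair_diag_neq //.
  by rewrite !mulr0 mul0r expr0n /= !subr0 addr0; case: ifP.
have vec2_diag i j : i != j -> vec i j [set i; j] != 0.
  move=> ij; rewrite /vec -curve_coef1 curve_pair // ?symE_sym // !coef_Poly /=.
  rewrite symE_in symE_pair ?symE_pair.
  - case: (T i j =P 0) => [_|/eqP Tij].
      by rewrite mulr0 expr1n sub0r oppr_eq0 oner_eq0.
    by rewrite mulr0 mul0r addr0 sub0r mulr1 oppr_eq0 mulf_neq0 // pnatr_eq0.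
  - exact: pair_diag_neq.
  exact: pair_diag_neq.
have [x [J [tx xsmall xJ]]] : exists x J, [/\ tangentV T x,
    forall S : {set 'I_r}, (#|S| <= 2)%N -> x S = 0 & x J != 0].
  (* If some off-diagonal T_jk is nonzero, an i outside that block gives a second-order vector with
     value 2 T_jk at {i, j, k}; if T is diagonal, third order is needed. *)
  have [|] := boolP [exists jk : 'I_r * 'I_r, (jk.1 != jk.2) && (T jk.1 jk.2 != 0)].
    case/existsP=> -[j k] /= /andP[njk Tjk].
    have [i Tij] : exists i, T i j = 0.
      apply: contra_notP ncT => nex B sB.
      have Tall i : T i j != 0 by apply/eqP => Tij; apply: nex; exists i.
      have [->|/set0Pn[a aB]] := eqVneq B set0; [by left | right].
      apply/setP=> b; rewrite inE; apply: contraT => bB.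
      have : T a b != 0 by apply: trT (Tall a) _; rewrite Tsym.
      by rewrite sB ?eqxx.
    have Tik : T i k = 0.
      by apply/eqP; apply: contraT => h; have := trT _ _ _ h; rewrite Tsym in Tjk;
        move=> /(_ _ Tjk); rewrite Tij eqxx.
    have nij : i != j by apply: contraTneq (Td j) => E; rewrite negbK -{1}E Tij.
    have nik : i != k by apply: contraTneq (Td k) => E; rewrite negbK -{1}E Tik.
    have E0 (p q a : 'I_r) : p != q -> symE K p q a a = 0.
      by move=> npq; apply: symE_pair; apply: pair_diag_neq.
    pose H1 : 'M[K]_r := symE K i j + symE K i k.
    have H1E a b : H1 a b = symE K i j a b + symE K i k a b by rewrite mxE.
    have H10 a : H1 a a = 0 by rewrite H1E !E0 ?addr0.
    have symH1 : H1^T = H1 by rewrite linearD /= !symE_sym.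
    have H1c : forall I, (curve T H1 I)`_1 = 0.
      by move=> I; rewrite /H1 curve_coef1D (crossE i j Tij) (crossE i k Tik) addr0.
    (* Polarization of the second-order coefficient: on small sets the mixed term of E_ij and E_ik
       vanishes. *)
    pose x I := 1 * (1 * (curve T H1 I)`_2 + -1 * (curve T (symE K i j) I)`_2)
      + -1 * (curve T (symE K i k) I)`_2.
    exists x, [set i; j; k]; split.
    - apply: tangentV_linear; first apply: tangentV_linear.
      + by apply: tangentV_coef.
      + by apply: tangentV_coef => //; [exact: symE_sym | exact: crossE].
      + by apply: tangentV_coef => //; [exact: symE_sym | exact: crossE].
    - move=> S /small_cases[->|[a [b ->]]].
        by rewrite /x !curve_set0 !coef1 /=; ring.
      have [<-|nab] := eqVneq a b.
        by rewrite setUid /x !curve_single !coef_Poly /=; ring.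
      rewrite /x !curve_pair // ?symE_sym // !coef_Poly /= !H10 !E0 // H1E.
      have [->|e1] := eqVneq (symE K i j a b) 0; first by ring.
      have -> : symE K i k a b = 0; last by ring.
      apply: symE_pair; apply: contraNneq e1 => E; rewrite symE_pair // E.
      by apply: contraNneq njk => /set_pair_eq[[_ ->]|[-> ->]].
    rewrite /x.
    have [a1 [b1 ->]] := curve_triple symT symH1 (H10 i) (H10 j) (H10 k) nij nik njk.
    have [a2 [b2 ->]] := curve_triple symT (symE_sym K i j) (E0 _ _ i nij)
      (E0 _ _ j nij) (E0 _ _ k nij) nij nik njk.
    have [a3 [b3 ->]] := curve_triple symT (symE_sym K i k) (E0 _ _ i nik)
      (E0 _ _ j nik) (E0 _ _ k nik) nij nik njk.
    rewrite !coef_Poly /= !mxE !eqxx (negbTE nij) (negbTE nik) (negbTE njk).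
    rewrite [j == i]eq_sym [k == i]eq_sym [k == j]eq_sym.
    rewrite (negbTE nij) (negbTE nik) (negbTE njk) /=.
    rewrite [X in X != 0](_ : _ = 2%:R * T j k); last by ring.
    by rewrite mulf_neq0 // pnatr_eq0.
  rewrite negb_exists => /forallP Tdiag.
  have T0 a b : a != b -> T a b = 0.
    by move=> ab; have := Tdiag (a, b); rewrite /= ab negbK => /eqP.
  pose i : 'I_r := Ordinal (ltnW (ltnW r3)).
  pose j : 'I_r := Ordinal (ltnW r3); pose k : 'I_r := Ordinal r3.
  have nij : i != j by []. have nik : i != k by []. have njk : j != k by [].
  (* A triangle of directions: minors on small sets have degree at most two along H, while the one
     on {i, j, k} has cubic coefficient 2. *)
  pose H : 'M[K]_r := symE K i j + (symE K i k + symE K j k).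
  have symH : H^T = H by rewrite !linearD /= !symE_sym.
  have Hc : forall I, (curve T H I)`_1 = 0.
    move=> I; rewrite /H (curve_coef1D T (symE K i j)) (curve_coef1D T (symE K i k)).
    rewrite (crossE i j (T0 _ _ nij)) (crossE i k (T0 _ _ nik)).
    by rewrite (crossE j k (T0 _ _ njk)) !addr0.
  exists (fun I => (curve T H I)`_3), [set i; j; k]; split.
  - exact: tangentV_coef.
  - move=> S /small_cases[->|[a [b ->]]].
      by rewrite curve_set0 coef1.
    have [<-|nab] := eqVneq a b.
      by rewrite setUid curve_single coef_Poly.
    by rewrite curve_pair // coef_Poly.
  have H0 a : H a a = 0.
    rewrite !mxE; case: (a =P i) => [->|_]; first by rewrite /= !addr0.
    case: (a =P j) => [->|_]; first by rewrite /= !addr0.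
    by rewrite !andbF /= !addr0.
  have [a1 [b1 ->]] := curve_triple symT symH (H0 i) (H0 j) (H0 k) nij nik njk.
  rewrite coef_Poly /= !mxE /=.
  by rewrite !addr0 !add0r !mulr1 pnatr_eq0.
pose M : 'M[{set 'I_r} -> K]_r := \matrix_(i, j) vec i j.
have symM : M^T = M.
  apply/matrixP=> i j; rewrite !mxE /vec (sym_entry i j symT) symEC //.
have [val [val0 valM]] := pair_function (pm T) symM.
have valE i j : val [set i; j] = vec i j by rewrite valM mxE.
exists (fun k => val (small_set k)), x.
split; [move=> k | exact: tx | move=> a b E].
  case: (small_cases (small_setP k)) => [->|[i [j ->]]].
    by rewrite val0; apply: tangentV_pm.
  rewrite valE; exact: tvec.
(* Elimination step, used for the empty set, then singletons, then pairs. *)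
have single k S : (forall k', k' != k -> a k' * val (small_set k') S = 0) ->
    x S = 0 -> a k * val (small_set k) S = 0.
  move=> h xS; have := E S; rewrite xS mulr0 addr0 (bigD1 k) //=.
  by rewrite [X in _ + X]big1 ?addr0.
have pairP (k : 'I_d.+1) : small_set k != set0 -> exists i j, small_set k = [set i; j].
  by case: (small_cases (small_setP k)) => [->|//]; rewrite eqxx.
have a0 : a (small_index set0) = 0.
  have := @single (small_index set0) set0.
  rewrite small_indexK ?cards0 // val0 pm0 mulr1; apply; last first.
    by rewrite xsmall ?cards0.
  move=> k nk; have k0 : small_set k != set0.
    by apply: contraNneq nk => E'; rewrite -E' small_setK.
  by have [i [j ->]] := pairP k k0; rewrite valE vec0 mulr0.
have a1 i : a (small_index [set i]) = 0.
  have := @single (small_index [set i]) [set i].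
  have vi : val [set i] [set i] = 1 by rewrite -{1}[[set i]]setUid valE vec1 eqxx.
  rewrite small_indexK ?cards1 // vi mulr1.
  apply; last by rewrite xsmall ?cards1.
  move=> k nk; have [k0|k0] := eqVneq (small_set k) set0.
    by rewrite -(small_setK k) k0 a0 mul0r.
  have [p [q kpq]] := pairP k k0.
  rewrite kpq valE vec1; case: andP => [[/eqP pi /eqP qi]|_]; last by rewrite mulr0.
  by case/eqP: nk; rewrite -(small_setK k) kpq pi qi setUid.
have a2 k : a k = 0.
  rewrite -(small_setK k); case: (small_cases (small_setP k)) => [->//|[i [j ->]]].
  have [<-|nij] := eqVneq i j; first by rewrite setUid.
  have := @single (small_index [set i; j]) [set i; j].
  rewrite small_indexK ?card_pair // valE => h.
  apply/eqP; have /eqP : a (small_index [set i; j]) * vec i j [set i; j] = 0.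
    apply: h; last by rewrite xsmall ?card_pair.
    move=> k' nk; have [k0|k0] := eqVneq (small_set k') set0.
      by rewrite -(small_setK k') k0 a0 mul0r.
    have [p [q kpq]] := pairP k' k0.
    rewrite kpq valE; have [pq|npq] := eqVneq p q.
      by rewrite -(small_setK k') kpq pq setUid a1 mul0r.
    have [->|v0] := eqVneq (vec p q [set i; j]) 0; first by rewrite mulr0.
    by case/eqP: nk; rewrite (vec2 _ _ _ _ nij npq v0) -kpq small_setK.
  by rewrite mulf_eq0 (negbTE (vec2_diag _ _ nij)) orbF.
split=> //; have /eqP := E J; rewrite big1 ?add0r => [|k _]; last by rewrite a2 mul0r.
by rewrite mulf_eq0 (negbTE xJ) orbF => /eqP.
Qed.

Lemma disconnected_many_tangents T : T^T = T -> \det T != 0 ->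
  ~ connected_mx T -> (2 < r)%N -> many_tangents T.
Proof.
move=> symT detT ncT r3; move: ncT; apply: (step_ind (P := fun T =>
  ~ connected_mx T -> many_tangents T)) symT detT => {T}.
- by move=> T symT detT trT ncT; apply: many_tangents_transitive.
- move=> T k s symT detT u IH ncT; apply: (many_tangents_step u).
  by apply: IH; apply: disconnected_step.
Qed.

End Singular.

(** At a nonsingular point the tangent space has dimension [(cone_dim r).+1], too small for the
    independent vectors found above. *)
Lemma disconnected_singular (R : realType) r c (T : 'M[R[i]]_r) : T^T = T ->
  \det T != 0 -> c != 0 -> (2 < r)%N ->
  nonsingular_point (@dpp_variety R r) (cone_pt c T) -> connected_mx T.
Proof.
move=> symT detT c0 r3 [e [W [/dpp_proj_dim_uniq -> dimW WE]]].
apply: contrapT => ncT.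
have [w [x [tw tx ind]]] := disconnected_many_tangents symT detT ncT r3.
pose row (v : {set 'I_r} -> R[i]) : subset_vec R[i] r := \row_k (c * v (enum_val k)).
have coord_row v I : coord (row v) I = c * v I by rewrite /coord mxE enum_rankK.
have rowW v : tangentV T v -> row v \in W.
  move=> tv; apply/WE/cone_tangentP; first exact: cone_pt_variety.
  apply: onV_ext (onV_scale c tv) => I.
  by rewrite dual_mulE /= mul0r addr0 coord_cone_pt coord_row.
pose X : (cone_dim r).+2.-tuple (subset_vec R[i] r) :=
  [tuple if unlift ord0 k is Some l then row (w l) else row x | k < (cone_dim r).+2].
have freeX : free X.
  apply/freeP=> a; rewrite big_ord_recl -[X`_ _]tnth_nth tnth_mktuple unlift_none => E.
  have [|aw ax] := ind (fun k => a (lift ord0 k)) (a ord0).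
    move=> I; apply: (mulfI c0); rewrite mulr0.
    have E0 : coord (0 : subset_vec R[i] r) I = 0 by rewrite /coord mxE.
    rewrite -[RHS]E0 -E coord_linear coord_row addrC mulrDr mulrCA; congr (_ + _).
    rewrite /coord summxE mulr_sumr; apply: eq_bigr => k _.
    rewrite -[X`_ _]tnth_nth tnth_mktuple liftK !mxE enum_rankK.
    by rewrite mulrCA.
  move=> k; case: (unliftP ord0 k) => [l ->|->//]; exact: aw.
have : (\dim <<X>> <= \dim W)%N.
  apply: dimvS; apply/span_subvP => v /mapP[k _ ->].
  by case: (unlift ord0 k) => [l|]; [exact: (rowW _ (tw l)) | exact: (rowW _ tx)].
by rewrite (eqnP freeX) size_tuple dimW ltnn.
Qed.

(** * Likelihood equations *)

Section Loglik.
Variable K : numFieldType.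

Definition dloglik r (w : {set 'I_r} -> K) (T H : 'M[K]_r) : K :=
  \sum_I w I * (dpm T H I / pm T I)
  - (\sum_I w I) * (ddet (T + 1%:M) H / \det (T + 1%:M)).

Definition regular_mx r (T : 'M[K]_r) : Prop :=
  (forall I, pm T I != 0) /\ \det (T + 1%:M) != 0.

Lemma dualmx_add1 r (T H : 'M[K]_r) : dualmx (T + 1%:M) H = dualmx T H + 1%:M.
Proof.
apply/matrixP=> i j; rewrite !mxE dual_addE /=; case: (i == j) => /=.
  by rewrite addr0.
by rewrite !addr0.
Qed.

Lemma sum_dpm r (T H : 'M[K]_r) : \sum_I dpm T H I = ddet (T + 1%:M) H.
Proof.
by rewrite /ddet dualmx_add1 -sum_pm -[RHS]/(dsnd _) raddf_sum.
Qed.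

Lemma ddet_dpm r (T H : 'M[K]_r) : ddet T H = dpm T H setT.
Proof. by rewrite /ddet /dpm pmT. Qed.

(** The chain rule. The function is homogeneous of degree 0, so the radial component c' pm T
    contributes nothing. *)
Lemma implicit_derivative r (w : {set 'I_r} -> K) (T H : 'M[K]_r) c c' :
  regular_mx T -> c != 0 ->
  \sum_I (w I / (c * pm T I) - (\sum_J w J) / (\sum_J c * pm T J))
     * (c * dpm T H I + c' * pm T I) = dloglik w T H.
Proof.
move=> [pT dT] c0; rewrite -mulr_sumr sum_pm /dloglik.
set W := \sum_J w J; set D := \det _.
rewrite (eq_bigr (fun I => w I * (dpm T H I / pm T I) + c' / c * w I
   - (W / D * dpm T H I + W / D * (c' / c) * pm T I))); last first.
  by move=> I _; field; rewrite c0 pT dT.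
rewrite big_split sumrN !big_split /= -!mulr_sumr sum_pm sum_dpm -/W -/D.
by field; rewrite c0 dT.
Qed.

Lemma dloglik_linear r (w : {set 'I_r} -> K) (T : 'M[K]_r) a H H' :
  dloglik w T (a *: H + H') = a * dloglik w T H + dloglik w T H'.
Proof.
have lin (f f1 f2 p : {set 'I_r} -> K) e e1 e2 D : (forall I, f I = a * f1 I + f2 I) ->
    e = a * e1 + e2 ->
    \sum_I w I * (f I / p I) - (\sum_I w I) * (e / D)
    = a * (\sum_I w I * (f1 I / p I) - (\sum_I w I) * (e1 / D))
      + (\sum_I w I * (f2 I / p I) - (\sum_I w I) * (e2 / D)).
  move=> fE ->; rewrite (eq_bigr (fun I => a * (w I * (f1 I / p I)) + w I * (f2 I / p I))).
    by rewrite big_split /= -mulr_sumr; ring.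
  by move=> I _; rewrite fE; ring.
by apply: lin => [I|]; [exact: dpm_linear | exact: ddet_linear].
Qed.

Lemma dloglik_ext r (w w' : {set 'I_r} -> K) (T H : 'M[K]_r) :
  w =1 w' -> dloglik w T H = dloglik w' T H.
Proof.
move=> ww; rewrite /dloglik (eq_bigr _ (fun I _ => ww I)); congr (_ - _).
by apply: eq_bigr => I _; rewrite ww.
Qed.

Lemma dloglik0 r (w : {set 'I_r} -> K) (T : 'M[K]_r) : dloglik w T 0 = 0.
Proof.
have := dloglik_linear w T 1 0 0; rewrite scale1r addr0 mul1r => /eqP.
by rewrite -subr_eq0 opprD addNKr oppr_eq0 => /eqP.
Qed.

Lemma dloglik_sym0 r (w : {set 'I_r} -> K) (T : 'M[K]_r) :
  (forall i j : 'I_r, (i <= j)%N -> dloglik w T (symE K i j) = 0) ->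
  forall H, H^T = H -> dloglik w T H = 0.
Proof.
move=> E H symH.
have -> : H = \sum_(i : 'I_r) \sum_(j : 'I_r | (i <= j)%N) H i j *: symE K i j.
  apply/matrixP=> a b; rewrite summxE.
  have E1 (i : 'I_r) : (\sum_(j : 'I_r | (i <= j)%N) H i j *: symE K i j) a b
      = \sum_(j : 'I_r | (i <= j)%N) H i j * symE K i j a b.
    by rewrite summxE; apply: eq_bigr => j _; rewrite mxE.
  rewrite (eq_bigr _ (fun i _ => E1 i)) {E1}.
  wlog ab : a b / (a <= b)%N.
    move=> h; have [/h //|/ltnW/h E2] := leqP a b.
    rewrite (sym_entry a b symH) E2; apply: eq_bigr => i _; apply: eq_bigr => j _.
    by rewrite (sym_entry b a (symE_sym K i j)).
  rewrite (bigD1 a) //= (bigD1 b) //= symE_in mulr1 !big1 ?addr0 //.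
    move=> i nia; rewrite big1 // => j ij; rewrite symE_pair ?mulr0 //.
    apply: contraNneq nia => /set_pair_eq[[<- _]//|[aj bi]].
    by move: ij; rewrite -aj -bi -val_eqE eqn_leq ab andbT.
  move=> j /andP[aj njb]; rewrite symE_pair ?mulr0 //.
  by apply: contraNneq njb => /set_pair_eq[[_ <-]//|[<- <-]//].
have addP A B : dloglik w T A = 0 -> dloglik w T B = 0 -> dloglik w T (A + B) = 0.
  by move=> A0 B0; rewrite -[A]scale1r dloglik_linear A0 B0 mulr0 addr0.
apply: (big_ind (fun H => dloglik w T H = 0)) => [|//|i _]; first exact: dloglik0.
apply: (big_ind (fun H => dloglik w T H = 0)) => [|//|j ij]; first exact: dloglik0.
by rewrite -[_ *: _]addr0 dloglik_linear E // dloglik0 mulr0 addr0.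
Qed.

Section Blocks.
Variables (n : nat) (B : {set 'I_n}).
Implicit Types (T H : 'M[K]_n) (I : {set 'I_n}).

(** The set I :&: B seen inside ['I_#|B|], matching the indexing of [marginal]. *)
Definition trace_set I : {set 'I_#|B|} := [set j : 'I_#|B| | enum_val j \in I].

Lemma trace_setE I : [set enum_val j | j in trace_set I] = I :&: B.
Proof.
apply/setP=> i; rewrite inE; apply/imsetP/andP => [[j]|[iI iB]].
  by rewrite inE => jI ->; split=> //; exact: enum_valP.
by exists (enum_rank_in iB i); rewrite ?inE enum_rankK_in.
Qed.

Lemma pm_trace T I : pm (psubmx T B) (trace_set I) = pm T (I :&: B).
Proof. by rewrite pm_psubmx trace_setE. Qed.

Lemma psubmx_dualmx T H :
  psubmx (dualmx T H) B = dualmx (psubmx T B) (psubmx H B).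
Proof. by apply/matrixP=> i j; rewrite !mxE. Qed.

Lemma psubmx_add1 T : psubmx (T + 1%:M) B = psubmx T B + 1%:M.
Proof.
by apply/matrixP=> i j; rewrite !mxE (inj_eq enum_val_inj).
Qed.

Lemma psubmx_sym (A : Type) (T : 'M[A]_n) : T^T = T -> (psubmx T B)^T = psubmx T B.
Proof. by move=> sT; apply/matrixP=> i j; rewrite !mxE sym_entry. Qed.

Lemma dpm_trace T H I : dpm (psubmx T B) (psubmx H B) (trace_set I) = dpm T H (I :&: B).
Proof. by rewrite /dpm -psubmx_dualmx pm_psubmx trace_setE. Qed.

Lemma separated_sym T i j : T^T = T -> separated B T ->
  i \in B -> j \notin B -> T j i = 0.
Proof. by move=> symT sB iB jB; rewrite (sym_entry j i symT) sB. Qed.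

Lemma separated_add1 T : separated B T -> separated B (T + 1%:M).
Proof.
by move=> sB i j iB jB; rewrite !mxE sB // add0r; case: eqP jB => // <-; rewrite iB.
Qed.

Lemma pm_separated T I : T^T = T -> separated B T ->
  pm T I = pm T (I :&: B) * pm T (I :\: B).
Proof. by move=> symT sB; apply: pm_block => // i j; apply: separated_sym. Qed.

Lemma dpm_separated T H I : T^T = T -> separated B T ->
  (forall i j, ~~ ((i \in B) && (j \in B)) -> H i j = 0) ->
  dpm T H I = dpm T H (I :&: B) * pm T (I :\: B).
Proof.
move=> symT sB HB; rewrite {1}/dpm (pm_block (B := B)).
- rewrite [pm _ (I :\: B)](_ : _ = dconst (pm T (I :\: B))).
    by rewrite dual_mulE /= mulr0 add0r.
  rewrite map_pm; apply: pm_ext => i j; rewrite !inE => /andP[iB _] /andP[jB _].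
  by rewrite !mxE HB // (negbTE iB).
- by move=> i j iB jB; rewrite mxE sB // HB // negb_and jB orbT.
- by move=> i j iB jB; rewrite mxE (separated_sym symT sB) // HB // negb_and jB.
Qed.

(** The factor outside B is constant along H and cancels in each logarithmic derivative; grouping
    the sets I by their trace on B then produces the marginal data. *)
Lemma dloglik_block (u : {set 'I_n} -> K) T H : T^T = T -> separated B T ->
  regular_mx T -> (forall i j, ~~ ((i \in B) && (j \in B)) -> H i j = 0) ->
  dloglik u T H
  = dloglik (fun J => \sum_(I | trace_set I == J) u I) (psubmx T B) (psubmx H B).
Proof.
move=> symT sB [pT dT] HB; rewrite /dloglik.
have sB1 : separated B (T + 1%:M) by apply: separated_add1.
have symT1 : (T + 1%:M)^T = T + 1%:M by rewrite linearD /= symT trmx1.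
congr (_ - _ * _).
- rewrite (partition_big trace_set xpredT) //=; apply: eq_bigr => J _.
  rewrite mulr_suml; apply: eq_bigr => I /eqP <-; congr (_ * _).
  rewrite dpm_trace pm_trace dpm_separated // (pm_separated I) // -mulf_div.
  rewrite divff ?mulr1 //; exact: pT.
- by rewrite (partition_big trace_set xpredT).
rewrite -!pmT !ddet_dpm dpm_separated // (pm_separated setT) // -mulf_div.
rewrite divff ?mulr1; last first.
  by apply: contraNneq dT => E; rewrite -pmT (pm_separated setT) // E mulr0.
rewrite -dpm_trace -pm_trace psubmx_add1.
have -> : trace_set setT = setT by apply/setP=> j; rewrite !inE.
by [].
Qed.

(** Along a direction crossing the cut every minor, of T and of T + Id, is even by [curve_odd]. *)
Lemma dloglik_cross (u : {set 'I_n} -> K) T i j : T^T = T -> separated B T ->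
  i \in B -> j \notin B -> dloglik u T (symE K i j) = 0.
Proof.
move=> symT sB iB jB.
have h (T' : 'M[K]_n) I : T'^T = T' -> separated B T' -> dpm T' (symE K i j) I = 0.
  move=> symT' sB'; rewrite -curve_coef1; apply: (@curve_odd _ _ _ _ B).
    move=> a b; have [aB|aB] := boolP (a \in B); have [bB|bB] := boolP (b \in B) => // _.
      exact: sB'.
    exact: (separated_sym symT' sB').
  move=> a b ab; apply: symE_pair; apply: contraTneq ab.
  by case/set_pair_eq=> [[-> ->]|[-> ->]]; rewrite iB (negbTE jB).
rewrite /dloglik big1 => [|I _]; last by rewrite h // mul0r mulr0.
rewrite ddet_dpm h ?mul0r ?mulr0 ?subrr //.
  by rewrite linearD /= symT trmx1.
exact: separated_add1.
Qed.

End Blocks.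

End Loglik.

(** * Critical points and the components of the support *)

Section Equations.
Variable R : realType.
Local Notation C := R[i].

Lemma coord_marginal n (u : subset_vec C n) (B : {set 'I_n}) J :
  coord (marginal u B) J = \sum_(I | trace_set B I == J) coord u I.
Proof. by rewrite /coord mxE enum_rankK. Qed.

Lemma dlog_jet (f : {poly C}) x : dlog f x = (jet x f).2 / (jet x f).1.
Proof. by []. Qed.

Lemma loglik_partialE n (u : subset_vec C n) (T : 'M[C]_n) i j : T^T = T ->
  loglik_partial u T i j = dloglik (coord u) T (symE C i j).
Proof.
move=> symT; have free_jet : map_mx (jet (T i j)) (free_entry T i j)
    = dualmx T (symE C i j).
  apply/matrixP=> k l; rewrite !mxE; case: ifP => [h|_] /=.
    rewrite /jet derivX hornerX -polyC1 hornerC; congr pair.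
    case/orP: h => /andP[/eqP-> /eqP->] //; exact: sym_entry.
  by rewrite /jet derivC !hornerC.
have free_jet1 : map_mx (jet (T i j)) (free_entry T i j + 1%:M)
    = dualmx (T + 1%:M) (symE C i j).
  by rewrite map_mxD map_mx1 free_jet dualmx_add1.
rewrite /loglik_partial /dloglik; congr (_ - _ * _).
  apply: eq_bigr => I _; congr (_ * _).
  by rewrite dlog_jet det_psubmx map_pm free_jet pm_dualmx.
by rewrite dlog_jet -det_map_mx free_jet1 -pmT pm_dualmx pmT ddet_dpm.
Qed.

Lemma critical_pointP n (u : subset_vec C n) (T : 'M[C]_n) :
  critical_point u T <->
  [/\ T^T = T, regular_mx T & forall H, H^T = H -> dloglik (coord u) T H = 0].
Proof.
split=> [[symT pT dT E]|[symT [pT dT] E]].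
  split; first exact: symT.
    split; last exact: dT.
    by move=> I; rewrite -det_psubmx; exact: pT.
  apply: dloglik_sym0 => i j ij; rewrite -loglik_partialE; last exact: symT.
  exact: E.
split; [exact: symT | | exact: dT |].
  by move=> I; rewrite det_psubmx; exact: pT.
move=> i j ij; rewrite loglik_partialE; last exact: symT.
apply: E; exact: symE_sym.
Qed.

Lemma implicit_pairing r (w : subset_vec C r) (T H : 'M[C]_r) c c' :
  regular_mx T -> c != 0 ->
  \sum_I implicit_partial w (cone_pt c T) I * coord (tangent_vec c T c' H) I
  = dloglik (coord w) T H.
Proof.
move=> regT c0; rewrite -(implicit_derivative (coord w) H c' regT c0).
apply: eq_bigr => I _; rewrite /implicit_partial !coord_cone_pt coord_tangent_vec.
congr ((_ - _ / _) * _); apply: eq_bigr => J _; exact: coord_cone_pt.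
Qed.

(** Only tangent vectors coming from the parametrization are tested, so T may be disconnected; the
    converse below must know the full tangent space. *)
Lemma implicit_criticalP r (w : subset_vec C r) (T : 'M[C]_r) c : T^T = T ->
  c != 0 -> implicit_critical w (cone_pt c T) ->
  regular_mx T /\ forall H, H^T = H -> dloglik (coord w) T H = 0.
Proof.
move=> symT c0 [[Vp _] pI sp crit].
have regT : regular_mx T.
  split=> [I|].
    by have := pI I; rewrite coord_cone_pt mulf_eq0 negb_or => /andP[].
  move: sp; rewrite (eq_bigr _ (fun I _ => coord_cone_pt c T I)) -mulr_sumr sum_pm.
  by rewrite mulf_eq0 negb_or => /andP[].
split=> // H symH; rewrite -(implicit_pairing w H 0 regT c0).
exact/crit/tangent_vec_cone.
Qed.

Lemma connected_implicit_critical r (w : subset_vec C r) (T : 'M[C]_r) c :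
  T^T = T -> c != 0 -> (0 < r)%N -> connected_mx T -> regular_mx T ->
  (forall H, H^T = H -> dloglik (coord w) T H = 0) ->
  implicit_critical w (cone_pt c T).
Proof.
move=> symT c0 r0 cT regT crit; have [pT dT] := regT.
have detT : \det T != 0 by rewrite -pmT; exact: pT.
split.
- split; [exact: cone_pt_variety | exact: connected_nonsingular].
- by move=> I; rewrite coord_cone_pt; exact: (mulf_neq0 c0 (pT I)).
- rewrite (eq_bigr _ (fun I _ => coord_cone_pt c T I)) -mulr_sumr sum_pm.
  exact: (mulf_neq0 c0 dT).
move=> v /connected_tangent[] // c' [H [symH ->]].
by rewrite implicit_pairing // crit.
Qed.

Lemma block_separated n (P : {set {set 'I_n}}) (T : 'M[C]_n) B :
  block_diagonal P T -> B \in P -> separated B T.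
Proof. by move=> PT BP i j; apply: PT. Qed.

Lemma pm_cover_neq0 n (P Q : {set {set 'I_n}}) (T : 'M[C]_n) I :
  T^T = T -> trivIset P -> Q \subset P -> (forall B, B \in P -> separated B T) ->
  (forall B, B \in P -> pm T (I :&: B) != 0) -> pm T (I :&: cover Q) != 0.
Proof.
move=> symT trP QP sP pP; have [m] := ubnP #|Q|; elim: m Q QP => // m IH Q QP Qm.
have [->|/set0Pn[B BQ]] := eqVneq Q set0.
  by rewrite /cover big_set0 setI0 pm0 oner_eq0.
have BP : B \in P by apply: (fintype.subsetP QP).
rewrite (pm_separated _ symT (sP B BP)).
have -> : (I :&: cover Q) :&: B = I :&: B.
  rewrite -setIA; congr (_ :&: _); apply/setIidPr.
  exact: bigcup_sup.
have -> : (I :&: cover Q) :\: B = I :&: cover (Q :\ B).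
  apply/setP=> i; rewrite !inE; case: (i \in I); rewrite ?andbF //=.
  apply/andP/bigcupP => [[iB /bigcupP[B' B'Q iB']]|[B' /setD1P[nB B'Q] iB']].
    by exists B' => //; rewrite !inE B'Q andbT; apply: contraNneq iB => <-.
  split; last by apply/bigcupP; exists B'.
  have /trivIsetP/(_ B' B) := trP; rewrite (fintype.subsetP QP _ B'Q) BP.
  by move=> /(_ isT isT nB) /disjointFr ->.
apply: mulf_neq0; first exact: pP.
apply: IH; first exact: fintype.subset_trans (subD1set _ _) QP.
by rewrite -ltnS (leq_trans _ Qm) // (cardsD1 B Q) BQ.
Qed.

(** Directions inside one block are governed by the equations of that block, all others by
    [dloglik_cross]. The partition may be coarser than the one into components. *)
Lemma critical_of_blocks n (u : subset_vec C n) (T : 'M[C]_n) (P : {set {set 'I_n}}) :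
  T^T = T -> finset.partition P [set: 'I_n] -> block_diagonal P T ->
  (forall B, B \in P -> implicit_critical (marginal u B) (dpp_point (psubmx T B))) ->
  critical_point u T.
Proof.
move=> symT partP PT critP.
have symB B : (psubmx T B)^T = psubmx T B by apply: psubmx_sym.
have regB B : B \in P -> regular_mx (psubmx T B) /\
    forall H, H^T = H -> dloglik (coord (marginal u B)) (psubmx T B) H = 0.
  move=> /critP; rewrite dpp_point_cone => crit.
  apply: (implicit_criticalP (symB B) _ crit).
  case: crit => _ /(_ set0); rewrite coord_cone_pt mulf_eq0 negb_or.
  by case/andP.
have covP : cover P = setT := cover_partition partP.
have trP : trivIset P by case/and3P: partP.
have sP B : B \in P -> separated B T by apply: block_separated.
have regT : regular_mx T.
  split=> [I|].
    rewrite -[I]setIT -covP.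
    apply: (pm_cover_neq0 symT trP (fintype.subxx _) sP) => B BP.
    by rewrite -pm_trace; have [[h _] _] := regB B BP.
  have symT1 : (T + 1%:M)^T = T + 1%:M by rewrite linearD /= symT trmx1.
  rewrite -pmT -[setT]setIT -[X in _ :&: X]covP.
  apply: (pm_cover_neq0 symT1 trP (fintype.subxx _)) => B BP.
    by apply: separated_add1; apply: sP.
  rewrite -pm_trace psubmx_add1.
  have -> : trace_set B setT = setT by apply/setP=> j; rewrite !inE.
  by rewrite pmT; have [[_ h] _] := regB B BP.
apply/critical_pointP; split; [exact: symT | exact: regT |].
apply: dloglik_sym0 => i j _.
pose B := pblock P i.
have iP : i \in cover P by rewrite covP inE.
have BP : B \in P by apply: pblock_mem.
have iB : i \in B by rewrite mem_pblock.
have [jB|jB] := boolP (j \in B); last first.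
  exact: (dloglik_cross _ symT (sP B BP)).
have outB a b : ~~ ((a \in B) && (b \in B)) -> symE C i j a b = 0.
  move=> h; apply: symE_pair; apply: contraTneq h.
  by case/set_pair_eq=> [[-> ->]|[-> ->]]; rewrite iB jB.
rewrite (dloglik_block _ symT (sP B BP) regT outB).
have [_ crit] := regB B BP.
rewrite -[RHS](crit _ (psubmx_sym B (symE_sym C i j))).
by apply: dloglik_ext => J; rewrite coord_marginal.
Qed.

Definition support_rel n (T : 'M[C]_n) : rel 'I_n := fun i j => T i j != 0.

Definition components n (T : 'M[C]_n) : {set {set 'I_n}} :=
  equivalence_partition (connect (support_rel T)) setT.

Lemma support_connect_sym n (T : 'M[C]_n) : T^T = T -> connect_sym (support_rel T).
Proof.
by move=> symT; apply: sym_connect_sym => a b; rewrite /support_rel (sym_entry a b symT).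
Qed.

Lemma support_connect_equiv n (T : 'M[C]_n) : T^T = T ->
  {in setT & &, equivalence_rel (connect (support_rel T))}.
Proof.
move=> symT i j k _ _ _; split; first exact: connect0.
by move=> ij; apply: same_connect => //; apply: support_connect_sym.
Qed.

Lemma components_partition n (T : 'M[C]_n) : T^T = T ->
  finset.partition (components T) setT.
Proof. by move=> symT; apply: equivalence_partitionP; apply: support_connect_equiv. Qed.

Lemma mem_component n (T : 'M[C]_n) B i j : T^T = T -> B \in components T ->
  i \in B -> (j \in B) = connect (support_rel T) i j.
Proof.
move=> symT BP iB; have eqT := support_connect_equiv symT.
have partP := components_partition symT.
have trP : trivIset (components T) by case/and3P: partP.
by rewrite -(def_pblock trP BP iB) pblock_equivalence_partition ?inE.
Qed.

Lemma components_block_diagonal n (T : 'M[C]_n) : T^T = T ->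
  block_diagonal (components T) T.
Proof.
move=> symT B i j BP iB jB; apply/eqP; apply: contraNT jB => Tij.
by rewrite (mem_component _ symT BP iB) connect1.
Qed.

Lemma component_connected n (T : 'M[C]_n) B : T^T = T -> B \in components T ->
  connected_mx (psubmx T B).
Proof.
move=> symT BP S sS; have [->|/set0Pn[i iS]] := eqVneq S set0; [by left | right].
apply/setP=> j; rewrite inE.
pose S' := [set enum_val a | a in S].
have S'B a : a \in S' -> a \in B by case/imsetP=> b _ ->; apply: enum_valP.
have clS : closed (support_rel T) (mem S').
  have cl a b : support_rel T a b -> a \in S' -> b \in S'.
    move=> ab aS'; have aB := S'B a aS'.
    have bB : b \in B by rewrite (mem_component _ symT BP aB) connect1.
    case/imsetP: aS' => a' a'S aE; apply/imsetP; exists (enum_rank_in aB b).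
      apply: contraT => bS; have := sS _ _ a'S bS.
      by rewrite mxE enum_rankK_in // -aE => /eqP; rewrite (negbTE ab).
    by rewrite enum_rankK_in.
  move=> a b ab; apply/idP/idP; first exact: cl.
  by apply: cl; rewrite /support_rel (sym_entry b a symT).
have : enum_val j \in S'.
  rewrite -(closed_connect clS (x := enum_val i)); first by apply: imset_f.
  by rewrite -(mem_component _ symT BP) ?enum_valP.
by case/imsetP=> a aS /enum_val_inj ->.
Qed.

(** Extension by zero: each sum has at most one term because [enum_val] is injective, and none for
    an index outside B. *)
Definition extend_block n (B : {set 'I_n}) (H : 'M[C]_#|B|) : 'M[C]_n :=
  \matrix_(i, j) \sum_(a | enum_val a == i) \sum_(b | enum_val b == j) H a b.

Lemma psubmx_extend n (B : {set 'I_n}) (H : 'M[C]_#|B|) :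
  psubmx (extend_block H) B = H.
Proof.
apply/matrixP=> i j; rewrite !mxE (big_pred1 i) ?(big_pred1 j) // => a;
  by rewrite (inj_eq enum_val_inj).
Qed.

Lemma extend_sym n (B : {set 'I_n}) (H : 'M[C]_#|B|) : H^T = H ->
  (extend_block H)^T = extend_block H.
Proof.
move=> symH; apply/matrixP=> i j; rewrite !mxE exchange_big /=.
by apply: eq_bigr => a _; apply: eq_bigr => b _; rewrite sym_entry.
Qed.

Lemma extend_outside n (B : {set 'I_n}) (H : 'M[C]_#|B|) i j :
  ~~ ((i \in B) && (j \in B)) -> extend_block H i j = 0.
Proof.
rewrite negb_and mxE => /orP[iB|jB].
  by rewrite big_pred0 // => a; apply: contraNF iB => /eqP <-; apply: enum_valP.
rewrite big1 // => a _.
by rewrite big_pred0 // => b; apply: contraNF jB => /eqP <-; apply: enum_valP.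
Qed.

Lemma blocks_of_critical n (u : subset_vec C n) (T : 'M[C]_n) B :
  critical_point u T -> B \in components T ->
  implicit_critical (marginal u B) (dpp_point (psubmx T B)).
Proof.
move=> /critical_pointP[symT regT crit] BP; have [pT dT] := regT.
have sB : separated B T by apply: block_separated BP; apply: components_block_diagonal.
have detB : \det (psubmx T B + 1%:M) != 0.
  apply: contraNneq dT => E; rewrite -pmT (pm_separated (B := B)).
  - rewrite -pm_trace psubmx_add1.
    have -> : trace_set B setT = setT by apply/setP=> j; rewrite !inE.
    by rewrite pmT E mul0r.
  - by rewrite linearD /= symT trmx1.
  exact: separated_add1.
have B0 : (0 < #|B|)%N.
  rewrite card_gt0; apply: contraTneq BP => ->.
  by have /and3P[] := components_partition symT.
rewrite dpp_point_cone; apply: connected_implicit_critical.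
- exact: psubmx_sym.
- by rewrite invr_neq0.
- exact: B0.
- exact: component_connected.
- by split; [move=> J; rewrite pm_psubmx; exact: pT | exact: detB].
move=> H symH; rewrite -[RHS](crit _ (extend_sym symH)).
rewrite (dloglik_block (B := B) (coord u) symT sB regT (extend_outside H)).
by rewrite psubmx_extend; apply: dloglik_ext => J; rewrite coord_marginal.
Qed.

End Equations.

(** * Finite cardinalities and genericity *)

Section Listing.
Local Open Scope classical_set_scope.

Lemma card_seq (T : eqType) (s : seq T) : uniq s -> ([set` s] #= `I_(size s))%card.
Proof.
case: s => [|x0 s0] us.
  by rewrite II0 card_eq0; apply/eqP/seteqP; split.
set s := x0 :: s0; rewrite card_eq_sym.
have /Pbij[f _] : set_bij `I_(size s) [set` s] (nth x0 s).
  split=> [i /= si|i j|x /= xs].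
  - exact: mem_nth.
  - by move=> /set_mem /= si /set_mem /= sj /eqP; rewrite nth_uniq // => /eqP.
  by exists (index x s); [rewrite -[X in (_ < X)%N]/(size s) index_mem | exact: nth_index].
exact: pcard_eq f.
Qed.

Definition listing (T : eqType) (A : T -> Prop) (n : nat) (s : seq T) : Prop :=
  [/\ uniq s, size s = n & forall x, A x <-> x \in s].

Lemma card_listingP (T : eqType) (A : T -> Prop) n :
  ([set x | A x] #= `I_n)%card <-> exists s, listing A n s.
Proof.
split=> [An|[s [us <- As]]]; last first.
  rewrite (_ : [set x | A x] = [set` s]); first exact: card_seq.
  by apply/seteqP; split=> x /As.
have /finite_seqP[s As] : finite_set [set x | A x] by apply/finite_setP; exists n.
exists (undup s); split; [exact: undup_uniq | | move=> x].
  have Au : [set x | A x] = [set` undup s].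
    by rewrite As; apply/seteqP; split=> x /=; rewrite mem_undup.
  apply/card_eq_II; rewrite -(card_eqr An) Au card_eq_sym.
  by apply: card_seq; rewrite undup_uniq.
rewrite mem_undup; have /(congr1 (fun B : set T => B x)) /= -> := As.
by [].
Qed.

Lemma listing_image (F : finType) (P : pred F) (T : eqType) (g : F -> T) (A : T -> Prop) :
  {in P &, injective g} -> (forall x, A x <-> exists2 y, P y & g y = x) ->
  exists s, listing A #|P| s.
Proof.
move=> g_inj Ag; exists [seq g y | y <- enum P]; split.
- by rewrite map_inj_in_uniq ?enum_uniq // => x y; rewrite !mem_enum; apply: g_inj.
- by rewrite size_map -cardE.
move=> x; split=> [/Ag[y Py <-]|/mapP[y]].
  by apply: map_f; rewrite mem_enum.
by rewrite mem_enum => Py ->; apply/Ag; exists y.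
Qed.

End Listing.

Section Genericity.
Variable R : realType.

Lemma generically_imp N (P Q : 'rV[R]_N -> Prop) :
  (forall u, P u -> Q u) -> generically P -> generically Q.
Proof. by move=> PQ [Z [aZ ZT ZP]]; exists Z; split=> // u /ZP/PQ. Qed.

Lemma generically_poly N (F : {mpoly R[N]}) (u0 : 'rV[R]_N) (P : 'rV[R]_N -> Prop) :
  F.@[u0 0] != 0 -> (forall u : 'rV[R]_N, F.@[u 0] != 0 -> P u) -> generically P.
Proof.
move=> F0 FP; exists [set u | F.@[u 0] = 0]%classic; split.
- exists [set F]%classic; apply/seteqP; split=> u /=; first by move=> E G ->.
  by apply.
- move=> /(congr1 (fun Z : set 'rV[R]_N => Z u0)) /= E; move/eqP: F0; apply.
  by rewrite E.
by move=> u /= /eqP; apply: FP.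
Qed.

(** Some equation of the proper subvariety fails somewhere; its nonvanishing alone already
    guarantees P. *)
Lemma genericallyP N (P : 'rV[R]_N -> Prop) : generically P ->
  exists (F : {mpoly R[N]}) (u0 : 'rV[R]_N), F.@[u0 0] != 0 /\
    forall u : 'rV[R]_N, F.@[u 0] != 0 -> P u.
Proof.
move=> [_ [[S ->] ZT ZP]].
have [u0 nu0] : exists u0 : 'rV[R]_N, ~ forall F, S F -> F.@[u0 0] = 0.
  apply/not_existsP => h; apply: ZT; apply/seteqP; split=> // u _ /=.
  by have /contrapT := h u.
have [F /not_implyP[SF /eqP Fu0]] : exists F, ~ (S F -> F.@[u0 0] = 0).
  by apply/existsNP.
by exists F, u0; split=> // u Fu; apply: ZP => /(_ F SF) /eqP; rewrite (negbTE Fu).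
Qed.

(** On the line through a nonzero of F and a nonzero of G both restrict to nonzero polynomials in
    one variable, so F G is nonzero at some point. *)
Lemma generically_and N (P Q : 'rV[R]_N -> Prop) :
  generically P -> generically Q -> generically (fun u => P u /\ Q u).
Proof.
move=> /genericallyP[F [u [Fu FP]]] /genericallyP[G [v [Gv GQ]]].
pose l (k : 'I_N) : {poly R} := (u 0 k)%:P + 'X * (v 0 k - u 0 k)%:P.
have lE H y : (mmap polyC l H).[y] = H.@[(u + y *: (v - u)) 0].
  rewrite -horner_evalE mmap_rmorph; apply: mmap_ext => [a|k] /=.
    by rewrite horner_evalE hornerC.
  by rewrite horner_evalE !hornerE !mxE.
have l0 H w y : w = u + y *: (v - u) -> H.@[w 0] != 0 -> mmap polyC l H != 0.
  by move=> -> Hw; apply: contraNneq Hw => E; rewrite -lE E horner0.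
have /exists_nonroot[y] : mmap polyC l F * mmap polyC l G != 0.
  rewrite mulf_neq0 //; first by apply: (l0 _ u 0) => //; rewrite scale0r addr0.
  by apply: (l0 _ v 1) => //; rewrite scale1r addrC subrK.
rewrite hornerM !lE -rmorphM => FG; apply: (generically_poly FG) => w.
by rewrite rmorphM mulf_eq0 negb_or => /andP[/FP ? /GQ ?].
Qed.

Lemma generically_all N (J : finType) (P : J -> 'rV[R]_N -> Prop) :
  (forall j, generically (P j)) -> generically (fun u => forall j, P j u).
Proof.
move=> gP.
have : generically (fun u => forall j, j \in enum J -> P j u).
  elim: (enum J) => [|j s IH].
    by apply: (@generically_poly _ 1 0) => //; rewrite meval1 oner_eq0.
  apply: generically_imp (generically_and (gP j) IH) => u [Pj Ps] k.
  by rewrite in_cons => /orP[/eqP->|/Ps].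
by apply: generically_imp => u Pu j; apply: Pu; rewrite mem_enum.
Qed.

Lemma generically_linear N M (A : 'M[R]_(N, M)) (P : 'rV[R]_M -> Prop) :
  (forall w : 'rV[R]_M, exists u : 'rV[R]_N, u *m A = w) -> generically P ->
  generically (fun u : 'rV[R]_N => P (u *m A)).
Proof.
move=> surj /genericallyP[F [w0 [Fw0 FP]]]; have [u0 u0w0] := surj w0.
pose G : {mpoly R[N]} := F \mPo [tuple \sum_i A i k *: 'X_i | k < M].
have GE (u : 'rV[R]_N) : G.@[u 0] = F.@[(u *m A) 0].
  rewrite comp_mpoly_meval; apply: meval_eq => k; rewrite tnth_mktuple mxE.
  by rewrite rmorph_sum; apply: eq_bigr => i _; rewrite /= mevalZ mevalXU mulrC.
apply: (@generically_poly _ G u0); first by rewrite GE u0w0.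
by move=> u; rewrite GE; apply: FP.
Qed.

(** For r = 2 a disconnected critical point has p_empty p_ij = p_i p_j and p proportional to the
    data; this condition rules it out. *)
Definition nondegenerate (K : comNzRingType) r (w : subset_vec K r) : Prop :=
  forall i j : 'I_r, i != j ->
    coord w set0 * coord w [set i; j] <> coord w [set i] * coord w [set j].

Lemma generically_nondegenerate r : generically (@nondegenerate R r).
Proof.
apply: generically_all => i; apply: generically_all => j.
have [->|nij] := eqVneq i j.
  by apply: (@generically_poly _ 1 0) => [|u _]; rewrite ?meval1 ?oner_eq0 ?eqxx.
pose X I : {mpoly R[#|{set 'I_r}|]} := 'X_(enum_rank I).
pose u0 : subset_vec R r :=
  \row_k ((enum_val k == set0) || (enum_val k == [set i; j]))%:R.
have XE (u : subset_vec R r) I : (X I).@[u 0] = coord u I by rewrite mevalXU.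
apply: (@generically_poly _ (X set0 * X [set i; j] - X [set i] * X [set j]) u0).
  have single k : coord u0 [set k] = 0.
    rewrite /coord mxE enum_rankK; case: eqP => [/setP/(_ k)|_]; first by rewrite !inE eqxx.
    case: eqP => // E; move: (cards1 k); rewrite E cards2 nij //.
  rewrite rmorphB !rmorphM /= !XE !single mulr0 subr0 /coord !mxE !enum_rankK.
  by rewrite !eqxx orbT mulr1 oner_eq0.
move=> u; rewrite rmorphB !rmorphM /= !XE => h _ E; move/eqP: h; apply.
by rewrite E subrr.
Qed.

Lemma marginal_linear n (B : {set 'I_n}) :
  exists A : 'M[R]_(#|{set 'I_n}|, #|{set 'I_#|B|}|),
    (forall u : subset_vec R n, marginal (complexify u) B = complexify (u *m A)) /\
    (forall w, exists u : subset_vec R n, u *m A = w).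
Proof.
pose A : 'M[R]_(#|{set 'I_n}|, #|{set 'I_#|B|}|) :=
  \matrix_(i, k) (trace_set B (enum_val i) == enum_val k)%:R.
have AE (u : subset_vec R n) k :
    (u *m A) 0 k = \sum_(I | trace_set B I == enum_val k) coord u I.
  rewrite mxE [RHS]big_mkcond [RHS](reindex_onto enum_val enum_rank) /=; last first.
    by move=> I _; rewrite enum_rankK.
  apply: eq_big => [i|i _]; first by rewrite enum_valK eqxx.
  by rewrite mxE /coord enum_valK; case: eqP => _; rewrite ?mulr1 ?mulr0.
exists A; split=> [u|w].
  apply/rowP=> k; rewrite !mxE; move: (AE u k); rewrite mxE => ->.
  by rewrite rmorph_sum; apply: eq_bigr => I _; rewrite coord_complexify.
(* A preimage of w: the data concentrated on the subsets of B, each of which is its own trace. *)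
exists (\row_(i < #|{set 'I_n}|)
  if (enum_val i : {set 'I_n}) \subset B then coord w (trace_set B (enum_val i)) else 0).
apply/rowP=> k; rewrite AE (bigD1 [set enum_val j | j in enum_val k]) /=; last first.
  apply/eqP/setP=> a; rewrite inE; apply/imsetP/idP => [[b bk /enum_val_inj -> //]|ak].
  by exists a.
have trk : trace_set B [set enum_val j | j in enum_val k] = enum_val k.
  apply/setP=> a; rewrite inE; apply/imsetP/idP => [[b bk /enum_val_inj -> //]|ak].
  by exists a.
rewrite {1}/coord mxE enum_rankK trk ifT; last first.
  by apply/fintype.subsetP=> i /imsetP[a _ ->]; apply: enum_valP.
rewrite /coord enum_valK big1 ?addr0 // => I /andP[/eqP tI nI].
rewrite mxE enum_rankK; case: ifP => // IB; case/eqP: nI.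
by rewrite -tI trace_setE; apply/esym/setIidPl.
Qed.

End Genericity.

(** * Critical points on the cone *)

Section Implicit.
Variables (R : realType) (r : nat).
Local Notation C := R[i].
Implicit Types (T : 'M[C]_r) (w p v : subset_vec C r) (I : {set 'I_r}).

(** For r at most 2 all sets are small, so the coordinates on the cone are algebraically
    independent. *)
Lemma small_vanishing F : (r <= 2)%N -> vanishing_ideal (@dpp_variety R r) F -> F = 0.
Proof.
move=> r2 VF; have small I : (#|I| <= 2)%N.
  by apply: leq_trans r2; have := max_card (mem I); rewrite card_ord.
pose G := F \mPo [tuple 'X_(small_index (enum_val k : {set 'I_r})) | k < #|{set 'I_r}|].
have GE (p : subset_vec C r) : F.@[p 0] = (G \mPo
    [tuple 'X_(enum_rank (small_set k)) | k < (cone_dim r).+1]).@[p 0].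
  rewrite !comp_mpoly_meval; apply: meval_eq => k.
  by rewrite tnth_mktuple mevalXU tnth_mktuple mevalXU small_indexK // enum_valK.
have G0 : G = 0 by apply: dpp_coordinates_independent => p /VF; rewrite GE.
apply: mpoly_all0 => v; have := GE (\row_k v k); rewrite G0 comp_mpoly0 meval0 => <-.
by apply: meval_eq => k; rewrite mxE.
Qed.

Lemma small_tangent p v : (r <= 2)%N -> cone_tangent (@dpp_variety R r) p v.
Proof.
move=> r2 F /(small_vanishing r2) ->.
by rewrite big1 // => k _; rewrite linear0 meval0 mul0r.
Qed.

(** For r > 2 a disconnected T would give a singular point. For r at most 2 every vector is tangent,
    so all partial derivatives vanish, w is a multiple of the minors, and a cut between i and j
    contradicts [nondegenerate]. *)
Lemma implicit_connected w T c : T^T = T -> c != 0 -> nondegenerate w ->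
  implicit_critical w (cone_pt c T) -> connected_mx T.
Proof.
move=> symT c0 ndw critT; have [r2|r2] := leqP r 2; last first.
  have [[pT _] _] := implicit_criticalP symT c0 critT.
  have [[_ nsT] _ _ _] := critT.
  by apply: disconnected_singular nsT => //; rewrite -pmT; exact: pT.
have [_ pn0 _ crit] := critT.
have partial0 I : implicit_partial w (cone_pt c T) I = 0.
  have := crit _ (small_tangent (cone_pt c T) (delta_mx 0 (enum_rank I)) r2).
  rewrite (bigD1 I) //= big1 ?addr0 => [|J nJI]; rewrite /coord mxE eqxx.
    by rewrite eqxx mulr1.
  by rewrite (inj_eq enum_rank_inj) (negbTE nJI) mulr0.
pose a := (\sum_J coord w J) / (\sum_J coord (cone_pt c T) J).
have wE I : coord w I = a * (c * pm T I).
  have /eqP := partial0 I; rewrite subr_eq0 => /eqP E.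
  by rewrite /a -E -coord_cone_pt divfK.
move=> B sB; have [->|/set0Pn[i iB]] := eqVneq B set0; [by left | right].
apply/setP=> j; rewrite [RHS]inE; apply: contraT => jB.
have nij : i != j by apply: contraNneq jB => <-.
case: (ndw i j nij); rewrite !wE pm0 pm2 // !pm1 (sB i j) // mul0r subr0 mulr1.
have alg (K : comNzRingType) (b d x y : K) : b * d * (b * (d * (x * y)))
    = b * (d * x) * (b * (d * y)) by ring.
exact: alg.
Qed.

End Implicit.

(** * Matrices over a critical line *)

Section Lines.
Variables (R : realType) (r : nat).
Local Notation C := R[i].
Implicit Types (T : 'M[C]_r) (w p v : subset_vec C r) (I : {set 'I_r}).

Lemma vline_scale a v : a != 0 -> <[a *: v]>%VS = <[v]>%VS.
Proof.
move=> a0; apply/eqP; rewrite eqEsubv -!memvE memvZ ?memv_line //=.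
by rewrite -{1}[v]scale1r -(mulVf a0) -scalerA memvZ ?memv_line.
Qed.

Lemma dpp_point_pm T T' : (forall I, pm T I = pm T' I) -> dpp_point T = dpp_point T'.
Proof.
move=> E; apply: coordK => I; rewrite !dpp_pointE E; congr (_ / _).
by rewrite -!sum_pm; apply: eq_bigr.
Qed.

Lemma implicit_critical_add1 w T :
  implicit_critical w (dpp_point T) -> \det (T + 1%:M) != 0.
Proof.
case=> _ /(_ set0) pn0 _ _; apply: contraNneq pn0 => E.
by rewrite dpp_pointE E invr0 mulr0.
Qed.

Lemma implicit_point_connected w T : T^T = T -> nondegenerate w ->
  implicit_critical w (dpp_point T) -> connected_mx T.
Proof.
move=> symT ndw crit; have d0 := implicit_critical_add1 crit.
by apply: implicit_connected symT (invr_neq0 d0) ndw _; rewrite -dpp_point_cone.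
Qed.

(** At a critical point the coordinate of the empty set is nonzero, so [onV_cone] supplies a matrix;
    the representative is then rescaled to have coordinate sum 1. *)
Lemma implicit_line w (L : {vspace subset_vec C r}) : (0 < r)%N -> nondegenerate w ->
  proj_points (implicit_critical w) L ->
  exists T, [/\ T^T = T, implicit_critical w (dpp_point T) & L = <[dpp_point T]>%VS].
Proof.
move=> r0 ndw [p crit ->]; have [[/dpp_varietyP[_ Vp] _] /(_ set0) p0 _ _] := crit.
have [T symT pT] := onV_cone Vp p0.
have pE : p = cone_pt (coord p set0) T by apply: coordK => I; rewrite coord_cone_pt.
move: crit p0; rewrite pE; move: (coord p set0) => c crit; rewrite coord_cone_pt pm0 mulr1 => c0.
have [regT E] := implicit_criticalP symT c0 crit; have [_ d0] := regT.
have cT := implicit_connected symT c0 ndw crit.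
exists T; split=> //; rewrite dpp_point_cone.
  exact: (connected_implicit_critical symT (invr_neq0 d0) r0 cT regT E).
have -> : cone_pt c T = (c * \det (T + 1%:M)) *: cone_pt (\det (T + 1%:M))^-1 T.
  apply/rowP=> k; rewrite !mxE; move: (\det _) d0 (pm T _) => x x0 y.
  by rewrite mulrA mulfK.
exact: (vline_scale _ (mulf_neq0 c0 d0)).
Qed.

Definition flip (S : {set 'I_r}) T : 'M[C]_r :=
  \matrix_(i, j) ((-1) ^+ (i \in S) * T i j * (-1) ^+ (j \in S)).

Lemma pm_flip S T I : pm (flip S T) I = pm T I.
Proof.
rewrite /flip (pm_scale T (fun i => (-1) ^+ (i \in S)) (fun i => (-1) ^+ (i \in S))).
by rewrite big1 ?mul1r // => i _; rewrite -signr_addb addbb.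
Qed.

Lemma flip_sym S T : T^T = T -> (flip S T)^T = flip S T.
Proof.
move=> symT; apply/matrixP=> i j; rewrite !mxE (sym_entry j i symT).
by rewrite mulrC mulrA mulrAC.
Qed.

(** The indices on which S and S' agree form a cut: across it the two flips give T_ij = - T_ij. The
    cut contains o, so by connectedness it is everything. *)
Lemma flip_inj (o : 'I_r) (S S' : {set 'I_r}) T : connected_mx T -> o \notin S -> o \notin S' ->
  flip S T = flip S' T -> S = S'.
Proof.
move=> cT oS oS' E; pose D := [set k | (k \in S) == (k \in S')].
have oD : o \in D by rewrite inE (negbTE oS) (negbTE oS').
have sD : separated D T.
  move=> i j; rewrite !inE => /eqP iS jS; have /matrixP/(_ i j) := E; rewrite !mxE iS ![_ * T i j]mulrC.
  have neg (x y : C) : y != 0 -> x * y = - (x * y) -> x = 0.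
    move=> y0 /eqP; rewrite -subr_eq0 opprK -mulr2n mulrn_eq0 /= mulf_eq0 (negbTE y0) orbF.
    by move=> /eqP.
  move=> Ts; apply: (neg _ ((-1) ^+ (i \in S'))); rewrite ?signr_eq0 //.
  move: jS Ts; case: (j \in S); case: (j \in S') => //= _;
    rewrite expr0 expr1 mulr1 mulrN1 // => <-.
have [D0|DT] := cT D sD; first by rewrite D0 inE in oD.
by apply/setP=> k; have : k \in D; [rewrite DT inE | rewrite inE => /eqP].
Qed.

Lemma flip_surj (o : 'I_r) T T' : T^T = T -> \det T != 0 -> connected_mx T ->
  T'^T = T' -> (forall I, pm T' I = pm T I) -> exists2 S : {set 'I_r}, o \notin S & flip S T = T'.
Proof.
move=> symT detT cT symT' E; have [_ _ rT] := connected_rigid o symT detT cT.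
(* Dividing the signs by d_o changes nothing in the conjugation and keeps o out of S. *)
have [d [dd T'E]] := rT T' symT' E; exists [set k | d k != d o]; first by rewrite inE eqxx.
have sE k : (-1) ^+ (k \in [set k | d k != d o]) = d k * d o.
  rewrite inE; have N1 : (1 == - 1 :> C) = false.
    by rewrite -subr_eq0 opprK -(mulr2n 1) pnatr_eq0.
  by case: (dd k) => ->; case: (dd o) => ->;
    rewrite ?eqxx ?N1 1?eq_sym ?N1 /= ?mulrNN ?mulr1 ?mul1r ?expr0 ?expr1.
have oo : d o * d o = 1 by case: (dd o) => ->; rewrite ?mulrNN mulr1.
have alg (K : comNzRingType) (x y z e : K) : x * e * y * (z * e) = x * y * z * (e * e).
  by ring.
by apply/matrixP=> i j; rewrite mxE !sE T'E alg oo mulr1.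
Qed.

End Lines.

Section Orbits.
Variables (R : realType) (r : nat).
Local Notation C := R[i].

(** Flips by S and by its complement coincide; requiring that S avoid o selects one of them, which
    leaves 2^(r-1) matrices over each line. *)
Lemma implicit_listing (w : subset_vec C r) m : (0 < r)%N -> nondegenerate w ->
  (proj_points (implicit_critical w) #= `I_m)%card ->
  exists s, listing (fun T : 'M[C]_r => T^T = T /\ implicit_critical w (dpp_point T))
    (2 ^ r.-1 * m) s.
Proof.
move=> r0 ndw /card_listingP[lines [uniq_lines size_lines linesP]].
pose o : 'I_r := Ordinal r0.
have line k : exists T : 'M[C]_r, [/\ T^T = T, implicit_critical w (dpp_point T)
    & nth 0%VS lines (k : 'I_m) = <[dpp_point T]>%VS].
  by apply: (implicit_line r0 ndw); apply/linesP; rewrite mem_nth ?size_lines.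
have [T TP] := boolp.choice line.
pose P := [pred x : 'I_m * {set 'I_r} | o \notin x.2].
have cardP : #|P| = (2 ^ r.-1 * m)%N.
  rewrite (eq_card (B := predX predT (mem (powerset [set~ o])))) => [|[k S]]; last first.
    by rewrite !inE /= -disjoints_subset disjoint_sym disjoints1.
  by rewrite cardX card_ord card_powerset cardsC1 card_ord mulnC.
rewrite -cardP.
have dppE k S : dpp_point (flip S (T k)) = dpp_point (T k).
  by apply: dpp_point_pm => I; rewrite pm_flip.
apply: (listing_image (g := fun x => flip x.2 (T x.1))) => [[k S] [l S']|T'].
  rewrite !inE /= => oS oS' E.
  have kl : k = l.
    have [_ _ Lk] := TP k; have [_ _ Ll] := TP l.
    apply/val_inj/eqP; rewrite /= -(nth_uniq 0%VS _ _ uniq_lines) ?size_lines //.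
    by rewrite Lk Ll -(dppE k S) E dppE.
  rewrite -kl in E *; have [symT crit _] := TP k.
  by rewrite (flip_inj (implicit_point_connected symT ndw crit) oS oS' E).
split=> [[symT' crit']|[[k S] _ <-]] /=; last first.
  have [symT crit _] := TP k.
  by split; [exact: flip_sym | rewrite dppE; exact: crit].
have L' : <[dpp_point T']>%VS \in lines.
  apply: (linesP _).1; exists (dpp_point T'); [exact: crit' | exact: erefl].
have kP : (index <[dpp_point T']>%VS lines < m)%N by rewrite -size_lines index_mem.
have [symT crit kE] := TP (Ordinal kP).
have LE := etrans (esym (nth_index 0%VS L')) kE.
set k := Ordinal kP in symT crit LE.
have d0 := implicit_critical_add1 crit; have d0' := implicit_critical_add1 crit'.
have pmE I : pm T' I = pm (T k) I.
  have /vlineP[a aE] : dpp_point T' \in <[dpp_point (T k)]>%VS by rewrite -LE memv_line.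
  have cE J : pm T' J / \det (T' + 1%:M) = a * (pm (T k) J / \det (T k + 1%:M)).
    by rewrite -!dpp_pointE aE /coord mxE.
  have := cE set0; rewrite !pm0 !mul1r => a0; have := cE I; rewrite mulrCA -a0.
  by move=> /(mulIf (invr_neq0 d0')).
have connT := implicit_point_connected symT ndw crit.
have detT : \det (T k) != 0.
  have [_ /(_ setT)] := crit; rewrite dpp_pointE pmT mulf_eq0 negb_or => /andP[-> //].
have [S oS SE] := flip_surj o symT detT connT symT' pmE.
by exists (k, S).
Qed.

End Orbits.

(** * Counting critical points *)

Section Counting.
Variables (R : realType) (n : nat).
Local Notation C := R[i].
Implicit Types (T : 'M[C]_n) (B : {set 'I_n}) (P : {set {set 'I_n}}).

(** No edge leaves a block, and inside a connected block the vertices reachable from i form a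
    trivial cut; hence reachability is membership in the same block. Distinct partitions thus yield
    distinct critical matrices. *)
Lemma components_uniq T P : T^T = T -> finset.partition P setT ->
  block_diagonal P T -> (forall B, B \in P -> connected_mx (psubmx T B)) ->
  components T = P.
Proof.
move=> symT partP bdT connT; have [/eqP covP trP _] := and3P partP.
rewrite -[RHS](equivalence_partition_pblock partP).
have blockE i j : connect (support_rel T) i j = (j \in pblock P i).
  have iP : i \in cover P by rewrite covP inE.
  have BP : pblock P i \in P by apply: pblock_mem.
  have iB : i \in pblock P i by rewrite mem_pblock.
  apply/idP/idP=> [|jB].
    have clB : closed (support_rel T) (mem (pblock P i)).
      apply: (intro_closed (support_connect_sym symT)) => a b /= Tab aB.
      by apply: contraNT Tab => bB; rewrite (bdT _ _ _ BP aB bB).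
    by move=> /(closed_connect clB) /= <-.
  pose D := [set a : 'I_#|pblock P i| | connect (support_rel T) i (enum_val a)].
  have [a b||DT] := connT _ BP D.
  - rewrite !inE mxE => ia; apply: contraNeq => Tab.
    by apply: connect_trans ia _; apply: connect1.
  - move=> /setP/(_ (enum_rank_in iB i)).
    by rewrite !inE enum_rankK_in // connect0.
  have := in_setT (enum_rank_in jB j).
  by rewrite -DT inE enum_rankK_in.
apply: eq_in_imset => i _; apply/setP=> j; rewrite !inE; exact: blockE.
Qed.

Lemma extend_psubmx T B i j :
  extend_block (psubmx T B) i j = if (i \in B) && (j \in B) then T i j else 0.
Proof.
case: ifP => [/andP[iB jB]|/negbT]; last exact: extend_outside.
have /matrixP/(_ (enum_rank_in iB i) (enum_rank_in jB j)) := psubmx_extend (psubmx T B).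
by rewrite !mxE !enum_rankK_in.
Qed.

Section BlockSum.
Variables (P : {set {set 'I_n}}) (X : {set 'I_n} -> 'M[C]_n).
Hypotheses (partP : finset.partition P setT)
  (supp : forall B, B \in P -> forall i j, ~~ ((i \in B) && (j \in B)) -> X B i j = 0).

Lemma block_sumE B i j : B \in P -> i \in B -> (\sum_(A in P) X A) i j = X B i j.
Proof.
have [_ trP _] := and3P partP; move=> BP iB; rewrite summxE (bigD1 B) //= big1 ?addr0 //.
move=> A /andP[AP nAB]; apply: supp => //; apply: contraNN nAB => /andP[iA _].
by rewrite -(def_pblock trP AP iA) (def_pblock trP BP iB).
Qed.

Lemma psubmx_block_sum B : B \in P -> psubmx (\sum_(A in P) X A) B = psubmx (X B) B.
Proof.
by move=> BP; apply/matrixP=> i j; rewrite mxE (block_sumE _ BP) ?enum_valP // mxE.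
Qed.

Lemma block_sum_diagonal : block_diagonal P (\sum_(A in P) X A).
Proof.
by move=> B i j BP iB jB; rewrite (block_sumE j BP iB) supp // iB (negbTE jB).
Qed.

End BlockSum.

Lemma block_decomposition T P : finset.partition P setT -> T^T = T ->
  block_diagonal P T -> \sum_(B in P) extend_block (psubmx T B) = T.
Proof.
move=> partP symT bdT; have [/eqP covP trP _] := and3P partP.
apply/matrixP=> i j; have iP : i \in cover P by rewrite covP inE.
have BP : pblock P i \in P by apply: pblock_mem.
have iB : i \in pblock P i by rewrite mem_pblock.
rewrite (block_sumE partP _ j BP iB) => [|B _ a b]; last exact: extend_outside.
rewrite extend_psubmx iB /=; case: ifPn => // jB.
by rewrite (bdT _ _ _ BP iB jB).
Qed.

Definition block_critical (u : subset_vec C n) B (T : 'M[C]_#|B|) : Prop :=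
  T^T = T /\ implicit_critical (marginal u B) (dpp_point T).

Lemma block_listings (u : subset_vec C n) (k : {set 'I_n} -> nat) :
  (forall B, B != set0 -> exists s, listing (block_critical u (B := B)) (k B) s) ->
  exists s : {set 'I_n} -> seq 'M[C]_n, forall B, B != set0 ->
    listing (fun X => exists2 T : 'M[C]_#|B|, block_critical u T & X = extend_block T) (k B) (s B).
Proof.
move=> h; have h' B : exists s : seq 'M[C]_n, B != set0 ->
    listing (fun X => exists2 T : 'M[C]_#|B|, block_critical u T & X = extend_block T) (k B) s.
  have [->|B0] := eqVneq B set0; first by exists [::].
  have [s [us ss sP]] := h B B0; exists (map (@extend_block _ _ B) s) => _; split.
  - by rewrite map_inj_uniq //; apply: (can_inj (@psubmx_extend _ _ B)).
  - by rewrite size_map.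
  move=> X; split=> [[T /sP Ts ->]|/mapP[T /sP Ts ->]]; first exact: map_f.
  by exists T.
by have [s sP] := boolp.choice h'; exists s.
Qed.

(** A critical matrix corresponds to its partition into components together with the position of
    each diagonal block in the list of solutions for that block. *)
Lemma critical_listing (u : subset_vec C n) (k : {set 'I_n} -> nat) :
  (forall B, B != set0 -> nondegenerate (marginal u B)) ->
  (forall B, B != set0 -> exists s, listing (block_critical u (B := B)) (k B) s) ->
  exists s, listing (critical_point u)
    (\sum_(P : {set {set 'I_n}} | finset.partition P setT) \prod_(B in P) k B) s.
Proof.
(* One bound on all block counts lets the positions in all lists share a single finite type. *)
move=> ndu /block_listings[s sP]; pose M := \max_B k B.
have block_neq0 P B : finset.partition P setT -> B \in P -> B != set0.
  by case/and3P=> _ _ P0; apply: contraTneq => ->.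
pose F (B : {set 'I_n}) := [pred a : 'I_M.+1 | (a < k B)%N].
(* Off the blocks of the partition the position is the default [ord0], so that f is determined by
   the matrix. *)
pose D := [pred x : {set {set 'I_n}} * {ffun {set 'I_n} -> 'I_M.+1} |
  finset.partition x.1 setT && (x.2 \in pfamily ord0 (mem x.1) F)].
have cardD : #|D| = (\sum_(P : {set {set 'I_n}} | finset.partition P setT) \prod_(B in P) k B)%N.
  rewrite -sum1_card; transitivity (\sum_(P : {set {set 'I_n}} | finset.partition P setT)
      \sum_(f | f \in pfamily ord0 (mem P) F) 1)%N.
    by rewrite pair_big_dep; apply: eq_bigl.
  apply: eq_bigr => P _; rewrite sum1_card card_pfamily foldrE big_image.
  apply: eq_bigr => B _; rewrite -sum1_card /=.
  have kM : (k B <= M.+1)%N by apply: leqW; apply: leq_bigmax.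
  by rewrite (big_ord_narrow kM) sum1_card card_ord.
rewrite -cardD.
pose x_ (f : {ffun {set 'I_n} -> 'I_M.+1}) B := nth 0 (s B) (f B).
have xP P f B : D (P, f) -> B \in P -> exists2 T : 'M[C]_#|B|, block_critical u T & x_ f B = extend_block T.
  move=> /andP[/= partP /pfamilyP[_ fP]] BP; have [_ ss sB] := sP B (block_neq0 P B partP BP).
  by apply/sB; rewrite mem_nth // ss; apply: fP.
have supp P f B : D (P, f) -> B \in P -> forall i j, ~~ ((i \in B) && (j \in B)) -> x_ f B i j = 0.
  by move=> Df BP; have [T _ ->] := xP P f B Df BP; apply: extend_outside.
pose g (x : {set {set 'I_n}} * {ffun {set 'I_n} -> 'I_M.+1}) := \sum_(B in x.1) x_ x.2 B.
have gB P f B : D (P, f) -> B \in P -> x_ f B = extend_block (psubmx (g (P, f)) B).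
  move=> Df BP; have [partP _] := andP Df; rewrite (psubmx_block_sum partP) //.
    by have [T _ ->] := xP P f B Df BP; rewrite psubmx_extend.
  by move=> A AP; apply: supp Df AP.
have gcrit P f B : D (P, f) -> B \in P -> block_critical u (psubmx (g (P, f)) B).
  move=> Df BP; have := gB P f B Df BP; have [T critT ->] := xP P f B Df BP.
  by move=> /(congr1 (fun X => psubmx X B)); rewrite !psubmx_extend => <-.
have gsym P f : D (P, f) -> (g (P, f))^T = g (P, f).
  move=> Df; rewrite /g /= linear_sum /=; apply: eq_bigr => B BP.
  by have [T [symT _] ->] := xP P f B Df BP; apply: extend_sym.
have gdiag P f : D (P, f) -> block_diagonal P (g (P, f)).
  move=> Df; have [partP _] := andP Df; apply: block_sum_diagonal partP _ => A AP.
  exact: supp Df AP.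
have gcomp P f : D (P, f) -> components (g (P, f)) = P.
  move=> Df; have [partP _] := andP Df.
  apply: (components_uniq (gsym P f Df) partP (gdiag P f Df)) => B BP.
  have [symB critB] := gcrit P f B Df BP.
  exact: implicit_point_connected symB (ndu B (block_neq0 P B partP BP)) critB.
apply: (listing_image (g := g)) => [[P f] [P' f'] Df Df' E|T].
  have PP : P = P' by rewrite -(gcomp P f Df) E gcomp.
  rewrite -PP in Df' E *; congr pair; apply/ffunP=> B.
  have [/= partP /pfamilyP[f0 fP]] := andP Df; have [/= _ /pfamilyP[f0' fP']] := andP Df'.
  have [BP|BP] := boolP (B \in P); last first.
    have off (h : {ffun {set 'I_n} -> 'I_M.+1}) :
        (ord0.-support h \subset mem P) -> h B = ord0.
      by move=> /fintype.subsetP/(_ B)/contraNeq; apply.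
    by rewrite (off f f0) (off f' f0').
  have [us ss _] := sP B (block_neq0 P B partP BP).
  apply/val_inj/eqP; rewrite /= -(nth_uniq 0 _ _ us) ?ss; [|exact: fP|exact: fP'].
  by apply/eqP; rewrite -![nth _ _ _]/(x_ _ B) (gB P f B Df BP) E -(gB P f' B Df' BP).
split=> [critT|[[P f] Df <-]]; last first.
  have [partP _] := andP Df.
  apply: (critical_of_blocks (gsym P f Df) partP (gdiag P f Df)) => B BP.
  by have [] := gcrit P f B Df BP.
have [symT _ _ _] := critT; have partP := components_partition symT.
have bT B : B \in components T -> (index (extend_block (psubmx T B)) (s B) < k B)%N /\
    extend_block (psubmx T B) \in s B.
  move=> BP; have [_ ss sB] := sP B (block_neq0 _ B partP BP).
  have Xs : extend_block (psubmx T B) \in s B.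
    apply: (sB _).1; exists (psubmx T B) => //; split; first exact: psubmx_sym.
    exact: blocks_of_critical critT BP.
  by rewrite -ss index_mem.
pose f : {ffun {set 'I_n} -> 'I_M.+1} := [ffun B => if B \in components T
  then inord (index (extend_block (psubmx T B)) (s B)) else ord0].
have fE B : B \in components T -> f B = index (extend_block (psubmx T B)) (s B) :> nat.
  move=> BP; rewrite ffunE BP inordK //; have [kB _] := bT B BP.
  by apply: leq_trans kB _; apply: leqW; apply: leq_bigmax.
exists (components T, f).
  rewrite /= partP; apply/pfamilyP; split.
    by apply/fintype.subsetP=> B; apply: contraNT => BP; rewrite ffunE (negbTE BP).
  by move=> B BP; rewrite inE fE //; have [] := bT B BP.
rewrite -[RHS](block_decomposition partP symT (components_block_diagonal symT)).
apply: eq_bigr => B BP; rewrite /x_ /= fE // nth_index //.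
by have [] := bT B BP.
Qed.

End Counting.

Lemma nondegenerate_complexify (R : realType) r (w : subset_vec R r) :
  nondegenerate w -> nondegenerate (complexify w).
Proof.
move=> ndw i j nij; rewrite !coord_complexify -!rmorphM => /complexI.
exact: ndw.
Qed.

Lemma generically_block (R : realType) n (B : {set 'I_n}) m :
  is_ml_degree R #|B| m ->
  generically (fun u : subset_vec R n => nondegenerate (marginal (complexify u) B) /\
    (proj_points (implicit_critical (marginal (complexify u) B)) #= `I_m)%card).
Proof.
move=> mlB; have [A [AE surjA]] := marginal_linear R B.
have := generically_linear surjA (generically_and (@generically_nondegenerate R #|B|) mlB).
by apply: generically_imp => u [/nondegenerate_complexify]; rewrite AE.
Qed.

Local Open Scope complex_scope.
Local Open Scope classical_set_scope.

Theorem theorem3p1 (R : realType) (n : nat) (n_gt0 : (0 < n)%N)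
    (mu : nat -> nat)
    (mu_ml_degree : forall r : nat, (0 < r <= n)%N -> is_ml_degree R r (mu r)) :
  (forall (u : subset_vec R[i] n) (T : 'M[R[i]]_n),
     critical_point u T <->
     T^T = T /\
     exists P : {set {set 'I_n}},
       [/\ finset.partition P [set: 'I_n]%SET,
           block_diagonal P T
         & forall B : {set 'I_n}, B \in P ->
             implicit_critical (marginal u B) (dpp_point (psubmx T B))]) /\
  generically (fun u : subset_vec R n =>
    ([set T : 'M[R[i]]_n | critical_point (complexify u) T] #=
      `I_(\sum_(P : {set {set 'I_n}} | finset.partition P [set: 'I_n]%SET)
            \prod_(B in P) (2 ^ #|B|.-1 * mu #|B|))%N)%card).
Proof.
split=> [u T|].
  split=> [critT|[symT [P [partP bdT critP]]]]; last exact: critical_of_blocks critP.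
  have [symT _ _ _] := critT; split=> //; exists (components T); split=> [||B BT].
  - exact: components_partition.
  - exact: components_block_diagonal.
  exact: blocks_of_critical critT BT.
(* Finitely many conditions, one for each B, so that one generic u serves every partition at
   once. *)
have generic_block (B : {set 'I_n}) : generically (fun u : subset_vec R n => B != set0%SET ->
    nondegenerate (marginal (complexify u) B) /\
    (proj_points (implicit_critical (marginal (complexify u) B)) #= `I_(mu #|B|))%card).
  have [->|B0] := eqVneq B set0%SET.
    by apply: (@generically_poly _ _ 1 0) => //; rewrite meval1 oner_eq0.
  have B1 : (0 < #|B| <= n)%N.
    by rewrite card_gt0 B0 /=; have := max_card (mem B); rewrite card_ord.
  by apply: generically_imp (generically_block (mu_ml_degree _ B1)).
apply: generically_imp (generically_all generic_block) => u ublock.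
apply/card_listingP; apply: critical_listing => B B0; first by have [] := ublock B B0.
have [ndB cardB] := ublock B B0.
by apply: implicit_listing ndB cardB; rewrite card_gt0.
Qed.
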